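(* Let $\tau\colon H\twoheadrightarrow G$ and $\tau'\colon H'\twoheadrightarrow G$ be fundamental epimorphisms of profinite groups. (1) $\tau$ dominates $\tau'$ (i.e. there is an epimorphism $\psi\colon H\twoheadrightarrow H'$ with $\tau=\tau'\circ\psi$) if and only if: (1a) $\operatorname{mult}_\lambda(\tau')\le\operatorname{mult}_\lambda(\tau)$ for every $\lambda\in\Lambda(G)$; and (1b) $\operatorname{supp}_A(\tau')\subseteq\operatorname{supp}_A(\tau)$ for every $A\in\Lambda_{\mathrm{ab}}(G)$. (2) $\tau'\cong_G\tau$ if and only if: (2a) $\operatorname{mult}_\lambda(\tau')=\operatorname{mult}_\lambda(\tau)$ for every $\lambda\in\Lambda(G)$; and (2b) $\operatorname{supp}_A(\tau')=\operatorname{supp}_A(\tau)$ for every $A\in\Lambda_{\mathrm{ab}}(G)$.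
   Context: All groups are profinite, homomorphisms are continuous, subgroups are closed; $\twoheadrightarrow$ denotes an epimorphism. Epimorphisms $\eta\colon H\twoheadrightarrow G$, $\rho\colon E\twoheadrightarrow G$ are isomorphic, $\eta\cong_G\rho$, if there is an isomorphism $\psi\colon H\to E$ with $\eta=\rho\circ\psi$. An epimorphism is indecomposable if it is not an isomorphism and is not a composition of two epimorphisms neither of which is an isomorphism. For $M\triangleleft H$, $\mathcal{N}_M(H)$ is the set of maximal elements among the normal subgroups of $H$ strictly contained in $M$. The fundament kernel of $\tau\colon H\twoheadrightarrow G$ is $\mathcal{M}(\tau)=\bigcap_{N\in\mathcal{N}_{\operatorname{Ker}\tau}(H)}N$ (equal to $\operatorname{Ker}\tau$ if the latter is $1$); $\tau$ is fundamental if $\mathcal{M}(\tau)=1$. $\Lambda_{\mathrm{ab}}(G)$ is the set of isomorphism classes of finite simple $G$-modules; $\Lambda_{\mathrm{na}}(G)$ is a set of representatives of the isomorphism classes of indecomposable epimorphisms onto $G$ with non-abelian kernel; $\Lambda(G)=\Lambda_{\mathrm{ab}}(G)\sqcup\Lambda_{\mathrm{na}}(G)$. An abelian kernel of an epimorphism onto $G$ is a $G$-module via conjugation. For $\zeta\in\Lambda_{\mathrm{na}}(G)$, $\operatorname{mult}_\zeta(\tau)=|\{N\triangleleft H : N\le\operatorname{Ker}\tau,\ (H/N\twoheadrightarrow G)\cong_G\zeta\}|$. For $A\in\Lambda_{\mathrm{ab}}(G)$ with finite field $F_A=\operatorname{End}_G(A)$, let $\mathcal{C}_A=\{N\triangleleft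 H : N\le\operatorname{Ker}\tau,\ \operatorname{Ker}\tau/N\cong_G A\}$ (in particular $\operatorname{Ker}\tau/N$ is abelian), $N_A=\bigcap_{N\in\mathcal{C}_A}N$ ($=\operatorname{Ker}\tau$ if $\mathcal{C}_A=\emptyset$), $H_A=H/N_A$, $B_A=\operatorname{Ker}(H_A\twoheadrightarrow G)=\operatorname{Ker}\tau/N_A$ (a profinite $G$-module), $f_A\in H^2(G,B_A)$ (continuous cohomology) the class of $1\to B_A\to H_A\to G\to1$, $B_A^*=\operatorname{Hom}_G(B_A,A)$ (continuous; an $F_A$-vector space), and $S_A\colon B_A^*\to H^2(G,A)$, $\phi\mapsto\phi_*(f_A)$. Then $\operatorname{mult}_A(\tau)=\dim_{F_A}\operatorname{Ker}S_A$ and $\operatorname{supp}_A(\tau)=\operatorname{Im}S_A$. *)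

(* Defs.v *)
From HB Require Import structures.
From mathcomp Require Import all_boot all_order all_algebra.
From mathcomp Require Import all_classical topology tvs.
Set Implicit Arguments.
Unset Strict Implicit.
Unset Printing Implicit Defensive.

Import GRing.Theory.
Local Open Scope classical_set_scope.
Local Open Scope quotient_scope.
Local Open Scope card_scope.
Local Open Scope group_scope.

HB.mixin Record isTopologicalGroup G of Group G & Topological G := {
  mulg_continuous : continuous (fun x : G * G => x.1 * x.2);
  invg_continuous : continuous (fun x : G => x^-1)
}.

#[short(type="topologicalGroupType")]
HB.structure Definition TopologicalGroup :=
  {G of Group G & Topological G & isTopologicalGroup G}.

HB.mixin Record isProfinite G of Topological G := {
  profinite_compact : compact [set: G];
  profinite_hausdorff : hausdorff_space G;
  profinite_totally_disconnected : totally_disconnected [set: G]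
}.

#[short(type="profiniteGroupType")]
HB.structure Definition ProfiniteGroup :=
  {G of TopologicalGroup G & isProfinite G}.

(* The lemmas up to quotient_totally_disconnected are only needed to make the
   quotient of a profinite group by a closed normal subgroup profinite. *)
Section ZeroDimensional.
Variable T : topologicalType.
Hypotheses (cT : compact [set: T]) (hT : hausdorff_space T).

Lemma clopen_quasicomponent_connected (x : T) :
  connected (\bigcap_(C in [set C : set T | clopen C /\ C x]) C).
Proof.
set Q := \bigcap_(C in _) C => B [b Bb] [U oU BU] [V cV BV].
have cQ : closed Q by apply: closed_bigI => C [[]].
have cB : closed B by rewrite BV; exact: closedI.
have cA : closed (Q `&` ~` U) by apply: closedI => //; exact: open_closedC.
have Bdisj : B `<=` ~` (Q `&` ~` U) by move=> y; rewrite BU => -[Qy Uy] [].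
have nB : set_nbhs B (~` (Q `&` ~` U)).
  by move=> y /Bdisj By; apply: open_nbhs_nbhs; split => //; exact: closed_openC.
have [W nW clW] := compact_normal hT cT cB nB.
pose O := W°; have oO : open O by exact: open_interior.
have BO : B `<=` O by move=> y By; exact: nW.
have QO : Q `<=` O `|` ~` closure W.
  move=> y Qy; case: (pselect (U y)) => Uy; first by left; apply: BO; rewrite BU.
  by right=> /clW; apply.
pose F := filter_from [set C : set T | clopen C /\ C x] id.
have FF : Filter F.
  apply: filter_from_filter; first by exists setT; split => //; exact: clopenT.
  move=> C D [? ?] [? ?]; exists (C `&` D) => //; split => //; exact: clopenI.
have PF : ProperFilter F by apply: filter_from_proper; move=> C [? ?]; exists x.
have oOW : open (O `|` ~` closure W).
  apply: openU => //; apply: closed_openC; exact: closed_closure.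
have /(iffLR (compact_near_coveringP _)) : compact (~` (O `|` ~` closure W)).
  by apply: (subclosed_compact _ cT) => //; exact: open_closedC.
move=> /(_ _ _ setC (powerset_filter_from_filter PF))[].
  move=> y nOy.
  have : ~ Q y by move=> Qy; apply: nOy; exact: QO.
  move=> /existsNP [C] /not_implyP [[[oC kC] Cx] nCy].
  exists (~` C, [set D | D `<=` C]); first split.
  - by apply: open_nbhs_nbhs; split => //; exact: closed_openC.
  - apply/near_powerset_filter_fromP; first by move=> ? ?; exact: subset_trans.
    by exists C => //; exists C.
  - by case=> i j [? /subsetC]; apply.
move=> D [DF _ [C DC]]/(_ _ DC)/subsetC2 CO.
have [C0 [[oC0 kC0] C0x] C0C] := DF _ DC.
have {C0C}C0O : C0 `<=` O `|` ~` closure W by move=> y /C0C /CO.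
have WO y : O y -> closure W y by move=> /interior_subset/subset_closure.
have clO : closed (C0 `&` O).
  have -> : C0 `&` O = C0 `&` closure W.
    apply/seteqP; split=> y [C0y Oy]; split => //; first exact: WO.
    by have [//|/(_ Oy)] := C0O _ C0y.
  by apply: closedI => //; exact: closed_closure.
have clN : closed (C0 `&` ~` O).
  by apply: closedI => //; exact: open_closedC.
have opN : open (C0 `&` ~` O).
  have -> : C0 `&` ~` O = C0 `&` ~` closure W.
    apply/seteqP; split=> y [C0y Oy]; split => //; last by move=> /WO.
    by have [/Oy|] := C0O _ C0y.
  by apply: openI => //; apply: closed_openC; exact: closed_closure.
case: (pselect (O x)) => Ox.
  have QC : Q `<=` C0 `&` O.
    by move=> y; apply; split; [split => //; exact: openI|].
  rewrite BU; apply/seteqP; split=> [y []//|y Qy]; split => //.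
  apply: contrapT => nUy; have [_ /WO/clW] := QC _ Qy; exact.
have QC : Q `<=` C0 `&` ~` O by move=> y; apply; split.
have Qb : Q b by move: Bb; rewrite BU => -[].
by have [_] := QC _ Qb; case; exact: BO.
Qed.

Lemma totally_disconnected_zero_dimensional :
  totally_disconnected [set: T] -> zero_dimensional T.
Proof.
move=> tdT x y xny; apply: contrapT => nU.
pose Q := \bigcap_(C in [set C : set T | clopen C /\ C x]) C.
have Qy : Q y.
  by move=> C [clC Cx]; apply: contrapT => nCy; apply: nU; exists C.
have : connected_component [set: T] x y.
  by exists Q => //; split; [move=> C []|by []|exact: clopen_quasicomponent_connected].
by rewrite tdT // => yx; move: xny; rewrite yx eqxx.
Qed.

End ZeroDimensional.

Section TopologicalGroupTheory.
Variable G : topologicalGroupType.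

Lemma cvgMg (T : Type) (F : set_system T) (FF : Filter F) (f g : T -> G) a b :
  f x @[x --> F] --> a -> g x @[x --> F] --> b -> f x * g x @[x --> F] --> a * b.
Proof.
move=> fa gb.
apply: (@continuous2_cvg T G G G F FF f g (fun x y => x * y) a b _ fa gb).
exact: (@mulg_continuous G (a, b)).
Qed.

Lemma cvgVg (T : Type) (F : set_system T) (FF : Filter F) (f : T -> G) a :
  f x @[x --> F] --> a -> (f x)^-1 @[x --> F] --> a^-1.
Proof. by move=> fa; apply: continuous_cvg => //; exact: invg_continuous. Qed.

Lemma mulgl_continuous (a : G) : continuous (fun x => a * x).
Proof. by move=> x; apply: cvgMg; [exact: cvg_cst|exact: cvg_id]. Qed.

Lemma mulgr_continuous (a : G) : continuous (fun x => x * a).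
Proof. by move=> x; apply: cvgMg; [exact: cvg_id|exact: cvg_cst]. Qed.

End TopologicalGroupTheory.

Definition open_map (S T : topologicalType) (f : S -> T) :=
  forall U : set S, open U -> open (f @` U).

Lemma open_map_nbhs (S T : topologicalType) (f : S -> T) x (A : set S) :
  open_map f -> nbhs x A -> nbhs (f x) (f @` A).
Proof.
move=> of_; rewrite nbhsE => -[U [oU Ux] UA].
rewrite nbhsE; exists (f @` U); last exact: image_subset.
by split; [exact: of_|exists x].
Qed.

Section ProfiniteTheory.
Variable G : profiniteGroupType.

Lemma profinite_zero_dimensional : zero_dimensional G.
Proof.
apply: totally_disconnected_zero_dimensional.
- exact: profinite_compact.
- exact: profinite_hausdorff.
- exact: profinite_totally_disconnected.
Qed.

Lemma profinite_open_subgroup (W : set G) : nbhs 1 W ->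
  exists U : set G, [/\ nbhs 1 U, U `<=` W &
    [/\ U 1, forall x y, U x -> U y -> U (x * y) & forall x, U x -> U x^-1]].
Proof.
move=> nW.
have [C [C1 [oC cC]] CW] := zero_dimensional_cvg profinite_hausdorff
  profinite_zero_dimensional profinite_compact nW.
pose S := [set x | forall c, C c -> C (x * c)].
exists [set x | S x /\ S x^-1]; split; last split.
- have nS : nbhs 1 S.
    have cptC : compact C by exact: subclosed_compact profinite_compact _.
    have /compact_near_coveringP := cptC.
    move=> /(_ G (nbhs 1) (fun x c => C (x * c)) _); apply.
    move=> c Cc.
    have : nbhs (1 * c) C by apply: open_nbhs_nbhs; split => //; rewrite mul1g.
    move=> /(@mulg_continuous G (1, c)) [[A B] /= [A1 Bc] AB].
    exists (B, A); first by split.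
    by move=> [b a] [/= Bb Aa]; apply: (AB (a, b)).
  apply: filterI; first exact: nS.
  by apply: (@invg_continuous G 1); rewrite /= invg1.
- by move=> x [Sx _]; apply: CW; have := Sx 1 C1; rewrite mulg1.
- by split=> c; rewrite ?invg1 mul1g.
- move=> x y [Sx Sx'] [Sy Sy']; split=> c Cc.
    by rewrite -mulgA; apply/Sx/Sy.
  by rewrite invgM -mulgA; apply/Sy'/Sx'.
- by move=> x [Sx Sx']; split; rewrite // invgK.
Qed.

End ProfiniteTheory.

(* As everywhere below, subgroups are closed and homomorphisms continuous. *)
Record normalSubgroup (H : profiniteGroupType) := NormalSubgroup {
  normal_set :> set H;
  normal1 : normal_set 1;
  normalM : forall x y, normal_set x -> normal_set y -> normal_set (x * y);
  normalV : forall x, normal_set x -> normal_set x^-1;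
  normalJ : forall x y, normal_set x -> normal_set (x ^ y);
  normal_closed : closed normal_set
}.

Section Quotient.
Variables (H : profiniteGroupType) (K : normalSubgroup H).
Local Notation N := (normal_set K).

Definition coset_rel : rel H := fun x y => `[< N (x^-1 * y) >].

Lemma coset_rel_equiv : equiv_class_of coset_rel.
Proof.
split=> [x|x y|y x z].
- by apply/asboolP; rewrite mulVg; exact: normal1.
- by apply/asboolP/asboolP => /normalV; rewrite invgM invgK.
- move=> /asboolP xy /asboolP yz; apply/asboolP.
  by have := normalM xy yz; rewrite mulgA mulgK.
Qed.

Canonical coset_equiv := EquivRelPack coset_rel_equiv.
Canonical coset_encModRel := defaultEncModRel coset_rel.

Definition quotient_group : Type := quotient_topology {eq_quot coset_rel}.
HB.instance Definition _ := Topological.on quotient_group.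
HB.instance Definition _ := Quotient.on quotient_group.

Local Notation Q := quotient_group.

Lemma coset_eqP (x y : H) : \pi_Q x = \pi_Q y <-> N (x^-1 * y).
Proof.
split=> [/(@eqmodP _ coset_equiv)/asboolP //|Nxy].
by apply/(@eqmodP _ coset_equiv)/asboolP.
Qed.

Definition quotient_one : Q := \pi_Q 1.
Definition quotient_mul (x y : Q) : Q := \pi_Q (repr x * repr y).
Definition quotient_inv (x : Q) : Q := \pi_Q (repr x)^-1.

Lemma coset_repr (x : H) : N (x^-1 * repr (\pi_Q x)).
Proof. by apply/coset_eqP; rewrite reprK. Qed.

Lemma quotient_mulE x y : \pi_Q (x * y) = quotient_mul (\pi_Q x) (\pi_Q y).
Proof.
apply/coset_eqP.
have := normalM (normalJ y (coset_repr x)) (coset_repr y).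
by rewrite /conjg invgM !mulgA mulgK.
Qed.

Lemma quotient_invE x : \pi_Q x^-1 = quotient_inv (\pi_Q x).
Proof.
apply/coset_eqP; rewrite invgK.
have := normalJ x^-1 (normalV (coset_repr x)).
by rewrite /conjg invgM !invgK !mulgA mulgK.
Qed.

Lemma quotient_mulA : associative quotient_mul.
Proof.
elim/quotW=> x; elim/quotW=> y; elim/quotW=> z.
rewrite -(quotient_mulE y z) -(quotient_mulE x y).
by rewrite -(quotient_mulE x (y * z)) -(quotient_mulE (x * y) z) mulgA.
Qed.

Lemma quotient_mul1 : left_id quotient_one quotient_mul.
Proof. by elim/quotW=> x; rewrite -(quotient_mulE 1) mul1g. Qed.

Lemma quotient_1mul : right_id quotient_one quotient_mul.
Proof. by elim/quotW=> x; rewrite -(quotient_mulE x 1) mulg1. Qed.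

Lemma quotient_mulV : left_inverse quotient_one quotient_inv quotient_mul.
Proof. by elim/quotW=> x; rewrite -quotient_invE -(quotient_mulE x^-1 x) mulVg. Qed.

Lemma quotient_Vmul : right_inverse quotient_one quotient_inv quotient_mul.
Proof. by elim/quotW=> x; rewrite -quotient_invE -(quotient_mulE x x^-1) mulgV. Qed.

HB.instance Definition _ := isGroup.Build Q quotient_mulA
  quotient_mul1 quotient_1mul quotient_mulV quotient_Vmul.

Lemma pi_open : open_map (\pi_Q : H -> Q).
Proof.
move=> U oU; rewrite /open /= /quotient_open.
rewrite (_ : _ @^-1` _ = \bigcup_(n in N) ((fun x => x * n) @^-1` U)).
  apply: bigcup_open => n _; apply: open_comp => // x _.
  exact: mulgr_continuous.
apply/seteqP; split => [x [u Uu /esym/coset_eqP Nux]|x [n Nn Uxn]].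
  by exists (x^-1 * u) => //=; rewrite mulgA mulgV mul1g.
by exists (x * n) => //; apply/esym/coset_eqP; rewrite mulgA mulVg mul1g.
Qed.

Lemma quotient_mul_continuous : continuous (fun x : Q * Q => x.1 * x.2).
Proof.
case=> a b; elim/quotW: a => x; elim/quotW: b => y W.
rewrite /= -[_ * _]quotient_mulE => /(@pi_continuous _ Q (x * y)).
move=> /(@mulg_continuous H (x, y)) [[A B] /= [Ax By] AB].
exists (\pi_Q @` A, \pi_Q @` B).
  by split; apply: (open_map_nbhs pi_open).
move=> [_ _] [/= [a Aa <-] [b Bb <-]]; rewrite -[_ * _]quotient_mulE.
exact: (AB (a, b)).
Qed.

Lemma quotient_inv_continuous : continuous (fun x : Q => x^-1).
Proof.
elim/quotW=> x W; rewrite -[_^-1]quotient_invE => /(@pi_continuous _ Q x^-1).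
move=> /(@invg_continuous H x) /(open_map_nbhs pi_open); apply: filterS.
by move=> _ [a Wa <-]; rewrite /= -[_^-1]quotient_invE.
Qed.

HB.instance Definition _ := isTopologicalGroup.Build Q
  quotient_mul_continuous quotient_inv_continuous.

Lemma quotient_compact : compact [set: Q].
Proof.
have <- : (\pi_Q : H -> Q) @` [set: H] = [set: Q].
  by apply/seteqP; split=> // x _; exists (repr x); rewrite ?reprK.
apply: continuous_compact; last exact: profinite_compact.
by apply: continuous_subspaceT; exact: pi_continuous.
Qed.

Lemma quotient_zero_dimensional : zero_dimensional Q.
Proof.
move=> a b; elim/quotW: a => x; elim/quotW: b => y xy.
have Nxy : ~ N (x^-1 * y) by move=> /coset_eqP xy'; rewrite xy' eqxx in xy.
have oN : nbhs (x^-1 * (1 * y)) (~` N).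
  rewrite mul1g; apply: open_nbhs_nbhs; split => //.
  by apply: closed_openC; exact: normal_closed.
have : nbhs 1 [set u | ~ N (x^-1 * (u * y))].
  have : continuous (fun u => x^-1 * (u * y)).
    by move=> u; apply: cvgMg; [exact: cvg_cst|exact: mulgr_continuous].
  by move=> /(_ 1)/(_ _ oN).
move=> /profinite_open_subgroup[U [nU UW [U1 UM UV]]].
have oU (A : set H) : (forall u a, U u -> A a -> A (u * a)) -> open A.
  move=> UA; rewrite openE => a Aa.
  have : nbhs (a * a^-1) U by rewrite mulgV.
  move=> /(@mulgr_continuous _ a^-1 a) nU'.
  apply: (@filterS _ (nbhs a) _ _ _ _ nU') => z /= Uz.
  by have := UA _ _ Uz Aa; rewrite divgK.
exists (\pi_Q @` [set z | exists2 u, U u & z = u * x]).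
have UxE z : (\pi_Q @` [set z | exists2 u, U u & z = u * x]) (\pi_Q z) <->
    exists2 u, U u & N (x^-1 * u * z).
  split=> [[_ [u Uu ->] /coset_eqP Nu]|[u Uu Nu]].
    by exists u^-1; [exact: UV|move: Nu; rewrite invgM].
  exists (u^-1 * x); first by exists u^-1 => //; exact: UV.
  by apply/coset_eqP; rewrite invgM invgK.
split; first split.
- rewrite /open /= /quotient_open; apply: oU => u a Uu /UxE[v Uv Nv].
  apply/UxE; exists (v * u^-1); first by apply: UM => //; exact: UV.
  by rewrite !mulgA divgK.
- rewrite -openC /open /= /quotient_open preimage_setC.
  apply: oU => u a Uu nUa /UxE[v Uv Nv]; apply: nUa; apply/UxE.
  by exists (v * u); [exact: UM|rewrite !mulgA in Nv *].
- by exists x => //; exists 1; rewrite ?mul1g.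
- move=> /UxE[u Uu]; rewrite -mulgA; exact: UW.
Qed.

Lemma quotient_hausdorff : hausdorff_space Q.
Proof.
rewrite open_hausdorff => x y /quotient_zero_dimensional[U [[oU cU] Ux Uy]].
exists (U, ~` U) => /=; first by split; apply/mem_set.
by split; rewrite ?setICr//; exact: closed_openC.
Qed.

Lemma quotient_totally_disconnected : totally_disconnected [set: Q].
Proof.
by apply: zero_dimension_totally_disconnected; exact: quotient_zero_dimensional.
Qed.

HB.instance Definition _ := isProfinite.Build Q
  quotient_compact quotient_hausdorff quotient_totally_disconnected.

End Quotient.

Record epi (E G : profiniteGroupType) := Epi {
  epi_fun :> E -> G;
  epiM : {morph epi_fun : x y / x * y};
  epi_continuous : continuous epi_fun;
  epi_surj : forall g, exists x, epi_fun x = g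
}.

Definition is_iso (E G : profiniteGroupType) (f : E -> G) : Prop :=
  [/\ {morph f : x y / x * y}, continuous f &
      exists f' : G -> E, [/\ cancel f f', cancel f' f & continuous f']].

Definition iso_over (G H E : profiniteGroupType)
    (eta : epi H G) (rho : epi E G) : Prop :=
  exists2 psi : H -> E, is_iso psi & eta =1 rho \o psi.

Definition dominates (G H E : profiniteGroupType)
    (eta : epi H G) (rho : epi E G) : Prop :=
  exists psi : epi H E, eta =1 rho \o psi.

Definition indecomposable (E G : profiniteGroupType) (pi : epi E G) : Prop :=
  ~ is_iso pi /\
  forall (D : profiniteGroupType) (alpha : epi E D) (beta : epi D G),
    pi =1 beta \o alpha -> is_iso alpha \/ is_iso beta.

Section Kernel.
Variables (E G : profiniteGroupType) (pi : epi E G).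

Lemma epi1 : pi 1 = 1.
Proof. by apply: (@mulgI _ (pi 1)); rewrite -(epiM pi) !mulg1. Qed.

Lemma epiV x : pi x^-1 = (pi x)^-1.
Proof. by apply: (@mulgI _ (pi x)); rewrite -(epiM pi) !mulgV epi1. Qed.

Let K : set E := [set x | pi x = 1].

Lemma ker1 : K 1. Proof. exact: epi1. Qed.
Lemma kerM x y : K x -> K y -> K (x * y).
Proof. by rewrite /K /= epiM => -> ->; rewrite mulg1. Qed.
Lemma kerV x : K x -> K x^-1.
Proof. by rewrite /K /= epiV => ->; rewrite invg1. Qed.
Lemma kerJ x y : K x -> K (x ^ y).
Proof. by rewrite /K /= conjgE !epiM epiV => ->; rewrite mul1g mulVg. Qed.
Lemma ker_closed : closed K.
Proof.
have -> : K = pi @^-1` [set 1] by [].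
apply: closed_comp; first by move=> x _; exact: epi_continuous.
by apply: accessible_closed_set1; apply: hausdorff_accessible;
  exact: profinite_hausdorff.
Qed.

Definition ker : normalSubgroup E := NormalSubgroup ker1 kerM kerV kerJ ker_closed.

Definition abelian_kernel : Prop :=
  forall x y, normal_set ker x -> normal_set ker y -> x * y = y * x.

Lemma epi_open : open_map pi.
Proof.
move=> U oU.
have -> : pi @` U = ~` (pi @` (~` (pi @^-1` (pi @` U)))).
  apply/seteqP; split=> [_ [u Uu <-] [x nx /esym ux]|g ng].
    by apply: nx; rewrite /= -ux; exists u.
  have [x xg] := epi_surj pi g; apply: contrapT => nUg.
  by apply: ng; exists x => //; rewrite /= xg.
apply: closed_openC; apply: compact_closed; first exact: profinite_hausdorff.
apply: continuous_compact.
  by apply: continuous_subspaceT; exact: epi_continuous.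
apply: (subclosed_compact _ (@profinite_compact E)) => //.
apply: open_closedC.
have -> : pi @^-1` (pi @` U) = \bigcup_(n in K) ((fun x => x * n) @^-1` U).
  apply/seteqP; split=> [x [u Uu ux]|x [n Kn Uxn]].
    exists (x^-1 * u); last by rewrite /= mulgA mulgV mul1g.
    by rewrite /K /= epiM epiV ux mulVg.
  by exists (x * n) => //; rewrite epiM Kn mulg1.
apply: bigcup_open => n _; apply: open_comp => // x _.
exact: mulgr_continuous.
Qed.

End Kernel.

Section QuotientEpi.
Variables (H G : profiniteGroupType) (tau : epi H G) (N : normalSubgroup H).
Hypothesis sNK : normal_set N `<=` normal_set (ker tau).
Local Notation Q := (quotient_group N).

Definition quotient_epi_fun (x : Q) : G := tau (repr x).
Local Notation f := quotient_epi_fun.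

Lemma quotient_epiE x : f (\pi_Q x) = tau x.
Proof.
have /sNK := coset_repr N x; rewrite /= epiM epiV => e.
by apply: (@mulgI _ (tau x)^-1); rewrite mulVg.
Qed.

Lemma quotient_epiM : {morph f : x y / x * y}.
Proof.
elim/quotW=> x; elim/quotW=> y.
by rewrite -[X in f X](quotient_mulE N x y) !quotient_epiE epiM.
Qed.

Lemma quotient_epi_continuous : continuous f.
Proof.
apply/quotient_continuous => x.
rewrite (_ : f \o _ = tau); last by apply/funext => y; exact: quotient_epiE.
exact: epi_continuous.
Qed.

Lemma quotient_epi_surj g : exists x, f x = g.
Proof.
by have [x <-] := epi_surj tau g; exists (\pi_Q x); exact: quotient_epiE.
Qed.

Definition quotient_epi : epi Q G :=
  Epi quotient_epiM quotient_epi_continuous quotient_epi_surj.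

End QuotientEpi.

(* Topological G-modules, with a jointly continuous left action; profinite and
   finite discrete G-modules are the instances of interest. *)
Record gmodule (G : topologicalGroupType) := Gmodule {
  gmodule_sort :> topologicalZmodType;
  gact : G -> gmodule_sort -> gmodule_sort;
  gact1 : forall a, gact 1 a = a;
  gactM : forall g h a, gact (g * h) a = gact g (gact h a);
  gactD : forall g a b, gact g (a + b)%R = (gact g a + gact g b)%R;
  gact_continuous : continuous (fun p : G * gmodule_sort => gact p.1 p.2)
}.

Section KernelModule.
Variables (E G : profiniteGroupType) (pi : epi E G) (ab : abelian_kernel pi).

(* The kernel of pi written additively. The commutativity proof is a (phantom)
   parameter of the type, so that the zmodType structure can be canonical. *)
Definition kernel_type of abelian_kernel pi : Type :=
  set_type (normal_set (ker pi)).
Local Notation B := (kernel_type ab).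
HB.instance Definition _ := Topological.on B.

Definition kernel_in (x : E) (Kx : normal_set (ker pi) x) : B :=
  exist _ x (mem_set Kx).

Definition kernel_val (u : B) : E := sval u.

Lemma kernel_valP u : normal_set (ker pi) (kernel_val u).
Proof. exact: set_valP. Qed.

Lemma kernel_val_inj : injective kernel_val.
Proof. exact: val_inj. Qed.

Definition kernel_zero : B := kernel_in (normal1 _).
Definition kernel_opp (u : B) : B := kernel_in (normalV (kernel_valP u)).
Definition kernel_add (u v : B) : B :=
  kernel_in (normalM (kernel_valP u) (kernel_valP v)).

Lemma kernel_addA : associative kernel_add.
Proof. by move=> u v w; apply: kernel_val_inj; exact: mulgA. Qed.
Lemma kernel_addC : commutative kernel_add.
Proof. by move=> u v; apply: kernel_val_inj; apply: ab; exact: kernel_valP. Qed.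
Lemma kernel_add0 : left_id kernel_zero kernel_add.
Proof. by move=> u; apply: kernel_val_inj; exact: mul1g. Qed.
Lemma kernel_addN : left_inverse kernel_zero kernel_opp kernel_add.
Proof. by move=> u; apply: kernel_val_inj; exact: mulVg. Qed.

HB.instance Definition _ := GRing.isZmodule.Build B
  kernel_addA kernel_addC kernel_add0 kernel_addN.

Lemma kernel_val_continuous : continuous kernel_val.
Proof. exact: initial_continuous. Qed.

Lemma kernel_continuous (T : topologicalType) (f : T -> B) :
  continuous (kernel_val \o f) -> continuous f.
Proof.
move=> cf x U; rewrite nbhsE => -[_ [[V oV <-] /= Vfx] VU].
have /cf nV : nbhs (kernel_val (f x)) V by exact: open_nbhs_nbhs.
by apply: (@filterS _ (nbhs x) _ _ _ _ nV) => y Vy; exact: VU.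
Qed.

Lemma kernel_add_continuous : continuous (fun u : B * B => (u.1 + u.2)%R).
Proof.
apply: kernel_continuous => -[u v].
apply: cvgMg; (apply: continuous_cvg; first exact: kernel_val_continuous).
  exact: cvg_fst.
exact: cvg_snd.
Qed.

Lemma kernel_opp_continuous : continuous (fun u : B => (- u)%R).
Proof.
apply: kernel_continuous => u.
exact: cvgVg (@kernel_val_continuous u).
Qed.

HB.instance Definition _ :=
  PreTopologicalNmodule_isTopologicalNmodule.Build B kernel_add_continuous.
HB.instance Definition _ :=
  TopologicalNmodule_isTopologicalZmodule.Build B kernel_opp_continuous.

(* g acts on the kernel by conjugation u |-> h u h^-1 by any h with pi h = g;
   kernel_actE shows that the choice of h is irrelevant. *)
Definition kernel_lift (g : G) : E := sval (cid (epi_surj pi g)).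

Lemma kernel_liftK g : pi (kernel_lift g) = g.
Proof. exact: svalP (cid (epi_surj pi g)). Qed.

Lemma kernel_conj (h x : E) :
  normal_set (ker pi) x -> normal_set (ker pi) (h * x * h^-1).
Proof. by move=> /(normalJ h^-1); rewrite conjgE invgK mulgA. Qed.

Definition kernel_act (g : G) (u : B) : B :=
  kernel_in (kernel_conj (kernel_lift g) (kernel_valP u)).

Lemma kernel_actE (h : E) u :
  kernel_val (kernel_act (pi h) u) = h * kernel_val u * h^-1.
Proof.
rewrite /=; set l := kernel_lift _.
have Klh : normal_set (ker pi) (h^-1 * l).
  by rewrite /= epiM epiV kernel_liftK mulVg.
have := ab Klh (kernel_valP u) => /(congr1 (fun z => h * z * l^-1)).
by rewrite !mulgA mulgV mul1g mulgK.
Qed.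

Lemma kernel_act1 u : kernel_act 1 u = u.
Proof.
apply: kernel_val_inj; rewrite -[X in kernel_act X](epi1 pi).
by rewrite kernel_actE mul1g invg1 mulg1.
Qed.

Lemma kernel_actM g h u : kernel_act (g * h) u = kernel_act g (kernel_act h u).
Proof.
apply: kernel_val_inj; have [x <-] := epi_surj pi g; have [y <-] := epi_surj pi h.
by rewrite -epiM !kernel_actE invgM !mulgA.
Qed.

Lemma kernel_actD g u v :
  kernel_act g (u + v)%R = (kernel_act g u + kernel_act g v)%R.
Proof.
apply: kernel_val_inj; have [x <-] := epi_surj pi g.
rewrite kernel_actE [RHS](_ : _ =
  kernel_val (kernel_act (pi x) u) * kernel_val (kernel_act (pi x) v)) //.
rewrite !kernel_actE.
rewrite [in LHS](_ : kernel_val (u + v)%R = kernel_val u * kernel_val v) //.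
by rewrite !mulgA divgK.
Qed.

Lemma kernel_act_continuous : continuous (fun p : G * B => kernel_act p.1 p.2).
Proof.
apply: kernel_continuous => -[g u]; have [h <-] := epi_surj pi g.
move=> W; rewrite -[(_ \o _) _]/(kernel_val (kernel_act (pi h) u)) kernel_actE.
move=> nW.
have : (fun p : E * B => p.1 * kernel_val p.2 * p.1^-1) p @[p --> (h, u)] -->
    h * kernel_val u * h^-1.
  apply: cvgMg; last by apply: cvgVg; exact: cvg_fst.
  apply: cvgMg; first exact: cvg_fst.
  by apply: continuous_cvg; [exact: kernel_val_continuous|exact: cvg_snd].
move=> /(_ _ nW) [[A C] /= [Ah Cu] AC].
exists (pi @` A, C).
  by split => //; apply: (open_map_nbhs (@epi_open _ _ pi)).
move=> [_ v] [/= [a Aa <-] Cv].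
change (W (kernel_val (kernel_act (pi a) v))); rewrite kernel_actE.
exact: (AC (a, v)).
Qed.

Definition kernel_module : gmodule G :=
  Gmodule kernel_act1 kernel_actM kernel_actD kernel_act_continuous.

End KernelModule.

Section Hom.
Variables (G : topologicalGroupType).
Implicit Types M A : gmodule G.

Definition is_ghom M A (f : M -> A) : Prop :=
  [/\ {morph f : x y / (x + y)%R >-> (x + y)%R},
      forall g x, f (gact g x) = gact g (f x) & continuous f].

Definition gmodule_iso M A : Prop :=
  exists2 f : M -> A, is_ghom f &
    exists f' : A -> M, [/\ cancel f f', cancel f' f & continuous f'].

Definition ghom M A : Type := set_type [set f : M -> A | is_ghom f].

Definition hom_fun M A (f : ghom M A) : M -> A := sval f.
Coercion hom_fun : ghom >-> Funclass.

Lemma gact0 M g : gact g 0%R = 0%R :> M.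
Proof. by apply: (@addrI _ (gact g (0%R : M))); rewrite -gactD !addr0. Qed.

Lemma gactN M g (x : M) : gact g (- x)%R = (- gact g x)%R.
Proof. by apply: (@addrI _ (gact g x)); rewrite -gactD !subrr gact0. Qed.

Lemma hom_continuous M A (f : ghom M A) : continuous f.
Proof. by have [] := set_valP f. Qed.

Lemma homD M A (f : ghom M A) x y : f (x + y)%R = (f x + f y)%R.
Proof. by have [fD _ _] := set_valP f; exact: fD. Qed.

Lemma homact M A (f : ghom M A) g x : f (gact g x) = gact g (f x).
Proof. by have [_ fG _] := set_valP f; exact: fG. Qed.

Lemma homP M A (f f' : ghom M A) : f =1 f' -> f = f'.
Proof. by move=> ff'; apply: val_inj; exact: funext. Qed.

Section Zmodule.
Variables M A : gmodule G.

HB.instance Definition _ := SubChoice.on (ghom M A).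

Lemma hom_zmod_closed : zmod_closed (fun f : M -> A => f \in [set f | is_ghom f]).
Proof.
split=> [|f f']; rewrite !unfold_in.
  apply/mem_set.
  by split=> [x y|g x|]; rewrite ?addr0 ?gact0//; exact: cst_continuous.
move=> /set_mem[fD fG fc] /set_mem[f'D f'G f'c]; apply/mem_set.
split=> [x y|g x|x].
- by rewrite /= !fctE fD f'D opprD addrACA.
- by rewrite !fctE fG f'G gactD gactN.
- apply: (@continuous2_cvg _ _ _ _ _ _ f f' (fun u v => u - v)%R
    _ _ _ (fc x) (f'c x)).
  exact: (@sub_continuous A (f x, f' x)).
Qed.

HB.instance Definition _ :=
  GRing.SubChoice_isSubZmodule.Build _ _ (ghom M A) hom_zmod_closed.

End Zmodule.

Lemma hom_comp_subproof M N A (f : ghom N A) (f' : ghom M N) : is_ghom (f \o f').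
Proof.
split=> [x y|g x|x] /=; rewrite ?homD ?homact//.
by apply: continuous_comp; exact: hom_continuous.
Qed.

Definition hom_comp M N A (f : ghom N A) (f' : ghom M N) : ghom M A :=
  exist _ (f \o f') (mem_set (hom_comp_subproof f f')).

Lemma hom_id_subproof M : is_ghom (@id M).
Proof. by split=> // x; exact: cvg_id. Qed.

Definition hom_id M : ghom M M := exist _ id (mem_set (hom_id_subproof M)).

Lemma hom_addE M A (f f' : ghom M A) x : hom_fun (f + f')%R x = (f x + f' x)%R.
Proof. by []. Qed.

(* End_G(A) is a ring under composition, over which Hom_G(M, A) is a module; it
   is a finite field when A is finite and simple. *)
Definition gend A : Type := ghom A A.

HB.instance Definition _ A := GRing.Zmodule.on (gend A).

Section Ring.
Variable A : gmodule G.

Lemma end_compA : associative (@hom_comp A A A).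
Proof. by move=> f f' f''; exact: homP. Qed.
Lemma end_comp1l : left_id (hom_id A) (@hom_comp A A A).
Proof. by move=> f; exact: homP. Qed.
Lemma end_comp1r : right_id (hom_id A) (@hom_comp A A A).
Proof. by move=> f; exact: homP. Qed.
Lemma end_compDl : left_distributive (@hom_comp A A A) (@GRing.add (ghom A A)).
Proof. by move=> f f' f''; exact: homP. Qed.
Lemma end_compDr : right_distributive (@hom_comp A A A) (@GRing.add (ghom A A)).
Proof. by move=> f f' f''; apply: homP => x; exact: homD. Qed.

HB.instance Definition _ := GRing.Zmodule_isPzRing.Build (gend A)
  end_compA end_comp1l end_comp1r end_compDl end_compDr.

Variable M : gmodule G.

Definition hom_scale (e : gend A) (f : ghom M A) : ghom M A := hom_comp e f.

Lemma hom_scaleA e e' f : hom_scale e (hom_scale e' f) = hom_scale (e * e')%R f.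
Proof. exact: homP. Qed.
Lemma hom_scale1 : left_id 1%R hom_scale.
Proof. by move=> f; exact: homP. Qed.
Lemma hom_scaleDr : right_distributive hom_scale +%R.
Proof. by move=> e f f'; apply: homP => x; exact: homD. Qed.
Lemma hom_scaleDl f : {morph hom_scale^~ f : e e' / (e + e')%R}.
Proof. by move=> e e'; exact: homP. Qed.

HB.instance Definition _ := GRing.Zmodule_isLmodule.Build (gend A) (ghom M A)
  hom_scaleA hom_scale1 hom_scaleDr hom_scaleDl.

End Ring.
End Hom.

Record simple_gmodule (G : topologicalGroupType) := SimpleGmodule {
  simple_module :> gmodule G;
  simple_finite : finite_set [set: simple_module];
  simple_discrete : forall U : set simple_module, open U;
  simple_neq0 : exists a : simple_module, a != 0%R;
  simple_submodule : forall S : set simple_module,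
    S 0%R -> (forall a b, S a -> S b -> S (a - b)%R) ->
    (forall g a, S a -> S (gact g a)) ->
    S = [set 0%R] \/ S = [set: simple_module]
}.

Section Cohomology.
Variables (G : topologicalGroupType) (M : gmodule G).
Local Open Scope ring_scope.

Definition is_cocycle2 (f : G * G -> M) : Prop :=
  continuous f /\
  forall g h k : G, f (g, h) + f ((g * h)%g, k) =
    gact g (f (h, k)) + f (g, (h * k)%g).

Definition Z2 : Type := set_type [set f | is_cocycle2 f].
HB.instance Definition _ := SubChoice.on Z2.

Lemma Z2_zmod_closed : zmod_closed (fun f => f \in [set f | is_cocycle2 f]).
Proof.
split=> [|f f']; rewrite !unfold_in.
  apply/mem_set.
  by split=> [|g h k]; rewrite ?addr0 ?gact0//; exact: cst_continuous.
move=> /set_mem[fc fZ] /set_mem[f'c f'Z]; apply/mem_set; split=> [x|g h k].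
  apply: (@continuous2_cvg _ _ _ _ _ _ f f' (fun u v => u - v)%R
    _ _ _ (fc x) (f'c x)).
  exact: (@sub_continuous M (f x, f' x)).
by rewrite !fctE addrACA -opprD fZ f'Z gactD gactN opprD addrACA.
Qed.

HB.instance Definition _ :=
  GRing.SubChoice_isSubZmodule.Build _ _ Z2 Z2_zmod_closed.

Definition coboundary2 (b : G -> M) : G * G -> M :=
  fun p => gact p.1 (b p.2) - b (p.1 * p.2)%g + b p.1.

Definition B2 : pred Z2 :=
  fun z => `[< exists2 b : G -> M, continuous b & val z = coboundary2 b >].

Lemma B2_zmod_closed : zmod_closed B2.
Proof.
split=> [|z z']; rewrite !unfold_in.
  apply/asboolP; exists (fun=> 0); first exact: cst_continuous.
  by apply/funext => p; rewrite /coboundary2 gact0 subr0 addr0.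
move=> /asboolP[b bc zb] /asboolP[b' b'c zb']; apply/asboolP.
exists (fun g => b g - b' g).
  move=> x; apply: (@continuous2_cvg _ _ _ _ _ _ b b' (fun u v => u - v)
    _ _ _ (bc x) (b'c x)).
  exact: (@sub_continuous M (b x, b' x)).
apply/funext => p; rewrite raddfB/= zb zb' /coboundary2 !fctE gactD gactN.
by rewrite !opprD !opprK addrACA [X in X + _]addrACA.
Qed.

HB.instance Definition _ := GRing.isZmodClosed.Build Z2 B2 B2_zmod_closed.

(* Continuous cohomology, by inhomogeneous cochains. *)
Definition H2 : Type := Quotient.quot (GRing.ZmodClosed.clone Z2 B2 _).
HB.instance Definition _ := GRing.Zmodule.on H2.

Definition H2_class (z : Z2) : H2 :=
  \pi_(Quotient.quot (GRing.ZmodClosed.clone Z2 B2 _)) z.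
Definition H2_repr (c : H2) : Z2 :=
  repr (c : Quotient.quot (GRing.ZmodClosed.clone Z2 B2 _)).


Lemma H2_class_eq z z' : H2_class z = H2_class z' <-> B2 (z - z').
Proof.
rewrite /H2_class; split=> [/eqP|Bz]; first by rewrite -Quotient.idealrBE.
by apply/eqP; rewrite -Quotient.idealrBE.
Qed.

End Cohomology.

Section Functoriality.
Variables (G : topologicalGroupType) (M A : gmodule G) (phi : ghom M A).

Lemma Z2_map_subproof (z : Z2 M) : is_cocycle2 (phi \o val z).
Proof.
have [zc zZ] := set_valP z; split=> [x|g h k].
  by apply: continuous_comp; [exact: zc|exact: hom_continuous].
by rewrite /= -homD zZ homD homact.
Qed.

Definition Z2_map (z : Z2 M) : Z2 A :=
  exist _ (phi \o val z) (mem_set (Z2_map_subproof z)).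

Definition H2_map (c : H2 M) : H2 A := H2_class (Z2_map (H2_repr c)).

Lemma H2_mapE z : H2_map (H2_class z) = H2_class (Z2_map z).
Proof.
apply/H2_class_eq.
have /H2_class_eq/asboolP[b bc zb] :
  H2_class (H2_repr (H2_class z)) = H2_class z by exact: reprK.
apply/asboolP; exists (phi \o b).
  by move=> x; apply: continuous_comp; [exact: bc|exact: hom_continuous].
apply/funext => p; have /(congr1 (fun f => phi (f p))) := zb.
rewrite !raddfB /= /coboundary2 !fctE => phizb.
have homN x : phi (- x)%R = (- phi x)%R.
  apply: (@addrI _ (phi x)); rewrite -homD !subrr.
  by apply: (@addrI _ (phi 0%R)); rewrite -homD !addr0.
by move: phizb; rewrite !homD !homN homact.
Qed.
End Functoriality.


(* A cardinal number is represented by a set having that cardinality; cardinals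
   are compared with cardinal_le and cardinal_eq only. *)
Record cardinal := Cardinal {
  cardinal_type : Type;
  cardinal_set : set cardinal_type
}.
Arguments cardinal_set : clear implicits.

Definition cardinal_le (a b : cardinal) : Prop :=
  cardinal_set a #<= cardinal_set b.
Definition cardinal_eq (a b : cardinal) : Prop :=
  cardinal_set a #= cardinal_set b.

Section Dimension.
Variables (R : pzRingType) (V : lmodType R).
Local Open Scope ring_scope.

Definition free_set (X : set V) : Prop :=
  forall n (v : 'I_n -> V) (a : 'I_n -> R), injective v ->
    (forall i, X (v i)) ->
    \sum_i a i *: v i = 0 -> forall i, a i = 0.

Definition span (X : set V) : set V :=
  [set w | exists n (v : 'I_n -> V) (a : 'I_n -> R),
    (forall i, X (v i)) /\ w = \sum_i a i *: v i].

Definition is_basis (W X : set V) : Prop := free_set X /\ span X = W.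

(* The cardinality of a chosen basis; over a division ring, bases exist and all
   have the same cardinality, and the default value set0 is not used. *)
Definition dimension (W : set V) : cardinal :=
  Cardinal (xget set0 [set X | is_basis W X]).

End Dimension.

Section Fundamental.
Variables (H G : profiniteGroupType) (tau : epi H G).

Definition max_normal (M : normalSubgroup H) : set (normalSubgroup H) :=
  [set N | normal_set N `<` normal_set M /\
     forall N' : normalSubgroup H, normal_set N' `<` normal_set M ->
       normal_set N `<=` normal_set N' -> normal_set N' = normal_set N].

(* The intersection with ker tau matters only if ker tau = 1, when there is no
   maximal N. *)
Definition fundament_kernel : set H :=
  normal_set (ker tau) `&` \bigcap_(N in max_normal (ker tau)) normal_set N.

Definition fundamental : Prop := fundament_kernel = [set 1].

End Fundamental.

Record nonabelian_epi (G : profiniteGroupType) := NonabelianEpi {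
  nonabelian_group : profiniteGroupType;
  nonabelian_fun :> epi nonabelian_group G;
  nonabelian_indecomposable : indecomposable nonabelian_fun;
  nonabelian_kernel : ~ abelian_kernel nonabelian_fun
}.

(* Lambda G contains every finite simple G-module and every indecomposable
   epimorphism with non-abelian kernel, not just one per isomorphism class. *)
Inductive Lambda (G : profiniteGroupType) :=
  | Lambda_ab of simple_gmodule G
  | Lambda_na of nonabelian_epi G.

Section Multiplicity.
Variables (H G : profiniteGroupType) (tau : epi H G).

Definition mult_na (zeta : nonabelian_epi G) : cardinal :=
  Cardinal [set N : normalSubgroup H |
    exists sNK : normal_set N `<=` normal_set (ker tau),
      iso_over (quotient_epi sNK) zeta].

Variable A : simple_gmodule G.

Definition C_A : set (normalSubgroup H) :=
  [set N | exists (sNK : normal_set N `<=` normal_set (ker tau))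
      (ab : abelian_kernel (quotient_epi sNK)),
    gmodule_iso (kernel_module ab) A].

Definition N_A_set : set H :=
  normal_set (ker tau) `&` \bigcap_(N in C_A) normal_set N.

Lemma N_A_set1 : N_A_set 1.
Proof. by split=> [|N _]; exact: normal1. Qed.
Lemma N_A_setM x y : N_A_set x -> N_A_set y -> N_A_set (x * y).
Proof.
move=> [Kx Nx] [Ky Ny]; split=> [|N CN]; first exact: (normalM Kx Ky).
by apply: normalM; [exact: Nx|exact: Ny].
Qed.
Lemma N_A_setV x : N_A_set x -> N_A_set x^-1.
Proof.
move=> [Kx Nx]; split=> [|N CN]; first exact: (normalV Kx).
by apply: normalV; exact: Nx.
Qed.
Lemma N_A_setJ x y : N_A_set x -> N_A_set (x ^ y).
Proof.
move=> [Kx Nx]; split=> [|N CN]; first exact: (normalJ y Kx).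
by apply: normalJ; exact: Nx.
Qed.
Lemma N_A_set_closed : closed N_A_set.
Proof.
apply: closedI; first exact: normal_closed.
by apply: closed_bigI => N _; exact: normal_closed.
Qed.

Definition N_A : normalSubgroup H :=
  NormalSubgroup N_A_set1 N_A_setM N_A_setV N_A_setJ N_A_set_closed.

Lemma N_A_sub : normal_set N_A `<=` normal_set (ker tau).
Proof. by move=> x []. Qed.

Definition H_A : profiniteGroupType := quotient_group N_A.
Definition tau_A : epi H_A G := quotient_epi N_A_sub.

Lemma tau_A_abelian : abelian_kernel tau_A.
Proof.
have E (a : quotient_group N_A) : exists x, a = \pi_(quotient_group N_A) x.
  by exists (repr a); rewrite reprK.
move=> a b; have [x ->] := E a; have [y ->] := E b; move=> Kx Ky.
have {}Kx : tau x = 1 := etrans (esym (quotient_epiE N_A_sub x)) Kx.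
have {}Ky : tau y = 1 := etrans (esym (quotient_epiE N_A_sub y)) Ky.
rewrite -[_ * _](quotient_mulE N_A x y) -[RHS](quotient_mulE N_A y x).
apply/coset_eqP; split.
  by rewrite /= epiM epiV !epiM Kx Ky !mulg1 invg1.
move=> N [sNK [ab _]]; apply/coset_eqP.
rewrite (quotient_mulE N x y) (quotient_mulE N y x).
by apply: ab; rewrite /= quotient_epiE.
Qed.

Definition B_A : gmodule G := kernel_module tau_A_abelian.

Definition is_factor_set (s : G -> H_A) (f : Z2 B_A) : Prop :=
  forall g h, kernel_val (sval f (g, h)) = s g * s h * (s (g * h))^-1.

(* The class of 1 -> B_A -> H_A -> G -> 1: the class of the factor set
   f(g, h) = s(g) s(h) s(gh)^-1 of a continuous section s. Such sections exist for
   epimorphisms of profinite groups, and the class does not depend on s. *)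
Definition f_A : H2 B_A :=
  xget 0%R [set c | exists (s : G -> H_A) (f : Z2 B_A),
    [/\ continuous s, cancel s tau_A, is_factor_set s f & c = H2_class f]].

Definition S_A : ghom B_A A -> H2 A := fun phi => H2_map phi f_A.

Definition mult_ab : cardinal :=
  @dimension (gend A) (ghom B_A A) (S_A @^-1` [set 0%R]).

Definition supp : set (H2 A) := range S_A.

End Multiplicity.

Arguments C_A {H G} tau A _.
Arguments N_A_set {H G} tau A _.
Arguments S_A {H G} tau A _.
Arguments supp {H G} tau A _.

Definition mult (H G : profiniteGroupType) (tau : epi H G) (lambda : Lambda G) :
    cardinal :=
  match lambda with
  | Lambda_ab A => mult_ab tau A
  | Lambda_na zeta => mult_na tau zeta
  end.

(* Main.v *)
Require Import Defs.
From mathcomp Require Import all_boot all_order all_algebra.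
From mathcomp Require Import all_classical topology tvs.

(** Let K be the kernel of tau : H ->> G. A fundamental epimorphism is controlled
    by the closed normal subgroups N of H that are maximal in K, since they meet
    trivially. They are of two kinds. If K/N is not abelian, then H/N ->> G is
    indecomposable, and mult counts such N class by class. If K/N is abelian, it
    is a finite simple G-module A, and N is the kernel of a nonzero character: an
    H-equivariant homomorphism K -> A. The characters with values in A form the
    vector space Hom_G(B_A, A), on which S_A records the class of the extension
    obtained by pushing out along the character.

    Suppose that multiplicities and supports satisfy the inequalities, and write
    H', K', S'_A for the data of tau'. For each A take a basis of the characters
    of K' that extends a basis of Ker S'_A, and match it with a free family of
    characters of K having the same values under S_A: inside Ker S'_A the
    inequality of multiplicities provides the match, outside it the inclusion of
    supports does (matched_bases, matched_characters). Match the non-abelian N'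
    injectively with subgroups N of the same class (matched_nonabelian). Every
    matched pair yields an isomorphism of H/N with H'/N' over G, kept as its graph, a
    closed subgroup of H x H'. For characters phi and phi' with the same value
    under S_A and S'_A this rests on S_A_splitting: some cocycle z has splitting
    maps c on H and c' on H', and the graph consists of the pairs (h, h') over
    the same element of G with c h = c' h'.

    These graphs are then intersected. The chosen subgroups are independent, no
    one containing the intersection of K with finitely many of the others
    (mixed_family_independent): non-abelian factors behave like primes, and for
    characters independence is linear independence, by Schur's lemma. Compactness
    turns independence into a Chinese remainder theorem
    (independent_cosets_meet), which makes the intersection of the graphs project
    onto both H and H'. As the N' meet trivially, it is the graph of an
    epimorphism H ->> H' (glue_local_isos). If multiplicities and supports agree,
    the chosen N have the same intersection as all the maximal ones, namely 1,
    and the epimorphism is an isomorphism.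

    Conversely, an epimorphism psi : H ->> H' over G pulls the subgroups N' and
    the characters of K' back to H, injectively and compatibly with S_A. For an
    isomorphism this applies in both directions, and the Cantor-Bernstein theorem
    turns the two inequalities into equalities.

    The Chinese remainder theorem has a second use: it provides a continuous
    section of H_A ->> G (tau_A_section), so that f_A is indeed the class of an
    actual factor set. *)

Set Implicit Arguments.
Unset Strict Implicit.
Unset Printing Implicit Defensive.

Import GRing.Theory.
Local Open Scope classical_set_scope.
Local Open Scope quotient_scope.
Local Open Scope card_scope.
Local Open Scope group_scope.

(** * Comparison of cardinals by functions on ambient types *)

Lemma inj_card_le_fun T U (A : set T) (B : set U) (f : T -> U) :
  {in A &, injective f} -> (forall x, A x -> B (f x)) -> A #<= B.
Proof.
move=> fI fAB; have /card_eqPle[_ le1] := inj_card_eq fI.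
by apply: card_le_trans le1 _; apply: subset_card_le => _ [x /fAB Bx <-].
Qed.

Lemma card_le_fun T U (u0 : U) (A : set T) (B : set U) : A #<= B ->
  exists f : T -> U, {in A &, injective f} /\ forall x, A x -> B (f x).
Proof.
move=> /card_leP[f].
pose g x := if pselect (A x) is left Ax then sval (f (exist _ x (mem_set Ax))) else u0.
exists g; split=> [x y /set_mem Ax /set_mem Ay|x Ax]; rewrite /g; case: pselect => // Ax'.
  case: pselect => // Ay' e.
  by have [] := @inj _ _ _ f _ _ (in_setT _) (in_setT _) (@val_inj _ _ (set_type B) _ _ e).
by apply: set_valP.
Qed.

Lemma card_eq_fun T U (u0 : U) (A : set T) (B : set U) : A #= B ->
  exists f : T -> U, {in A &, injective f} /\ f @` A = B.
Proof.
move=> /card_eqP[f].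
pose g x := if pselect (A x) is left Ax then sval (f (exist _ x (mem_set Ax))) else u0.
exists g; split=> [x y /set_mem Ax /set_mem Ay|]; rewrite /g.
  case: pselect => // Ax'; case: pselect => // Ay' e.
  by have [] := @inj _ _ _ f _ _ (in_setT _) (in_setT _) (@val_inj _ _ (set_type B) _ _ e).
apply/seteqP; split=> [_ [x Ax <-]|y By].
  by case: pselect => // Ax'; exact: set_valP.
have [[x xA] _ fx] := @surj _ _ _ _ f (exist _ y (mem_set By)) I.
exists x; first exact: set_mem.
case: pselect => [Ax'|]; last by case; exact: set_mem.
by rewrite (Prop_irrelevance (mem_set Ax') xA) fx.
Qed.

(** One function serves for the inequality and, if it holds, for the equality
    of cardinals, so that a single construction covers both parts of the
    theorem. *)
Lemma card_le_eq_fun T U (u0 : U) (A : set T) (B : set U) : A #<= B ->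
  exists f : T -> U, [/\ {in A &, injective f}, forall x, A x -> B (f x) &
    A #= B -> f @` A = B].
Proof.
move=> AB; have [/(card_eq_fun u0)[f [fI fAB]]|nAB] := pselect (A #= B).
  by exists f; split => // x Ax; rewrite -fAB; exists x.
by have [f [fI fAB]] := card_le_fun u0 AB; exists f; split.
Qed.

(** * Free families, bases and dimension over a division ring *)

Section LinearAlgebra.
Local Open Scope ring_scope.
Local Notation span := Defs.span.
Variables (R : pzRingType) (V : lmodType R).

(** For a family rather than a set of vectors, a repetition is a dependence:
    over a nontrivial ring freeness includes the injectivity of t on X. *)
Definition free_family (I : eqType) (X : set I) (t : I -> V) : Prop :=
  forall (s : seq I) (a : I -> R), uniq s -> (forall x, x \in s -> X x) ->
    \sum_(x <- s) a x *: t x = 0 -> forall x, x \in s -> a x = 0.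

Lemma free_setP (X : set V) : free_set X <-> free_family X id.
Proof.
split=> [fX s a us sX e x xs|fX n v a vinj vX e i].
  have := fX _ (tnth (in_tuple s)) (fun i => a (tnth (in_tuple s) i)).
  have tinj : injective (tnth (in_tuple s)) by apply/tuple_uniqP.
  have tX i : X (tnth (in_tuple s) i) by apply: sX; exact: (mem_tnth i (in_tuple s)).
  move=> /(_ tinj tX).
  rewrite -(big_tnth _ _ s predT (fun x => a x *: x)) => /(_ e).
  by have /tnthP[i ->] : x \in in_tuple s by [].
pose b x := if [pick i | v i == x] is Some i then a i else 0.
have bv j : b (v j) = a j.
  by rewrite /b; case: pickP => [k /eqP/vinj -> //|/(_ j)]; rewrite eqxx.
rewrite -bv; apply: (fX [seq v i | i <- enum 'I_n]).
- by rewrite map_inj_uniq ?enum_uniq.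
- by move=> _ /mapP[j _ ->].
- by rewrite big_map big_enum /= -[RHS]e; apply: eq_bigr => j _; rewrite bv.
- by apply: map_f; rewrite mem_enum.
Qed.

(** Repeated vectors are collected, so that the coefficients live on a
    duplicate-free sequence as in the definition of freeness. *)
Lemma span_imageP (I : eqType) (X : set I) (t : I -> V) w :
  span (t @` X) w <-> exists (s : seq I) (a : I -> R),
    [/\ uniq s, forall x, x \in s -> X x & w = \sum_(x <- s) a x *: t x].
Proof.
split=> [[n [v [a [vX ->]]]]|[s [a [us sX ->]]]].
  elim/big_rec: _ => [|i u _ [s [b [us sX ->]]]].
    by exists [::], (fun=> 0); split => //; rewrite big_nil.
  have [x Xx <-] := vX i.
  have [xs|xs] := boolP (x \in s).
    exists s, (fun y => b y + (if y == x then a i else 0)); split => //.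
    rewrite (big_rem x xs) [in RHS](big_rem x xs) /= eqxx scalerDl.
    rewrite addrA [in RHS](addrC (b x *: _)); congr (_ + _).
    rewrite !big_seq; apply: eq_bigr => y; rewrite mem_rem_uniq // => /andP[/= yx _].
    by rewrite (negbTE yx) addr0.
  exists (x :: s), (fun y => if y == x then a i else b y); split.
  - by rewrite /= xs.
  - by move=> y; rewrite in_cons => /predU1P[->|/sX].
  - rewrite big_cons eqxx; congr (_ + _); rewrite !big_seq; apply: eq_bigr => y ys.
    by case: eqP => // yx; move: xs; rewrite -yx ys.
exists (size s), (fun i => t (tnth (in_tuple s) i)), (fun i => a (tnth (in_tuple s) i)).
split; last by rewrite (big_tnth _ _ s).
by move=> i; exists (tnth (in_tuple s) i) => //; apply: sX; exact: (mem_tnth i (in_tuple s)).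
Qed.

Lemma spanP (X : set V) w : span X w <-> exists (s : seq V) (a : V -> R),
  [/\ uniq s, forall x, x \in s -> X x & w = \sum_(x <- s) a x *: x].
Proof. by rewrite -{1}(image_id X); exact: span_imageP. Qed.

Definition is_submodule (W : set V) : Prop :=
  [/\ W 0, forall v w, W v -> W w -> W (v + w) & forall a v, W v -> W (a *: v)].

Lemma submodule_sum (W : set V) (I : eqType) (s : seq I) (a : I -> R) (t : I -> V) :
  is_submodule W -> (forall x, x \in s -> W (t x)) -> W (\sum_(x <- s) a x *: t x).
Proof.
move=> [W0 WD WZ] sW; rewrite big_seq; elim/big_ind: _ => // x xs.
exact/WZ/sW.
Qed.

Lemma span_submodule (X : set V) : is_submodule (span X).
Proof.
split=> [|v w [n [x [a [xX ->]]]] [m [y [b [yX ->]]]]|c v [n [x [a [xX ->]]]]].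
- by exists 0%N, (fun=> 0), (fun=> 0); split => [[]//|]; rewrite big_ord0.
- exists (n + m)%N, (fun i => match fintype.split i with inl j => x j | inr j => y j end),
    (fun i => match fintype.split i with inl j => a j | inr j => b j end).
  split=> [i|]; first by case: fintype.split.
  rewrite big_split_ord /=; congr (_ + _); apply: eq_bigr => i _.
    by rewrite (unsplitK (inl _)).
  by rewrite (unsplitK (inr _)).
- exists n, x, (fun i => c * a i); split => //.
  by rewrite scaler_sumr; apply: eq_bigr => i _; rewrite scalerA.
Qed.

Lemma span_le (X W : set V) : is_submodule W -> X `<=` W -> span X `<=` W.
Proof.
move=> sW XW _ [n [x [a [xX ->]]]]; have [W0 WD WZ] := sW.
by elim/big_ind: _ => // i _; apply/WZ/XW.
Qed.

Lemma sub_span (X : set V) : X `<=` span X.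
Proof.
move=> x Xx; exists 1%N, (fun=> x), (fun=> 1); split => //.
by rewrite big_ord1 scale1r.
Qed.

Lemma span_mono (X Y : set V) : X `<=` Y -> span X `<=` span Y.
Proof.
by move=> XY; apply: span_le; [exact: span_submodule|move=> x /XY/sub_span].
Qed.

Lemma free_family_sub (I : eqType) (X Y : set I) (t : I -> V) :
  X `<=` Y -> free_family Y t -> free_family X t.
Proof. by move=> XY fY s a us sX; apply: fY => // x /sX/XY. Qed.

Lemma free_family_val (I : choiceType) (X : set I) (t : I -> V) :
  free_family X t -> free_family [set: set_type X] (fun x => t (sval x)).
Proof.
move=> fX s a us _ e x xs.
pose b v := if insub v is Some y then a y else 0.
have bE y : b (sval y) = a y by rewrite /b valK.
rewrite -bE; apply: (fX [seq sval y | y <- s]).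
- by rewrite map_inj_uniq //; exact: val_inj.
- by move=> _ /mapP[y _ ->]; exact: set_valP.
- by rewrite big_map -[RHS]e; apply: eq_bigr => y _; rewrite bE.
- exact: map_f.
Qed.

Hypothesis divR : forall a : R, a != 0 -> exists b, b * a = 1.
Hypothesis oneR : 1 != 0 :> R.

Lemma free_setU1 (X : set V) x :
  free_family X id -> ~ span X x -> free_family (x |` X) id.
Proof.
move=> fX nXx s a us sX e.
have ax : x \in s -> a x = 0.
  move=> xs; apply: contrapT => /eqP /divR [b ba]; apply: nXx; move: e.
  rewrite (big_rem x xs) /= => /(congr1 (fun v => b *: v)).
  rewrite scaler0 scalerDr scalerA ba scale1r => /eqP; rewrite addr_eq0 => /eqP ->.
  have [_ _ sZ] := span_submodule X.
  rewrite -scaleN1r; apply: (sZ); apply: (sZ).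
  apply: (@submodule_sum _ _ _ _ id) => [|y]; first exact: span_submodule.
  rewrite mem_rem_uniq // => /andP[/= /eqP yx ys].
  by apply: sub_span; case: (sX _ ys).
have sum0 : \sum_(y <- [seq y <- s | y != x]) a y *: y = 0.
  rewrite big_filter -[RHS]e big_mkcond !big_seq; apply: eq_bigr => y ys.
  by case: eqP => //= yx; rewrite yx ax ?scale0r // -yx.
move=> y ys; case: (eqVneq y x) => [yx|yx]; first by rewrite yx ax // -yx.
apply: (fX [seq y <- s | y != x]) => //.
- exact: filter_uniq.
- by move=> z; rewrite mem_filter => /andP[/eqP zx /sX[]].
- by rewrite mem_filter yx.
Qed.

Lemma free_family_not_span (I : eqType) (X : set I) (t : I -> V) x (s : seq I) a :
  free_family X t -> X x -> uniq s -> (forall y, y \in s -> X y) -> x \notin s ->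
  t x <> \sum_(y <- s) a y *: t y.
Proof.
move=> ft Xx us sX xs e.
have := ft (x :: s) (fun y => if y == x then -1 else a y).
rewrite /= xs us big_cons eqxx scaleN1r => /(_ isT).
have -> : \sum_(j <- s) (if j == x then -1 else a j) *: t j = t x.
  rewrite e !big_seq; apply: eq_bigr => y ys.
  by case: eqP => // yx; move: xs; rewrite -yx ys.
rewrite addNr => H; have /eqP : -1 = 0 :> R.
  have := H _ erefl x; rewrite mem_head eqxx; apply => // y.
  by rewrite in_cons => /predU1P[->//|/sX].
by rewrite oppr_eq0 (negbTE oneR).
Qed.

Lemma free_family_neq0 (I : eqType) (X : set I) (t : I -> V) x :
  free_family X t -> X x -> t x != 0.
Proof.
move=> ft Xx; apply/eqP => tx0.
apply: (@free_family_not_span _ _ _ x [::] (fun=> 0) ft Xx) => //.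
by rewrite big_nil.
Qed.

Lemma free_not_span (X : set V) x : free_family X id -> X x -> ~ span (X `\ x) x.
Proof.
move=> fX Xx /spanP[s [a [us sX e]]].
apply: (free_family_not_span fX Xx us _ _ e) => [y /sX[]//|].
by apply/negP => /sX [_]; exact.
Qed.

Lemma chain_seq (I : eqType) (T : Type) (F : set (set T)) (f : I -> T) (s : seq I) :
  total_on F subset -> F !=set0 ->
  (forall x, x \in s -> exists2 A, F A & A (f x)) ->
  exists2 A, F A & forall x, x \in s -> A (f x).
Proof.
move=> tF [A0 FA0]; elim: s => [|x s IH] sF; first by exists A0.
have [|A FA As] := IH; first by move=> y ys; apply: sF; rewrite in_cons ys orbT.
have [B FB Bx] := sF x (mem_head _ _).
have [AB|BA] := tF _ _ FA FB.
  by exists B => // y; rewrite in_cons => /predU1P[->//|/As/AB].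
by exists A => // y; rewrite in_cons => /predU1P[->|/As//]; exact: BA.
Qed.

(** Over a division ring a relation can be solved for any vector that has a
    nonzero coefficient in it. *)
Lemma free_family_criterion (I : eqType) (X : set I) (t : I -> V) :
  (forall x, X x -> ~ span (t @` (X `\ x)) (t x)) -> free_family X t.
Proof.
move=> nX s a us sX e x xs; apply: contrapT => /eqP/divR[c ca].
apply: (nX x (sX _ xs)); move: e; rewrite (big_rem x xs) /=.
move=> /(congr1 (fun v => c *: v)); rewrite scaler0 scalerDr scalerA ca scale1r.
move=> /eqP; rewrite addr_eq0 => /eqP ->; rewrite -scaleN1r.
have [_ _ sZ] := span_submodule (t @` (X `\ x)); apply: (sZ); apply: (sZ).
apply: submodule_sum => [|y]; first exact: span_submodule.
rewrite mem_rem_uniq // => /andP[/= /eqP yx ys].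
by apply: sub_span; exists y => //; split => //; exact: sX.
Qed.

(** A relation involves finitely many vectors, which already lie in a single
    member of the chain. *)
Lemma free_chain (F : set (set V)) : total_on F subset ->
  (forall X, F X -> free_family X id) -> free_family (\bigcup_(X in F) X) id.
Proof.
move=> tF fF [|x0 s0] //; set s := _ :: _ => a us sX.
have F0 : F !=set0 by have [X FX _] := sX x0 (mem_head _ _); exists X.
have [A FA As] := @chain_seq _ _ F id s tF F0 sX.
exact: (fF A).
Qed.

Lemma basis_extension (W X0 : set V) : is_submodule W -> X0 `<=` W ->
  free_family X0 id -> exists X, [/\ X0 `<=` X, free_family X id & span X = W].
Proof.
move=> sW X0W fX0.
pose P := [set X : set V | (X `<=` W) /\ free_family (X0 `|` X) id].
have [|X [[XW fX] maxX]] := @Zorn_bigcup V P.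
  move=> F FP tF; split; first by move=> x [X /FP[XW _]]; exact: XW.
  have [F0|/set0P/negP/negPn/eqP ->] := pselect (F !=set0); last first.
    by rewrite bigcup_set0 setU0.
  pose F' := [set X0 `|` X | X in F].
  apply: (@free_family_sub _ _ (\bigcup_(X in F') X)).
    move=> x [X0x|[X FX Xx]].
      by have [X FX] := F0; exists (X0 `|` X); [exists X|left].
    by exists (X0 `|` X); [exists X|right].
  apply: free_chain.
    move=> _ _ [X FX <-] [Y FY <-].
    by have [XY|YX] := tF _ _ FX FY; [left|right]; exact: setUS.
  by move=> _ [X /FP[_ fX] <-].
exists (X0 `|` X); split => //.
apply/seteqP; split; first by apply: span_le => // x [/X0W|/XW].
move=> w Ww; apply: contrapT => nw.
apply: (maxX (w |` X)).
  split; first by move=> ? ?; right.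
  by move=> /(_ w (or_introl erefl)) Xw; apply: nw; apply: sub_span; right.
split; first by move=> x [->|/XW].
by rewrite setUCA; exact: free_setU1.
Qed.

(* Steinitz *)
(** Steinitz exchange in arbitrary cardinality. Zorn's lemma is applied to the
    partial injections p from Y to X, as sets of pairs, such that Y stays free
    when the elements of the domain are replaced by their images. A maximal p
    is total: since X spans y, it contains some x outside the span of what
    remains after removing y, and y can be exchanged for x. *)
Lemma free_card_le_span (X Y : set V) :
  free_family Y id -> Y `<=` span X -> Y #<= X.
Proof.
move=> fY YX.
pose dom (p : set (V * V)) := [set y | exists x, p (y, x)].
pose ran (p : set (V * V)) := [set x | exists y, p (y, x)].
pose P := [set p : set (V * V) | [/\ forall y x, p (y, x) -> Y y /\ X x,
  forall y x x', p (y, x) -> p (y, x') -> x = x',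
  forall y y' x, p (y, x) -> p (y', x) -> y = y',
  (Y `\` dom p) `&` ran p = set0 & free_family ((Y `\` dom p) `|` ran p) id]].
have [|p [[pYX pf pi p0 pfree] maxp]] := @Zorn_bigcup (V * V)%type P.
  move=> F FP tF; set p := \bigcup_(_ in _) _.
  have two u v : p u -> p v -> exists2 q, F q & q u /\ q v.
    move=> [q Fq qu] [r Fr rv]; have [qr|rq] := tF _ _ Fq Fr.
      by exists r => //; split => //; exact: qr.
    by exists q => //; split => //; exact: rq.
  split.
  - by move=> y x [q /FP[+ _ _ _ _]]; apply.
  - move=> y x x' pu pv; have [q /FP[_ qf _ _ _] [qu qv]] := two _ _ pu pv.
    exact: qf qu qv.
  - move=> y y' x pu pv; have [q /FP[_ _ qi _ _] [qu qv]] := two _ _ pu pv.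
    exact: qi qu qv.
  - apply/seteqP; split => // y [[Yy ny] [y' [q Fq qy]]].
    have [_ _ _ /seteqP[+ _] _] := FP _ Fq; apply; split; last by exists y'.
    by split => // -[x qx]; apply: ny; exists x, q.
  - have [F0|/set0P/negP/negPn/eqP F0] := pselect (F !=set0); last first.
      apply: free_family_sub fY => x; rewrite /p F0 bigcup_set0.
      by move=> [[]//|[? []]].
    move=> s a us sp; pose good q z := (Y z /\ ~ dom p z) \/ ran q z.
    have [q Fq qs] : exists2 q, F q & forall z, z \in s -> good q z.
      elim: s {us} sp => [|z s IH] sp.
        by have [q Fq] := F0; exists q.
      have [|q Fq qs] := IH; first by move=> y ys; apply: sp; rewrite in_cons ys orbT.
      have := sp z (mem_head _ _) => -[[Yz nz]|[y [r Fr ryz]]].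
        by exists q => // y; rewrite in_cons => /predU1P[->|/qs //]; left.
      have [qr|rq] := tF _ _ Fq Fr.
        exists r => // z'; rewrite in_cons => /predU1P[->|/qs].
          by right; exists y.
        by move=> [|[u /qr ru]]; [left|right; exists u].
      exists q => // z'; rewrite in_cons => /predU1P[->|/qs //].
      by right; exists y; exact: rq.
    have [_ _ _ _ fq] := FP _ Fq; apply: fq => // z /qs [[Yz nz]|]; last by right.
    by left; split => // -[x qx]; apply: nz; exists x, q.
suff Ydom : Y `<=` dom p.
  have /choice[f fP] : forall y, exists x, Y y -> p (y, x).
    move=> y; have [/Ydom[x px]|nY] := pselect (Y y); first by exists x.
    by exists y.
  apply: (@inj_card_le_fun _ _ _ _ f).
    move=> y y' /set_mem Yy /set_mem Yy' e.
    by apply: (pi _ _ (f y)); [exact: fP|rewrite e; exact: fP].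
  by move=> y /fP /pYX[].
move=> y Yy; apply: contrapT => ny.
pose Z := (Y `\` dom p) `|` ran p; pose Z' := Z `\ y.
have Zy : Z y by left.
have nZ'y : ~ span Z' y by exact: free_not_span.
have [x [Xx nx]] : exists x, X x /\ ~ span Z' x.
  apply: contrapT => /forallNP nX; apply: nZ'y.
  apply: (span_le (span_submodule Z')) (YX _ Yy) => x Xx.
  by have := nX x; rewrite not_andP => -[//|/contrapT].
have ranZ' : ran p `<=` Z'.
  move=> u ru; split; first by right.
  by move=> /= uy; move: p0 => /seteqP[+ _] => /(_ y); apply; split; [|rewrite -uy].
have nranx : ~ ran p x by move=> /ranZ'/sub_span.
have domE u : dom ((y, x) |` p) u -> u = y \/ dom p u.
  by move=> [z [[-> _]|pz]]; [left|right; exists z].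
have ranE u : ran ((y, x) |` p) u -> u = x \/ ran p u.
  by move=> [z [[_ ->]|pz]]; [left|right; exists z].
apply: (maxp ((y, x) |` p)).
  split; first by move=> u; right.
  by move=> /(_ (y, x) (or_introl erefl)) pyx; apply: ny; exists x.
have YdZ' u : (Y `\` dom ((y, x) |` p)) u -> Z' u.
  move=> [Yu nu]; split; first by left; split => // -[z pz]; apply: nu; exists z; right.
  by move=> /= uy; apply: nu; exists x; left; rewrite uy.
split.
- by move=> u z [[-> ->]|/pYX].
- move=> u z z' [/pair_equal_spec[-> ->]|puz] [/pair_equal_spec[e ->]|puz'] //.
  + by case: ny; exists z'.
  + by case: ny; exists z; rewrite -e.
  + exact: pf puz puz'.
- move=> u u' z [/pair_equal_spec[-> ->]|puz] [/pair_equal_spec[-> e]|puz'] //.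
  + by case: nranx; exists u'.
  + by case: nranx; exists u; rewrite -e.
  + exact: pi puz puz'.
- apply/seteqP; split=> // u [Yu /ranE[ux|ru]].
    by apply: nx; rewrite -ux; apply/sub_span/YdZ'.
  have [_ /= uy] := YdZ' _ Yu.
  have /seteqP[/(_ u) + _] := p0; apply; split => //.
  case: Yu => Yu nu; split => // -[z pz].
  by apply: nu; exists z; right.
- apply: (@free_family_sub _ _ (x |` Z')).
    by move=> u [/YdZ'|/ranE[->|/ranZ']]; [right|left|right].
  by apply: free_setU1 => //; apply: free_family_sub pfree => u [].
Qed.

End LinearAlgebra.

Section Dimension.
Local Open Scope ring_scope.
Local Notation span := Defs.span.
Variable R : pzRingType.
Hypothesis divR : forall a : R, a != 0 -> exists b, b * a = 1.
Hypothesis oneR : 1 != 0 :> R.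

Lemma free_set0 (V : lmodType R) : free_family (@set0 V) id.
Proof. by move=> [|x s] a // _ /(_ x (mem_head _ _)). Qed.

Lemma dimension_basis (V : lmodType R) (W : set V) : is_submodule W ->
  is_basis W (cardinal_set (dimension W)).
Proof.
move=> sW; rewrite /dimension /=.
have [X [_ fX WX]] := basis_extension divR sW (@sub0set _ W) (@free_set0 V).
by case: xgetP => [Y -> //|/(_ X)]; case; split => //; apply/free_setP.
Qed.

Lemma dimension_le (V' V : lmodType R) (W' : set V') (W : set V) (f : V' -> V) :
  is_submodule W' -> is_submodule W -> {morph f : v w / v + w} ->
  (forall a, {morph f : v / a *: v}) -> injective f ->
  (forall v, W' v -> W (f v)) ->
  cardinal_le (dimension W') (dimension W).
Proof.
move=> sW' sW fD fZ fI fW.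
have [/free_setP fX' X'W'] := dimension_basis sW'.
have [/free_setP fX XW] := dimension_basis sW.
set X' := cardinal_set _ in fX' X'W' *; set X := cardinal_set _ in fX XW *.
rewrite /cardinal_le -/X' -/X.
have /card_eqPle[_ le1] := inj_card_eq (in2W fI : {in X' &, injective f}).
have f0 : f 0 = 0 by rewrite -(scale0r 0) fZ scale0r.
apply: card_le_trans le1 _; apply: free_card_le_span => //; last first.
  by move=> _ [x X'x <-]; rewrite XW; apply: fW; rewrite -X'W'; exact: sub_span.
apply: free_family_criterion => // _ [x X'x <-]; rewrite image_id.
have /span_mono sp : (f @` X') `\ f x `<=` f @` (X' `\ x).
  by move=> _ [[y X'y <-] fyx]; exists y => //; split => // yx; apply: fyx; rewrite yx.
move=> /sp/span_imageP[s [a [us sX' e]]]; apply: (free_not_span oneR fX' X'x).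
apply/spanP; exists s, a; split => //; apply: fI.
by rewrite e (big_morph f fD f0); apply: eq_bigr => y _; rewrite fZ.
Qed.

(** The linear relation rho v' v stands for S' v' = S v, so that the two basis
    hypotheses concern the kernels of S' and S. On X0' the family t is f,
    elsewhere it selects any related vector. It is free: by rho, a relation
    among the t x puts the same combination of the x into span X0', hence
    involves only X0', where f is injective with free image. *)
Lemma matched_bases (V' V : lmodType R) (rho : V' -> V -> Prop)
    (X0' : set V') (X0 : set V) (f : V' -> V) :
  rho 0 0 ->
  (forall v' v w' w, rho v' v -> rho w' w -> rho (v' + w') (v + w)) ->
  (forall a v' v, rho v' v -> rho (a *: v') (a *: v)) ->
  (forall v', exists v, rho v' v) ->
  is_basis [set v' | rho v' 0] X0' -> is_basis [set v | rho 0 v] X0 ->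
  {in X0' &, injective f} -> (forall x, X0' x -> X0 (f x)) ->
  exists (X' : set V') (t : V' -> V),
    [/\ free_family X' id, span X' = [set: V'], free_family X' t,
      forall x, X' x -> rho x (t x) &
      f @` X0' = X0 -> (forall v, exists v', rho v' v) ->
        span (t @` X') = [set: V]].
Proof.
move=> rho0 rhoD rhoZ rhot [/free_setP fX0' spX0'] [/free_setP fX0 spX0] fI fX.
have rhoS (I : eqType) (s : seq I) (a : I -> R) (u' : I -> V') (u : I -> V) :
    (forall x, x \in s -> rho (u' x) (u x)) ->
    rho (\sum_(x <- s) a x *: u' x) (\sum_(x <- s) a x *: u x).
  elim: s => [|x s IH] su; first by rewrite !big_nil.
  rewrite !big_cons; apply: rhoD; first by apply: rhoZ; exact/su/mem_head.
  by apply: IH => y ys; apply: su; rewrite in_cons ys orbT.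
have sT : is_submodule [set: V'] by [].
have [X' [X0X' fX' spX']] := basis_extension divR sT (@subsetT _ X0') fX0'.
have [g gP] := choice rhot.
pose t x := if pselect (X0' x) is left _ then f x else g x.
have t0 x : X0' x -> t x = f x by rewrite /t; case: pselect.
have rho' x : X0' x -> rho x 0.
  by move=> Xx; have : span X0' x := sub_span Xx; rewrite spX0'.
have rhof x : X0' x -> rho 0 (f x).
  by move=> /fX Xx; have : span X0 (f x) := sub_span Xx; rewrite spX0.
have rhoX x : rho x (t x).
  rewrite /t; case: pselect => // Xx.
  by have := rhoD _ _ _ _ (rho' _ Xx) (rhof _ Xx); rewrite addr0 add0r.
exists X', t; split => //.
  move=> s a us sX' e.
  have sp0 : span X0' (\sum_(x <- s) a x *: x).
    by rewrite spX0' /= -e; apply: rhoS => x _; exact: rhoX.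
  have a0 x : x \in s -> ~ X0' x -> a x = 0.
    move=> xs nXx; apply: contrapT => /eqP/divR[c ca].
    apply: (free_not_span oneR fX' (sX' _ xs)).
    have [_ sD sZ] := span_submodule (X' `\ x).
    have : span (X' `\ x) (\sum_(y <- s) a y *: y).
      by apply: span_mono sp0 => y Xy; split; [exact: X0X'|move=> yx; apply: nXx; rewrite -yx].
    rewrite (big_rem x xs) /= => sp1.
    have sp2 : span (X' `\ x) (\sum_(y <- rem x s) a y *: y).
      apply: (@submodule_sum _ _ _ _ _ _ idfun) => [|y]; first exact: span_submodule.
      rewrite mem_rem_uniq // => /andP[/= /eqP yx ys].
      by apply: sub_span; split => //; exact: sX'.
    suff : span (X' `\ x) (c *: (a x *: x)) by rewrite scalerA ca scale1r.
    apply: (sZ).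
    rewrite -(addrK (\sum_(y <- rem x s) a y *: y) (a x *: x)) -scaleN1r.
    by apply: (sD) => //; apply: (sZ).
  (* What is left of the relation involves f on X0' only. *)
  have f1 : free_family X0' f.
    apply: free_family_criterion => // x Xx.
    have fsp : f @` (X0' `\ x) `<=` X0 `\ f x.
      move=> _ [y [Xy yx] <-]; split; first exact: fX.
      by move=> /fI fyx; apply: yx; apply: fyx; exact/mem_set.
    by move=> /(span_mono fsp); exact: (free_not_span oneR fX0 (fX _ Xx)).
  have : \sum_(x <- [seq x <- s | `[< X0' x >]]) a x *: f x = 0.
    rewrite big_filter -[RHS]e big_mkcond !big_seq; apply: eq_bigr => x xs.
    by case: asboolP => [/t0 -> //|/(a0 _ xs) ->]; rewrite scale0r.
  move=> e1 x xs; have [X0x|] := pselect (X0' x); last exact: a0.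
  apply: (f1 _ a _ _ e1); first exact: filter_uniq.
    by move=> y; rewrite mem_filter => /andP[/asboolP].
  by rewrite mem_filter xs andbT; exact/asboolP.
move=> fX0X rhos; apply/seteqP; split => // v _.
have [v' vv'] := rhos v.
have /spanP[s [a [us sX' e]]] : span X' v' by rewrite spX'.
have [_ sD sZ] := span_submodule (t @` X').
have sps : span (t @` X') (\sum_(x <- s) a x *: t x).
  by apply/span_imageP; exists s, a.
rewrite -(subrK (\sum_(x <- s) a x *: t x) v); apply: (sD) => //.
suff : span X0 (v - \sum_(x <- s) a x *: t x).
  apply: span_mono => x; rewrite -fX0X => -[y Xy <-].
  by exists y; [exact: X0X'|exact: t0].
rewrite spX0 /= -(subrr v') {2}e -!scaleN1r; apply: rhoD => //.
by apply: rhoZ; apply: rhoS => x _; exact: rhoX.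
Qed.
End Dimension.

(** * Closed normal subgroups of profinite groups *)

Section Compactness.

Lemma closed_graph_continuous (S T : topologicalType) (f : S -> T) :
  compact [set: T] -> closed [set p : S * T | f p.1 = p.2] -> continuous f.
Proof.
move=> cT cf x W; rewrite nbhsE => -[V [oV Vfx] VW].
have cV : compact (~` V) by apply: (subclosed_compact _ cT) => //; exact: open_closedC.
have /compact_near_coveringP/(_ S (nbhs x) (fun x' y => f x' <> y) _) := cV.
move=> H; have : \forall x' \near x, forall y, (~` V) y -> f x' <> y.
  apply: H => y nVy.
  have : nbhs (x, y) (~` [set p : S * T | f p.1 = p.2]).
    apply: open_nbhs_nbhs; split; first exact: closed_openC.
    by move=> /= fxy; apply: nVy; rewrite -fxy.
  move=> [[A B] /= [Ax By] AB]; exists (B, A) => //= -[y' x'] /= [By' Ax'].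
  exact: (AB (x', y')).
by apply: filterS => x' nx; apply: VW; apply: contrapT => /nx.
Qed.

Lemma compact_bigcap_nonempty (T : topologicalType) (I : eqType) (C : I -> set T) :
  compact [set: T] -> (forall i, closed (C i)) ->
  (forall s : seq I, exists x, forall i, i \in s -> C i x) ->
  exists x, forall i, C i x.
Proof.
move=> cT cC fip.
pose F := filter_from [set: seq I] (fun s => [set x | forall i, i \in s -> C i x]).
have FF : Filter F.
  apply: filter_from_filter; first by exists [::].
  move=> s t _ _; exists (s ++ t) => // x /= xst.
  by split=> i Hi; apply: xst; rewrite mem_cat Hi ?orbT.
have PF : ProperFilter F.
  by apply: filter_from_proper => s _; have [x xs] := fip s; exists x.
have [x [_ clx]] := cT F PF filterT.
exists x => i; apply: (cC i).
move=> B nB; apply: clx => //.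
by exists [:: i] => // y; apply; rewrite mem_head.
Qed.

End Compactness.

Section NormalSubgroups.
Variable H : profiniteGroupType.

Lemma normal_inj (M N : normalSubgroup H) :
  normal_set M = normal_set N -> M = N.
Proof.
case: M N => M m1 mM mV mJ mc [N n1 nM nV nJ nc] /= MN; subst N.
by congr NormalSubgroup; exact: Prop_irrelevance.
Qed.

Lemma normalVE (N : normalSubgroup H) x : normal_set N x^-1 <-> normal_set N x.
Proof. by split=> [/normalV|]; rewrite ?invgK //; exact: normalV. Qed.

Lemma normalMl (N : normalSubgroup H) x y :
  normal_set N x -> normal_set N (x * y) <-> normal_set N y.
Proof.
move=> Nx; split; last exact: normalM.
by move=> /(normalM (normalV Nx)); rewrite mulgA mulVg mul1g.
Qed.

Lemma normalC (N : normalSubgroup H) x y :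
  normal_set N (x * y) -> normal_set N (y * x).
Proof. by move=> /(normalJ x); rewrite /conjg !mulgA mulVg mul1g. Qed.

Lemma normal_conj (N : normalSubgroup H) h x :
  normal_set N x -> normal_set N (h * x * h^-1).
Proof. by move=> /(normalJ h^-1); rewrite conjgE invgK mulgA. Qed.

Lemma coset_closed (N : normalSubgroup H) x : closed [set h | normal_set N (x^-1 * h)].
Proof.
apply: (@preimage_closed _ _ (fun h => x^-1 * h)); last exact: normal_closed.
by move=> h _; exact: mulgl_continuous.
Qed.

Section Product.
Variables L M : normalSubgroup H.
Let LM : set H := [set x | exists2 l, normal_set L l & normal_set M (l^-1 * x)].
Let LM1 : LM 1.
Proof. by exists 1; rewrite ?mulg1 ?invg1; exact: normal1. Qed.
Let LMM x y : LM x -> LM y -> LM (x * y).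
Proof.
move=> [l Ll Mx] [k Lk My]; exists (l * k); first exact: normalM.
have := normalM (normalJ k Mx) My; congr (normal_set M _).
by rewrite conjgE invgM !mulgA mulgK.
Qed.
Let LMV x : LM x -> LM x^-1.
Proof.
move=> [l Ll Mx]; exists l^-1; first exact: normalV.
by rewrite invgK; apply: normalC; apply/normalVE; rewrite invgM invgK.
Qed.
Let LMJ x y : LM x -> LM (x ^ y).
Proof.
move=> [l Ll Mx]; exists (l ^ y); first exact: normalJ.
by have := normalJ y Mx; rewrite conjMg conjVg.
Qed.
Let LMc : closed LM.
Proof.
have cL : compact (normal_set L).
  by apply: (subclosed_compact _ (@profinite_compact H)) => //; exact: normal_closed.
have cM : compact (normal_set M).
  by apply: (subclosed_compact _ (@profinite_compact H)) => //; exact: normal_closed.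
apply: compact_closed; first exact: profinite_hausdorff.
rewrite (_ : LM = (fun p : H * H => p.1 * p.2) @` (normal_set L `*` normal_set M)).
  apply: continuous_compact; last exact: compact_setX.
  by apply: continuous_subspaceT; exact: mulg_continuous.
apply/seteqP; split=> [x [l Ll Mx]|_ [[l m] /= [Ll Mm] <-]].
  by exists (l, l^-1 * x) => //=; rewrite mulgA mulgV mul1g.
by exists l => //; rewrite mulgA mulVg mul1g.
Qed.

Definition normal_prod : normalSubgroup H := NormalSubgroup LM1 LMM LMV LMJ LMc.

Lemma normal_prodl : normal_set L `<=` normal_set normal_prod.
Proof. by move=> x Lx; exists x; rewrite ?mulVg //; exact: normal1. Qed.
Lemma normal_prodr : normal_set M `<=` normal_set normal_prod.
Proof.
by move=> x Mx; exists 1; [exact: normal1|rewrite invg1 mul1g].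
Qed.
End Product.

Section Meet.
Variables (I : Type) (M : normalSubgroup H) (D : set I) (N : I -> normalSubgroup H).
Let S : set H := [set x | normal_set M x /\ forall i, D i -> normal_set (N i) x].
Let S1 : S 1. Proof. by split=> *; exact: normal1. Qed.
Let SM x y : S x -> S y -> S (x * y).
Proof.
move=> [Mx Nx] [My Ny]; split=> [|i Di]; apply: normalM => //; [exact: Nx|exact: Ny].
Qed.
Let SV x : S x -> S x^-1.
Proof. by move=> [Mx Nx]; split=> [|i Di]; apply: normalV => //; exact: Nx. Qed.
Let SJ x y : S x -> S (x ^ y).
Proof. by move=> [Mx Nx]; split=> [|i Di]; apply: normalJ => //; exact: Nx. Qed.
Let Sc : closed S.
Proof.
rewrite (_ : S = normal_set M `&` \bigcap_(i in D) normal_set (N i)) //.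
apply: closedI; first exact: normal_closed.
by apply: closed_bigI => i _; exact: normal_closed.
Qed.
(** M plays the role of the meet of the empty family. *)
Definition normal_meet : normalSubgroup H := NormalSubgroup S1 SM SV SJ Sc.
End Meet.
End NormalSubgroups.

(** * A Chinese remainder theorem *)

Section Supplemented.
Variables (H G : profiniteGroupType) (tau : epi H G).

(** The consequence of maximality in ker tau that the arguments use: a normal
    subgroup of ker tau that is not contained in N covers ker tau modulo N. *)
Definition supplemented (N : normalSubgroup H) : Prop :=
  forall L : normalSubgroup H, normal_set L `<=` normal_set (ker tau) ->
  ~ normal_set L `<=` normal_set N ->
  forall k, normal_set (ker tau) k ->
  exists2 l, normal_set L l & normal_set N (l^-1 * k).

Definition independent (I : eqType) (N : I -> normalSubgroup H) : Prop :=
  forall (i : I) (s : seq I), i \notin s ->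
  ~ normal_set (normal_meet (ker tau) [set j | j \in s] N) `<=` normal_set (N i).

(** A finite number of conditions is handled by induction: the intersection L
    of the subgroups treated so far is not contained in the next N i, so it
    covers the kernel modulo N i, and the partial solution can be corrected
    inside L. Compactness gives all conditions at once. *)
Lemma independent_cosets_meet (I : eqType) (N : I -> normalSubgroup H) :
  (forall i, supplemented (N i)) -> independent N ->
  forall (x : I -> H) g, (forall i, tau (x i) = g) ->
  exists2 h, tau h = g & forall i, normal_set (N i) ((x i)^-1 * h).
Proof.
move=> supN indN x g xg.
have [x0 x0g] := epi_surj tau g.
pose C (i : option I) : set H := if i is Some i then
  [set h | normal_set (N i) ((x i)^-1 * h)]
  else [set h | normal_set (ker tau) (x0^-1 * h)].
(* The index None carries the condition of lying over g. *)
have C0 h : C None h <-> tau h = g.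
  rewrite /C /= epiM epiV x0g; split=> [|->]; last by rewrite mulVg.
  by move=> e; apply: (@mulgI _ g^-1); rewrite mulVg.
have [||h Ch] := @compact_bigcap_nonempty H (option I) C (@profinite_compact H).
- by case=> [i|]; exact: coset_closed.
- move=> s0; pose s := undup (pmap id s0).
  suff [h hg hs] : exists2 h, tau h = g & forall i, i \in s -> C (Some i) h.
    exists h => -[i|] is0; last exact/C0.
    by apply: hs; rewrite mem_undup mem_pmap map_id.
  have : uniq s by exact: undup_uniq.
  elim: s => [_|i s IH /= /andP[is_ us]]; first by exists x0.
  have [h hg hs] := IH us.
  have [||l [Kl Nl] Ni] := supN i (normal_meet (ker tau) [set j | j \in s] N) _
    (indN _ _ is_) (h^-1 * x i).
  - by move=> ? [].
  - by rewrite /= epiM epiV hg xg mulVg.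
  exists (h * l); first by rewrite epiM Kl mulg1.
  move=> j; rewrite in_cons => /predU1P[->|js] /=.
    by apply/normalVE; move: Ni; rewrite !invgM invgK !mulgA.
  by rewrite mulgA; apply: normalM; [exact: hs|exact: Nl].
- exists h; first exact/C0/(Ch None).
  by move=> i; exact: (Ch (Some i)).
Qed.

End Supplemented.

(** * Simple modules and Schur's lemma *)

Section SimpleModules.
Variable G : topologicalGroupType.

Lemma discrete_continuous (A : simple_gmodule G) (T : topologicalType) (f : A -> T) :
  continuous f.
Proof. by apply/continuousP => U _; exact: simple_discrete. Qed.

Lemma hom0 (M A : gmodule G) (f : ghom M A) : f 0%R = 0%R.
Proof. by apply: (@addrI _ (f 0%R)); rewrite -homD !addr0. Qed.

Lemma homN (M A : gmodule G) (f : ghom M A) x : f (- x)%R = (- f x)%R.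
Proof. by apply: (@addrI _ (f x)); rewrite -homD !subrr hom0. Qed.

Lemma homB (M A : gmodule G) (f : ghom M A) x y : f (x - y)%R = (f x - f y)%R.
Proof. by rewrite homD homN. Qed.

Lemma hom_image (M : gmodule G) (A : simple_gmodule G) (f : ghom M A) x :
  f x != 0%R -> forall a, exists y, f y = a.
Proof.
move=> fx a; have [|||e|e] := @simple_submodule G A (range f).
- by exists 0%R => //; rewrite hom0.
- by move=> _ _ [y _ <-] [z _ <-]; exists (y - z)%R => //; rewrite homB.
- by move=> g _ [y _ <-]; exists (gact g y) => //; rewrite homact.
- have : range f (f x) by exists x.
  by rewrite e /= => f0; rewrite f0 eqxx in fx.
- by have : range f a by [rewrite e]; case=> y _; exists y.
Qed.

Lemma hom_injective (M : simple_gmodule G) (A : gmodule G) (f : ghom M A) x :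
  f x != 0%R -> injective f.
Proof.
move=> fx; have [|||e|e] := @simple_submodule G M [set y | f y = 0%R].
- exact: hom0.
- by move=> y z /= fy fz; rewrite homB fy fz subrr.
- by move=> g y /= fy; rewrite homact fy gact0.
- move=> y z fyz; apply/eqP; rewrite -subr_eq0; apply/eqP.
  have : [set y | f y = 0%R] (y - z)%R by rewrite /= homB fyz subrr.
  by rewrite e.
- have : [set y | f y = 0%R] x by rewrite e.
  by move=> /= f0; rewrite f0 eqxx in fx.
Qed.

Lemma bijective_gmodule_iso (M : gmodule G) (A : simple_gmodule G) (f : ghom M A) x :
  f x != 0%R -> injective f -> gmodule_iso M A.
Proof.
move=> fx fI; exists f; first exact: set_valP.
have [f' f'K] := choice (hom_image fx).
exists f'; split => //; last exact: discrete_continuous.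
by move=> y; apply: fI.
Qed.

Lemma schur (M A : simple_gmodule G) (f : ghom M A) x :
  f x != 0%R -> gmodule_iso M A.
Proof. by move=> fx; apply: (bijective_gmodule_iso fx); exact: hom_injective fx. Qed.

Lemma gend_neq0 (M A : gmodule G) (f : ghom M A) : f != 0%R -> exists x, f x != 0%R.
Proof.
move=> f0; apply: contrapT => /forallNP nf; case/eqP: f0.
by apply: homP => x; apply/eqP/negPn/negP/nf.
Qed.

Lemma gend_div (A : simple_gmodule G) (a : gend A) :
  a != 0%R -> exists b : gend A, (b * a = 1)%R.
Proof.
move=> /gend_neq0[x ax].
have [f _ [f' [fK f'K _]]] := schur ax.
have aI := hom_injective ax.
have [b bK] := choice (hom_image ax).
have bP : is_ghom (b : A -> A).
  split=> [y z|g y|]; [| |exact: discrete_continuous].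
  - by apply: aI; rewrite homD !bK.
  - by apply: aI; rewrite homact !bK.
exists (exist _ b (mem_set bP)); apply: homP => y.
by apply: aI; rewrite /= bK.
Qed.

Lemma gend1 (A : simple_gmodule G) : (1 != 0 :> gend A)%R.
Proof.
have [a a0] := simple_neq0 A; apply/eqP => /(congr1 (fun f : gend A => hom_fun f a)) e.
by move: a0; rewrite (_ : a = 0%R) ?eqxx.
Qed.

Lemma gmodule_iso_refl (M : gmodule G) : gmodule_iso M M.
Proof.
have cid x : {for x, continuous (@id M)} by exact: cvg_id.
by exists id; [split|exists id; split].
Qed.

Lemma gmodule_iso_sym (M A : gmodule G) : gmodule_iso M A -> gmodule_iso A M.
Proof.
move=> [f [fD fG fc] [f' [fK f'K f'c]]]; exists f'; last by exists f.
split=> // [x y|g x]; apply: (can_inj fK); first by rewrite fD !f'K.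
by rewrite fG !f'K.
Qed.

Lemma gmodule_iso_trans (M N A : gmodule G) :
  gmodule_iso M N -> gmodule_iso N A -> gmodule_iso M A.
Proof.
move=> [f [fD fG fc] [f' [fK f'K f'c]]] [h [hD hG hc] [h' [hK h'K h'c]]].
exists (h \o f).
  split=> [x y|g x|x] /=; rewrite ?fD ?hD ?fG ?hG //.
  by apply: continuous_comp; [exact: fc|exact: hc].
exists (f' \o h'); split; [exact: can_comp|exact: can_comp|].
by move=> x; apply: continuous_comp; [exact: h'c|exact: f'c].
Qed.

Lemma hom_scaleE (M A : gmodule G) (a : gend A) (f : ghom M A) x :
  hom_fun (a *: f)%R x = hom_fun a (f x).
Proof. by []. Qed.

Lemma hom_sumE (M A : gmodule G) (I : Type) (s : seq I) (a : I -> gend A)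
    (f : I -> ghom M A) x :
  hom_fun (\sum_(i <- s) a i *: f i)%R x = (\sum_(i <- s) hom_fun (a i) (f i x))%R.
Proof.
elim: s => [|i s IH]; first by rewrite !big_nil.
by rewrite !big_cons hom_addE hom_scaleE IH.
Qed.

End SimpleModules.

(** * Characters of the kernel *)

Section QuotientProjection.
Variables (H : profiniteGroupType) (N : normalSubgroup H).
Local Notation Q := (quotient_group N).

Lemma quotient_proj_surj (y : Q) : exists x : H, \pi_Q x = y.
Proof. by exists (repr y); rewrite reprK. Qed.

Definition quotient_proj : epi H Q :=
  @Epi H Q (\pi_Q : H -> Q) (@quotient_mulE H N) (@pi_continuous H Q) quotient_proj_surj.

Lemma quotient_projE (x y : H) :
  quotient_proj x = quotient_proj y <-> normal_set N (x^-1 * y).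
Proof. exact: coset_eqP. Qed.

Lemma quotient_proj1 (x : H) : quotient_proj x = 1 <-> normal_set N x.
Proof.
rewrite -(epi1 quotient_proj); split.
  by move=> /esym/quotient_projE; rewrite invg1 mul1g.
by move=> Nx; apply/esym/quotient_projE; rewrite invg1 mul1g.
Qed.

Lemma quotient_epi_proj (G : profiniteGroupType) (tau : epi H G)
  (sNK : normal_set N `<=` normal_set (ker tau)) x :
  quotient_epi sNK (quotient_proj x) = tau x.
Proof. exact: quotient_epiE. Qed.
End QuotientProjection.

Section Characters.
Variables (H G : profiniteGroupType) (tau : epi H G).
Local Notation K := (normal_set (ker tau)).

(** A character is a total function on H of which only the values on ker tau
    matter. For finite discrete A, closedness of the kernel amounts to
    continuity on ker tau. *)
Record is_char (A : gmodule G) (chi : H -> A) : Prop := IsChar {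
  charM : forall x y, K x -> K y -> chi (x * y) = (chi x + chi y)%R;
  charJ : forall h x, K x -> chi (h * x * h^-1) = gact (tau h) (chi x);
  char_closed : closed [set x | K x /\ chi x = 0%R]
}.

Section Theory.
Variables (A : gmodule G) (chi : H -> A) (cchi : is_char chi).

Lemma char1 : chi 1 = 0%R.
Proof.
by apply: (@addrI _ (chi 1)); rewrite -(charM cchi) // ?mulg1 ?addr0 //; exact: ker1.
Qed.

Lemma charV x : K x -> chi x^-1 = (- chi x)%R.
Proof.
move=> Kx; apply: (@addrI _ (chi x)); rewrite -(charM cchi) // ?mulgV ?subrr ?char1 //.
exact: normalV.
Qed.

Let S : set H := [set x | K x /\ chi x = 0%R].
Let S1 : S 1. Proof. by split; [exact: normal1|exact: char1]. Qed.
Let SM x y : S x -> S y -> S (x * y).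
Proof.
by move=> [Kx x0] [Ky y0]; split; [exact: normalM|rewrite (charM cchi) // x0 y0 addr0].
Qed.
Let SV x : S x -> S x^-1.
Proof. by move=> [Kx x0]; split; [exact: normalV|rewrite charV // x0 oppr0]. Qed.
Let SJ x y : S x -> S (x ^ y).
Proof.
move=> [Kx x0]; split; first exact: normalJ.
by have := charJ cchi y^-1 Kx; rewrite invgK conjgE mulgA x0 gact0.
Qed.
Definition char_ker : normalSubgroup H :=
  NormalSubgroup S1 SM SV SJ (char_closed cchi).

Lemma char_ker_sub : normal_set char_ker `<=` K. Proof. by move=> x []. Qed.

Lemma char_kerE x y : K x -> K y ->
  normal_set char_ker (x^-1 * y) <-> chi x = chi y.
Proof.
move=> Kx Ky.
rewrite -[normal_set _ _]/(K (x^-1 * y) /\ chi (x^-1 * y) = 0%R).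
rewrite (charM cchi) //; last exact: normalV.
rewrite charV // addrC; split=> [[_ /eqP]|xy]; first by rewrite subr_eq0 => /eqP.
by split; [apply: normalM => //; exact: normalV|rewrite xy subrr].
Qed.

Lemma char_ker_abelian : abelian_kernel (quotient_epi char_ker_sub).
Proof.
move=> a b; have [x <-] := quotient_proj_surj a; have [y <-] := quotient_proj_surj b.
rewrite -[_ _ x]/(quotient_proj _ x) -[_ _ y]/(quotient_proj _ y) /= => Kx Ky.
have {}Kx : K x by rewrite /= -(quotient_epi_proj char_ker_sub).
have {}Ky : K y by rewrite /= -(quotient_epi_proj char_ker_sub).
change (quotient_proj char_ker x * quotient_proj char_ker y =
  quotient_proj char_ker y * quotient_proj char_ker x).
rewrite -!epiM; apply/quotient_projE/char_kerE; try exact: normalM.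
by rewrite !(charM cchi) // addrC.
Qed.
End Theory.

Section Simple.
Variables (A : simple_gmodule G) (chi : H -> A) (cchi : is_char chi).

(** A fibre is empty or a coset of the kernel, and A is finite. *)
Lemma char_fiber_closed (D : set A) : closed [set x | K x /\ D (chi x)].
Proof.
rewrite (_ : [set _ | _] = \bigcup_(a in D) [set x | K x /\ chi x = a]); last first.
  by apply/seteqP; split=> [x [Kx Dx]|x [a Da [Kx xa]]]; [exists (chi x)|split; rewrite ?xa].
apply: closed_bigcup => [|a Da].
  exact: sub_finite_set (@subsetT _ D) (simple_finite A).
have [[x0 [Kx0 <-]]|n] := pselect (exists x, K x /\ chi x = a); last first.
  rewrite (_ : [set _ | _] = set0); first exact: closed0.
  by apply/seteqP; split => // x Hx; apply: n; exists x.
rewrite (_ : [set _ | _] = [set x | normal_set (char_ker cchi) (x0^-1 * x)]).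
  exact: coset_closed.
apply/seteqP; split=> x.
  by move=> [Kx e]; apply/char_kerE.
move=> Nx; have Kx : K x by have [+ _] := Nx; apply: (normalMl _ (normalV Kx0)).1.
by split => //; apply/esym; have /char_kerE := Nx; apply.
Qed.

(** The values of chi on L form a nonzero submodule of A. *)
Lemma char_image x : K x -> chi x != 0%R -> forall L : normalSubgroup H,
  normal_set L `<=` K -> normal_set L x -> forall a, exists2 y, normal_set L y & chi y = a.
Proof.
move=> Kx x0 L LK Lx a; have [|||e|e] := @simple_submodule G A (chi @` normal_set L).
- by exists 1; [exact: normal1|exact: char1].
- move=> _ _ [y Ly <-] [z Lz <-]; exists (y * z^-1).
    by apply: normalM => //; exact: normalV.
  have Ky := LK _ Ly; have Kz := LK _ Lz.
  by rewrite (charM cchi) ?(charV cchi) //; exact: normalV.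
- move=> g _ [y Ly <-]; have [h <-] := epi_surj tau g.
  exists (h * y * h^-1); first exact: normal_conj.
  by rewrite (charJ cchi) //; exact: LK.
- have : (chi @` normal_set L) (chi x) by exists x.
  by rewrite e /= => x0'; rewrite x0' eqxx in x0.
- by have : (chi @` normal_set L) a by [rewrite e]; case=> y; exists y.
Qed.

Lemma char_supplemented : supplemented tau (char_ker cchi).
Proof.
move=> L LK nL k Kk.
have [l [Ll nl]] : exists l, normal_set L l /\ ~ normal_set (char_ker cchi) l.
  by apply: contrapT => /forallNP nL'; apply: nL => l Ll; apply: contrapT => nl; apply: (nL' l).
have Kl := LK _ Ll.
have l0 : chi l != 0%R by apply/eqP => l0; apply: nl.
have [m Lm e] := char_image Kl l0 LK Ll (chi k).
exists m => //; apply/char_kerE => //; exact: LK.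
Qed.

End Simple.
End Characters.

Section KernelFun.
Variables (E G : profiniteGroupType) (pi : epi E G) (ab : abelian_kernel pi).
Variables (A : gmodule G) (phi : ghom (kernel_module ab) A).
Local Notation K := (normal_set (ker pi)).

Definition kernel_fun (x : E) : A :=
  if pselect (K x) is left Kx then phi (kernel_in ab Kx) else 0%R.

Lemma kernel_in_eq x y (Kx : K x) (Ky : K y) :
  x = y -> kernel_in ab Kx = kernel_in ab Ky.
Proof. by move=> xy; apply: kernel_val_inj. Qed.

Lemma kernel_funE x (Kx : K x) : kernel_fun x = phi (kernel_in ab Kx).
Proof. by rewrite /kernel_fun; case: pselect => // Kx'; congr (phi _); exact: kernel_in_eq. Qed.

Lemma kernel_funM x y : K x -> K y -> kernel_fun (x * y) = (kernel_fun x + kernel_fun y)%R.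
Proof.
move=> Kx Ky; rewrite (kernel_funE (normalM Kx Ky)) (kernel_funE Kx) (kernel_funE Ky).
by rewrite -homD; congr (phi _); exact: kernel_val_inj.
Qed.

Lemma kernel_funJ h x : K x -> kernel_fun (h * x * h^-1) = gact (pi h) (kernel_fun x).
Proof.
move=> Kx; rewrite (kernel_funE Kx) -homact.
have Khx : K (h * x * h^-1) by exact: normal_conj.
rewrite (kernel_funE Khx); congr (phi _); apply: kernel_val_inj.
by rewrite [RHS]kernel_actE.
Qed.

Lemma kernel_fun_continuous (T : topologicalType) (f : T -> E) :
  continuous f -> (forall t, K (f t)) -> continuous (fun t => kernel_fun (f t)).
Proof.
move=> cf Kf; rewrite (_ : (fun t => _) = phi \o (fun t => kernel_in ab (Kf t))).
  move=> t; apply: continuous_comp; last exact: hom_continuous.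
  by apply: kernel_continuous; exact: cf.
by apply/funext => t; exact: kernel_funE.
Qed.

Lemma kernel_fun_char : hausdorff_space A -> is_char pi kernel_fun.
Proof.
move=> hA; split; [exact: kernel_funM|exact: kernel_funJ|].
have : closed [set u : kernel_module ab | phi u = 0%R].
  apply: (@preimage_closed _ _ phi [set 0%R]); first by move=> u _; exact: hom_continuous.
  by apply: accessible_closed_set1; exact: hausdorff_accessible.
rewrite -openC => -[V oV VE].
rewrite (_ : [set _ | _] = K `&` ~` V).
  by apply: closedI; [exact: normal_closed|exact: open_closedC].
apply/seteqP; split=> x /= [Kx x0]; split=> //.
  have : ~ (~` [set u : kernel_module ab | phi u = 0%R]) (kernel_in ab Kx).
    by apply; rewrite /= -(kernel_funE Kx).
  by rewrite -VE.
have : ~ (~` [set u : kernel_module ab | phi u = 0%R]) (kernel_in ab Kx).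
  by rewrite -VE.
by rewrite (kernel_funE Kx) => /contrapT.
Qed.
End KernelFun.

Lemma simple_hausdorff (G : topologicalGroupType) (A : simple_gmodule G) : hausdorff_space A.
Proof.
rewrite open_hausdorff => x y xy; exists ([set x], [set y]) => /=.
  by split; apply/mem_set.
split; [exact: simple_discrete|exact: simple_discrete|].
apply/eqP; rewrite -subset0 => z [/= -> yx]; by rewrite yx eqxx in xy.
Qed.

Section CharDescent.
Variables (H G : profiniteGroupType) (tau : epi H G) (A : simple_gmodule G).
Local Notation K := (normal_set (ker tau)).

Lemma char_comp (H' : profiniteGroupType) (tau' : epi H' G) (psi : epi H H')
    (chi : H' -> A) : tau =1 tau' \o psi -> is_char tau' chi -> is_char tau (chi \o psi).
Proof.
move=> e cchi; have KE x : K x <-> normal_set (ker tau') (psi x) by rewrite /= e.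
split.
- by move=> x y /KE Kx /KE Ky; rewrite /= epiM (charM cchi).
- by move=> h x /KE Kx; rewrite /= !epiM epiV (charJ cchi) // e.
- rewrite (_ : [set _ | _] = psi @^-1` [set x | normal_set (ker tau') x /\ chi x = 0%R]).
    apply: preimage_closed (char_closed cchi) => x _; exact: epi_continuous.
  by apply/seteqP; split=> x [/KE].
Qed.

Variables (M : normalSubgroup H) (sMK : normal_set M `<=` K).
Variable (ab : abelian_kernel (quotient_epi sMK)).

Lemma kernel_fun_proj_char (phi : ghom (kernel_module ab) A) :
  is_char tau (kernel_fun phi \o quotient_proj M).
Proof.
apply: char_comp; last by apply: kernel_fun_char; exact: simple_hausdorff.
by move=> x; exact: esym (quotient_epi_proj sMK x).
Qed.

Lemma quotient_ker x : normal_set (ker (quotient_epi sMK)) (quotient_proj M x) <-> K x.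
Proof.
rewrite -[normal_set _ _]/(quotient_epi sMK (quotient_proj M x) = 1).
by rewrite quotient_epi_proj.
Qed.

(** Continuity of the induced map: the points of ker tau where chi avoids U
    form a closed, hence compact set, so their image in the quotient is closed.
    *)
Lemma char_descend (chi : H -> A) : is_char tau chi ->
  (forall x, normal_set M x -> chi x = 0%R) ->
  exists phi : ghom (kernel_module ab) A,
    forall x, K x -> kernel_fun phi (quotient_proj M x) = chi x.
Proof.
move=> cchi chiM.
have chi_eq x y : K x -> quotient_proj M x = quotient_proj M y -> chi x = chi y.
  move=> Kx /quotient_projE Nxy.
  have Ky : K y by apply: (normalMl _ (normalV Kx)).1; exact: sMK.
  by apply/(char_kerE cchi Kx Ky); split; [exact: sMK|exact: chiM].
pose lift (u : kernel_module ab) : H := repr (kernel_val u).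
have liftK u : quotient_proj M (lift u) = kernel_val u by exact: reprK.
have Kl u : K (lift u).
  by apply/quotient_ker; rewrite liftK; exact: kernel_valP.
pose f u := chi (lift u).
have fE u x : quotient_proj M x = kernel_val u -> f u = chi x.
  by move=> xu; apply: chi_eq => //; rewrite liftK.
have fP : is_ghom f.
  split.
  - move=> u v; rewrite (fE (u + v)%R (lift u * lift v)); first by rewrite (charM cchi).
    by rewrite epiM !liftK.
  - move=> g u; have [h <-] := epi_surj tau g.
    rewrite (fE _ (h * lift u * h^-1)); first by rewrite (charJ cchi).
    rewrite -[X in gact X u](quotient_epi_proj sMK h) [RHS]kernel_actE.
    by rewrite !epiM epiV liftK.
  - apply/continuousP => U _.
    have cF : closed (quotient_proj M @` [set x | K x /\ (~` U) (chi x)]).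
      apply: compact_closed; first exact: profinite_hausdorff.
      apply: continuous_compact.
        by apply: continuous_subspaceT; exact: epi_continuous.
      apply: (subclosed_compact _ (@profinite_compact H)) => //.
      exact: char_fiber_closed.
    rewrite (_ : f @^-1` U = @kernel_val _ _ _ ab @^-1`
       (~` (quotient_proj M @` [set x | K x /\ (~` U) (chi x)]))).
      apply: open_comp; last exact: closed_openC.
      by move=> u _; exact: kernel_val_continuous.
    apply/seteqP; split=> [u /= Uu [x [Kx nUx] /fE e]|u /= nu].
      by apply: nUx; rewrite -e.
    by apply: contrapT => nUu; apply: nu; exists (lift u); [split; [exact: Kl|]|exact: liftK].
exists (exist _ f (mem_set fP)) => x Kx.
have Kx' := (quotient_ker x).2 Kx.
by rewrite (kernel_funE _ Kx') /=; exact: fE.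
Qed.
End CharDescent.

Section BA.
Variables (H G : profiniteGroupType) (tau : epi H G) (A : simple_gmodule G).
Local Notation K := (normal_set (ker tau)).

(** An isomorphism of K/N with A is a character of K with kernel N; conversely
    a nonzero character is onto A. Thus N_A is the common kernel of all
    characters with values in A. *)
Lemma C_A_char (N : normalSubgroup H) : C_A tau A N <->
  exists (chi : H -> A) (cchi : is_char tau chi),
    N = char_ker cchi /\ exists2 x, K x & chi x != 0%R.
Proof.
split=> [[sNK [ab [f fP [f' [fK f'K f'c]]]]]|[chi [cchi [-> [x Kx chix]]]]].
  pose phi : ghom (kernel_module ab) A := exist _ f (mem_set fP).
  have cchi := kernel_fun_proj_char phi.
  exists (kernel_fun phi \o quotient_proj N), cchi; split.
    apply: normal_inj; apply/seteqP; split=> x.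
      move=> Nx; have Kx := sNK _ Nx; split => //.
      rewrite -[LHS]/(kernel_fun phi (quotient_proj N x)); have /quotient_proj1 -> := Nx.
      exact: (char1 (kernel_fun_char phi (@simple_hausdorff _ A))).
    move=> [Kx]; rewrite /= (kernel_funE _ ((quotient_ker sNK x).2 Kx)).
    rewrite -(hom0 phi) => /(can_inj fK)/(congr1 (@kernel_val _ _ _ _)) /=.
    by move=> /quotient_proj1.
  have [a a0] := simple_neq0 A.
  have [x xa] : exists x, quotient_proj N x = kernel_val (f' a).
    by have [x <-] := epi_surj (quotient_proj N) (kernel_val (f' a)); exists x.
  have Kx : K x by apply/(quotient_ker sNK); rewrite xa; exact: kernel_valP.
  exists x => //=; rewrite (kernel_funE _ ((quotient_ker sNK x).2 Kx)).
  rewrite (_ : kernel_in _ _ = f' a); last exact: kernel_val_inj.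
  by rewrite /= f'K.
exists (@char_ker_sub _ _ _ _ _ cchi), (@char_ker_abelian _ _ _ _ _ cchi).
have [|phi phiE] := char_descend (@char_ker_abelian _ _ _ _ _ cchi) cchi.
  by move=> y [].
have Kx' := (quotient_ker (char_ker_sub (cchi := cchi)) x).2 Kx.
apply: (@bijective_gmodule_iso _ _ _ phi (kernel_in _ Kx')).
  by rewrite -(kernel_funE phi Kx') phiE.
move=> u v; have [y yu] := epi_surj (quotient_proj (char_ker cchi)) (kernel_val u).
have [z zv] := epi_surj (quotient_proj (char_ker cchi)) (kernel_val v).
have Ky : K y by apply/(quotient_ker (char_ker_sub (cchi := cchi))); rewrite yu; exact: kernel_valP.
have Kz : K z by apply/(quotient_ker (char_ker_sub (cchi := cchi))); rewrite zv; exact: kernel_valP.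
have uE : u = kernel_in _ (kernel_valP u) by exact: kernel_val_inj.
have vE : v = kernel_in _ (kernel_valP v) by exact: kernel_val_inj.
rewrite {1}uE {1}vE -!kernel_funE -yu -zv !phiE // => e.
apply: kernel_val_inj; rewrite -yu -zv; exact/quotient_projE/char_kerE.
Qed.

(** With char_surj and char_inj, this identifies Hom_G(B_A, A) with the
    characters of ker tau that take values in A. *)
Definition char (phi : ghom (B_A tau A) A) : H -> A :=
  kernel_fun phi \o quotient_proj (N_A tau A).

Lemma char_is_char phi : is_char tau (char phi).
Proof. exact: kernel_fun_proj_char. Qed.

(** A nonzero character vanishes on N_A because its kernel belongs to C_A. *)
Lemma char_surj (chi : H -> A) : is_char tau chi ->
  exists phi, forall x, K x -> char phi x = chi x.
Proof.
move=> cchi.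
have [[x Kx x0]|n] := pselect (exists2 x, K x & chi x != 0%R).
  apply: char_descend => // y [Ky Ny].
  have [] : normal_set (char_ker cchi) y; last by [].
  by apply: Ny; apply/C_A_char; exists chi, cchi; split => //; exists x.
exists 0%R => x Kx; rewrite /char /= (kernel_funE _ ((quotient_ker (@N_A_sub _ _ tau A) x).2 Kx)).
apply/eqP; rewrite eq_sym; apply/negPn/negP => x0; apply: n; exists x => //.
Qed.

Lemma charE phi x (Kx : normal_set (ker (tau_A tau A)) (quotient_proj (N_A tau A) x)) :
  char phi x = phi (kernel_in (@tau_A_abelian _ _ tau A) Kx).
Proof. exact: kernel_funE. Qed.

Lemma char_inj phi phi' : (forall x, K x -> char phi x = char phi' x) -> phi = phi'.
Proof.
move=> e; apply: homP => u.
have [y yu] := epi_surj (quotient_proj (N_A tau A)) (kernel_val u).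
have Ky' : normal_set (ker (tau_A tau A)) (quotient_proj (N_A tau A) y).
  by rewrite yu; exact: kernel_valP.
have uE : u = kernel_in (@tau_A_abelian _ _ tau A) Ky' by exact: kernel_val_inj.
have Ky := (quotient_ker (@N_A_sub _ _ tau A) y).1 Ky'.
by rewrite uE; have := e _ Ky; rewrite !(charE _ Ky').
Qed.

Lemma charD phi phi' x : K x -> char (phi + phi')%R x = (char phi x + char phi' x)%R.
Proof.
move=> Kx; have Kx' := (quotient_ker (@N_A_sub _ _ tau A) x).2 Kx.
by rewrite !(charE _ Kx').
Qed.

Lemma charZ (a : gend A) phi x : K x -> char (a *: phi)%R x = hom_fun a (char phi x).
Proof.
move=> Kx; have Kx' := (quotient_ker (@N_A_sub _ _ tau A) x).2 Kx.
by rewrite !(charE _ Kx').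
Qed.

Lemma char0 x : K x -> char 0%R x = 0%R.
Proof.
move=> Kx; have Kx' := (quotient_ker (@N_A_sub _ _ tau A) x).2 Kx.
by rewrite !(charE _ Kx').
Qed.

Lemma char_neq0 phi : phi != 0%R -> exists2 x, K x & char phi x != 0%R.
Proof.
move=> /eqP p0; apply: contrapT => n; apply: p0; apply: char_inj => x Kx.
rewrite char0 //; apply/eqP/negPn/negP => x0; apply: n; by exists x.
Qed.

Lemma char_sum (I : Type) (s : seq I) (a : I -> gend A) phi x : K x ->
  char (\sum_(i <- s) a i *: phi i)%R x = (\sum_(i <- s) hom_fun (a i) (char (phi i) x))%R.
Proof.
move=> Kx; have Kx' := (quotient_ker (@N_A_sub _ _ tau A) x).2 Kx.
rewrite (charE _ Kx') hom_sumE; apply: eq_bigr => i _.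
by rewrite (charE _ Kx').
Qed.
End BA.

(** * Independence of maximal subgroups *)

Section Independence.
Variables (H G : profiniteGroupType) (tau : epi H G).
Local Notation K := (normal_set (ker tau)).

(** Stated by commutators in H, which spares a quotient type depending on N. *)
Definition abelian_mod (N : normalSubgroup H) : Prop :=
  forall x y, K x -> K y -> normal_set N ((y * x)^-1 * (x * y)).

Lemma abelian_modP (N : normalSubgroup H) (sNK : normal_set N `<=` K) :
  abelian_kernel (quotient_epi sNK) <-> abelian_mod N.
Proof.
split=> [ab x y Kx Ky|ab].
  apply/quotient_projE; rewrite !epiM.
  by apply: ab; apply/quotient_ker.
move=> a b.
have [x <-] := epi_surj (quotient_proj N) a; have [y <-] := epi_surj (quotient_proj N) b.
move=> /quotient_ker Kx /quotient_ker Ky; rewrite -!epiM.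
by apply/quotient_projE; exact: ab.
Qed.

Lemma char_ker_abelian_mod (A : gmodule G) (chi : H -> A) (cchi : is_char tau chi) :
  abelian_mod (char_ker cchi).
Proof. by apply/(abelian_modP (char_ker_sub (cchi := cchi))); exact: char_ker_abelian. Qed.

Lemma abelian_mod_le (M N : normalSubgroup H) :
  normal_set M `<=` normal_set N -> abelian_mod M -> abelian_mod N.
Proof. by move=> MN abM x y Kx Ky; apply/MN/abM. Qed.

Lemma abelian_mod_repr (N : normalSubgroup H) (L M : set H) :
  (forall k, K k -> exists2 l, L l & normal_set N (l^-1 * k)) ->
  (forall k, K k -> exists2 m, M m & normal_set N (m^-1 * k)) ->
  (forall l m, L l -> M m -> normal_set N ((m * l)^-1 * (l * m))) ->
  abelian_mod N.
Proof.
move=> LK MK LM x y /LK[l Ll /quotient_projE lx] /MK[m Mm /quotient_projE my].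
by apply/quotient_projE; rewrite !epiM -lx -my -!epiM; apply/quotient_projE/LM.
Qed.

(** Otherwise both L and M cover ker tau modulo N, while the commutators of L
    with M lie in both subgroups, hence in N. *)
Lemma nonabelian_prime (N L M : normalSubgroup H) :
  supplemented tau N -> ~ abelian_mod N ->
  normal_set L `<=` K -> normal_set M `<=` K ->
  normal_set L `&` normal_set M `<=` normal_set N ->
  normal_set L `<=` normal_set N \/ normal_set M `<=` normal_set N.
Proof.
move=> supN nabN LK MK LMN; apply: contrapT => /not_orP[nL nM]; apply: nabN.
apply: (abelian_mod_repr (supN _ LK nL) (supN _ MK nM)) => l m Ll Mm; apply: LMN.
rewrite invgM; split.
  by have := normalM (normalV Ll) (normalJ m Ll); rewrite conjgE !mulgA.
by have := normalM (normalJ l (normalV Mm)) Mm; rewrite conjgE !mulgA.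
Qed.

(** Non-abelian factors do not interact with abelian ones. Let P be the
    intersection of L with the kernel of chi. If P is not contained in M, it
    covers ker tau modulo M, so an element of L is the product of an element of
    P and an element common to L and M, and chi kills both. If P is contained
    in M but L is not, the commutators of L lie in P, and ker tau / M, covered
    by L, would be abelian. *)
Lemma char_vanish_nonabelian (A : gmodule G) (chi : H -> A) (L M : normalSubgroup H) :
  is_char tau chi -> supplemented tau M -> ~ abelian_mod M ->
  normal_set L `<=` K ->
  (forall x, normal_set L x -> normal_set M x -> chi x = 0%R) ->
  forall x, normal_set L x -> chi x = 0%R.
Proof.
move=> cchi supM nabM LK LM0 x Lx.
pose P := normal_meet L [set: unit] (fun=> char_ker cchi).
have PK : normal_set P `<=` K by move=> y [/LK].
have [PM|nPM] := pselect (normal_set P `<=` normal_set M); last first.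
  have [p [Lp /(_ tt I) [Kp p0]] Mpx] := supM P PK nPM _ (LK _ Lx).
  have := LM0 (p^-1 * x) (normalM (normalV Lp) Lx) Mpx.
  rewrite (charM cchi) ?(charV cchi) // ?p0 ?oppr0 ?add0r //; last exact: LK.
  exact: normalV.
have [LM|nLM] := pselect (normal_set L `<=` normal_set M).
  by apply: LM0 => //; exact: LM.
case: nabM; apply: (abelian_mod_repr (supM _ LK nLM) (supM _ LK nLM)) => l m Ll Lm.
apply: PM; split.
  by apply: normalM; [apply: normalV|]; exact: normalM.
by move=> _ _; apply: char_ker_abelian_mod; exact: LK.
Qed.

Section Schur.
Variables (R : eqType) (A : R -> simple_gmodule G).
Hypothesis isoA : forall r r', gmodule_iso (A r) (A r') -> r = r'.
Variables (T : R -> eqType) (t : forall r, T r -> ghom (B_A tau (A r)) (A r)).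

(** On L, phi factors through psi. The values of psi on L fill the whole simple
    module, so the factor e is defined on all of it. *)
Lemma char_factor (r r' : R) (phi : ghom (B_A tau (A r)) (A r))
    (psi : ghom (B_A tau (A r')) (A r')) (L : normalSubgroup H) :
  normal_set L `<=` K ->
  (forall x, normal_set L x -> char psi x = 0%R -> char phi x = 0%R) ->
  (exists2 x, normal_set L x & char phi x != 0%R) ->
  exists2 e : ghom (A r') (A r), (exists a, e a != 0%R) &
    forall x, normal_set L x -> char phi x = e (char psi x).
Proof.
move=> LK psiphi [x0 Lx0 phi0].
have cphi := char_is_char phi; have cpsi := char_is_char psi.
have psi0 : char psi x0 != 0%R.
  by apply: contraNneq phi0 => /psiphi -> //.
have /choice[l lP] : forall a, exists x, normal_set L x /\ char psi x = a.
  move=> a; by have [y Ly ya] := char_image cpsi (LK _ Lx0) psi0 LK Lx0 a; exists y.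
pose e a := char phi (l a).
have eE x : normal_set L x -> char phi x = e (char psi x).
  move=> Lx; have [Lly ly] := lP (char psi x); set y := l _ in Lly ly *.
  have Kx := LK _ Lx; have Ky := LK _ Lly.
  have := psiphi (x * y^-1) (normalM Lx (normalV Lly)).
  rewrite !(charM cpsi, charM cphi) ?(charV cpsi, charV cphi) //; last exact: normalV.
  - by rewrite ly subrr => /(_ erefl)/eqP; rewrite subr_eq0 => /eqP.
  - exact: normalV.
have eP : is_ghom e.
  have key a x : normal_set L x -> char psi x = a -> e a = char phi x.
    by move=> Lx xa; rewrite eE // xa.
  split=> [a b|g a|]; last exact: discrete_continuous.
  - have [La la] := lP a; have [Lb lb] := lP b; have Ka := LK _ La; have Kb := LK _ Lb.
    rewrite (key _ (l a * l b)) ?(charM cpsi) ?la ?lb ?(charM cphi) //.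
    exact: normalM.
  - have [h <-] := epi_surj tau g; have [La la] := lP a; have Ka := LK _ La.
    rewrite (key _ (h * l a * h^-1)) ?(charJ cpsi) ?la ?(charJ cphi) //.
    exact: normal_conj.
exists (exist _ e (mem_set eP)) => //.
by exists (char psi x0); rewrite /= -eE.
Qed.

(** By induction on s. If phi does not already vanish on the common kernel L of
    the remaining characters, it factors on L through the first one, by
    char_factor. Schur's lemma makes the two modules isomorphic, hence equal by
    isoA, and phi minus a multiple of the first character vanishes on L. *)
Lemma schur_span (s : seq {r & T r}) r (phi : ghom (B_A tau (A r)) (A r)) :
  uniq s ->
  (forall x, K x -> (forall z, z \in s -> char (t (tagged z)) x = 0%R) -> char phi x = 0%R) ->
  exists (l : seq (T r)) (a : T r -> gend (A r)),
    [/\ uniq l, forall x, x \in l -> existT _ r x \in s &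
      phi = (\sum_(x <- l) a x *: t x)%R].
Proof.
elim: s phi => [|[q y] s IH] phi /=.
  move=> _ phi0; exists [::], (fun=> 0%R); split => //; rewrite big_nil.
  by apply: char_inj => x Kx; rewrite char0 //; exact: phi0.
move=> /andP[ys us] phi0.
pose L := normal_meet (ker tau) [set z | z \in s]
  (fun z => char_ker (char_is_char (t (tagged z)))).
have LK : normal_set L `<=` K by move=> x [].
have L0 x : K x -> (forall z, z \in s -> char (t (tagged z)) x = 0%R) -> normal_set L x.
  by move=> Kx xs; split => // z /xs.
have [[x0 Lx0 x00]|n] := pselect (exists2 x, normal_set L x & char phi x != 0%R); last first.
  have [|l [a [ul ls ->]]] := IH phi us.
    move=> x Kx xs; apply/eqP/negPn/negP => x0; apply: n; exists x => //; exact: L0.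
  by exists l, a; split => // x /ls; rewrite in_cons => ->; rewrite orbT.
have [//|||e [b eb] eE] := @char_factor r q phi (t y) L.
- move=> x [Kx Lx] yx; apply: phi0 => // z; rewrite in_cons => /predU1P[->//|zs].
  by have [] := Lx _ zs.
- by exists x0.
have rq : q = r by apply: isoA; exact: schur eb.
subst q.
have [|l [a [ul ls e']]] := IH (phi - (e : gend (A r)) *: t y)%R us.
  move=> x Kx xs; rewrite -scaleN1r charD // !charZ // (eE x); last exact: L0.
  exact: subrr.
exists (y :: l), (fun x => if x == y then e else a x); split.
- by rewrite /= ul andbT; apply/negP => /ls; rewrite (negbTE ys).
- move=> x; rewrite in_cons => /predU1P[->|/ls]; first exact: mem_head.
  by rewrite in_cons => ->; rewrite orbT.
- rewrite big_cons eqxx addrC; apply/eqP; rewrite -subr_eq e'; apply/eqP.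
  rewrite !big_seq; apply: eq_bigr => x xl.
  by case: eqP => // xy; move: (ls _ xl); rewrite xy (negbTE ys).
Qed.

Hypothesis freet : forall r, free_family [set: T r] (@t r).

Variables (I : eqType) (N : I -> normalSubgroup H).
Hypotheses (NK : forall i, normal_set (N i) `<=` K) (supN : forall i, supplemented tau (N i)).
Hypotheses (nabN : forall i, ~ abelian_mod (N i)) (injN : injective N).

Definition mixed_family (i : I + {r & T r}) : normalSubgroup H :=
  match i with
  | inl i => N i
  | inr z => char_ker (char_is_char (t (tagged z)))
  end.

Lemma mixed_family_supplemented i : supplemented tau (mixed_family i).
Proof. by case: i => [i|z]; [exact: supN|exact: char_supplemented]. Qed.

Lemma mixed_family_sub i : normal_set (mixed_family i) `<=` K.
Proof. by case: i => [i|z]; [exact: NK|exact: char_ker_sub]. Qed.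

(** A subgroup with non-abelian factor is prime for intersections, so it would
    contain another single member of the family, which is excluded by injN or
    by the abelian factor of a character. For a character, the subgroups with
    non-abelian factor are dropped one by one, and what remains contradicts
    freeness by schur_span. *)
Lemma mixed_family_independent : independent tau mixed_family.
Proof.
case=> [i|[r y]] s.
  elim: s => [_ sub|j s IH].
    apply: (@nabN i) => x y Kx Ky; apply: sub; split => //.
    by apply: normalM; [apply: normalV|]; exact: normalM.
  rewrite in_cons negb_or => /andP[ij /IH nIH] sub.
  have [|||//|jN] := @nonabelian_prime (N i)
      (normal_meet (ker tau) [set j | j \in s] mixed_family) (mixed_family j)
      (@supN i) (@nabN i).
  - by move=> x [].
  - exact: mixed_family_sub.
  - move=> x [[Kx xs] xj]; apply: sub; split => // k /=.
    by rewrite in_cons => /predU1P[->//|/xs].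
  case: j ij jN {sub} => [j|z] ij jN /=; last first.
    by apply: (@nabN i); apply: abelian_mod_le jN _; exact: char_ker_abelian_mod.
  have [ijN|nij] := pselect (normal_set (N i) `<=` normal_set (N j)).
    by move: ij; rewrite (injN (normal_inj _ : N i = N j)) ?eqxx //; apply/seteqP; split.
  apply: (@nabN i) => x z Kx Kz.
  have Kxz : K ((z * x)^-1 * (x * z)) by apply: normalM; [apply: normalV|]; exact: normalM.
  have [l Nil /jN Njl] := supN (@NK i) nij Kxz.
  by have := normalM Nil Njl; rewrite mulgA mulgV mul1g.
move=> ys sub.
pose s1 := pmap (fun i : I + {r & T r} => if i is inl j then Some j else None) s.
pose s2 := undup (pmap (fun i : I + {r & T r} => if i is inr z then Some z else None) s).
have s1P j : (j \in s1) = (inl j \in s).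
  rewrite mem_pmap; apply/mapP/idP => [[[k|k] // ks [->]] //|js].
  by exists (inl j).
have s2P z : (z \in s2) = (inr z \in s).
  rewrite mem_undup mem_pmap; apply/mapP/idP => [[[k|k] // ks [->]] //|zs].
  by exists (inr z).
have drop (l : seq I) (L : normalSubgroup H) : normal_set L `<=` K ->
    (forall x, normal_set L x -> (forall j, j \in l -> normal_set (N j) x) ->
      char (t y) x = 0%R) -> forall x, normal_set L x -> char (t y) x = 0%R.
  move=> LK; elim: l => [|j l IH] Ll x Lx; first exact: Ll.
  apply: IH x Lx => x Lx xl.
  apply: (@char_vanish_nonabelian _ (char (t y)) (normal_meet L [set j | j \in l] N) (N j)
     (char_is_char _) (@supN j) (@nabN j)) => //; first by move=> ? [/LK].
  move=> z [Lz zl] zj; apply: Ll => // k; rewrite in_cons => /predU1P[->//|/zl].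
  by [].
have [||l [a [ul ls e]]] := @schur_span s2 r (t y); first exact: undup_uniq.
  move=> x Kx x2.
  apply: (drop s1 (normal_meet (ker tau) [set z | z \in s2]
    (fun z => char_ker (char_is_char (t (tagged z)))))).
  - by move=> z [].
  - move=> z [Kz z2] z1.
    have [] : normal_set (char_ker (char_is_char (t y))) z; last by [].
    apply: sub; split => // -[j|w] js.
      by apply: z1; rewrite s1P.
    by apply: z2; rewrite /= s2P.
  - by split => // z /x2.
apply: (@free_family_not_span _ _ (@gend1 _ (A r)) _ _ _ y l a (@freet r)) => //.
by apply/negP => /ls; rewrite s2P (negbTE ys).
Qed.

End Schur.
End Independence.

(** * Continuous sections *)

Lemma class_repr (T : Type) (e : T -> T -> Prop) :
  (forall x, e x x) -> (forall x y, e x y -> e y x) ->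
  (forall x y z, e x y -> e y z -> e x z) ->
  exists r : T -> T, (forall x, e x (r x)) /\ forall x y, e x y -> r x = r y.
Proof.
move=> exx esym etrans.
have /choice[f fP] : forall P : {P : T -> Prop | exists x, P x}, exists x, sval P x.
  by case.
pose cl x : {P : T -> Prop | exists x, P x} := exist _ (e x) (ex_intro _ x (exx x)).
exists (fun x => f (cl x)); split=> [x|x y xy]; first exact: (fP (cl x)).
congr f; apply: eq_exist; apply/funext => z; apply/propext.
by split; apply: etrans => //; exact: esym.
Qed.

Section Trivialisation.
Variables (E G : profiniteGroupType) (pi : epi E G) (ab : abelian_kernel pi).
Variables (A : simple_gmodule G) (phi : ghom (kernel_module ab) A).
Local Notation K := (normal_set (ker pi)).

(** Let U be an open subgroup such that phi vanishes on the elements of ker pi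
    in U. With one representative r in each double coset of ker pi and U, put c
    (k r u) = phi k. This is well defined because phi is equivariant, so that
    it also vanishes on the elements of ker pi in r U r^-1; and c is constant
    on the cosets x U. *)
Lemma trivialisation : exists c : E -> A, continuous c /\
  forall k x, K k -> c (k * x) = (kernel_fun phi k + c x)%R.
Proof.
have cchar := kernel_fun_char phi (@simple_hausdorff _ A).
pose F := [set x | K x /\ [set~ 0%R] (kernel_fun phi x)].
have nF : nbhs 1 (~` F).
  apply: open_nbhs_nbhs; split; first by apply: closed_openC; exact: char_fiber_closed.
  by move=> [_ /=]; rewrite (char1 cchar).
have [U [nU UF [U1 UM UV]]] := profinite_open_subgroup nF.
pose e x y := exists k u, [/\ K k, U u & y = k * x * u].
have [|||r [er re]] := @class_repr E e.
- by move=> x; exists 1, 1; split => //; [exact: normal1|rewrite mul1g mulg1].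
- move=> x y [k [u [Kk Uu ->]]]; exists k^-1, u^-1; split; [exact: normalV|exact: UV|].
  by rewrite !mulgA mulVg mul1g mulgK.
- move=> x y z [k [u [Kk Uu ->]]] [k' [u' [Kk' Uu' ->]]].
  by exists (k' * k), (u * u'); split; [exact: normalM|exact: UM|rewrite !mulgA].
have phi_uniq k k' u u' x : K k -> K k' -> U u -> U u' ->
    k * x * u = k' * x * u' -> kernel_fun phi k = kernel_fun phi k'.
  move=> Kk Kk' Uu Uu' kk'.
  have Kd : K (k'^-1 * k) by apply: normalM => //; exact: normalV.
  have dE : k'^-1 * k = x * (u' * u^-1) * x^-1.
    have := congr1 (fun y => k'^-1 * y * u^-1 * x^-1) kk'.
    by rewrite !mulgA mulVg mul1g !mulgK.
  have KU : K (u' * u^-1) by have := normalJ x Kd; rewrite dE conjgE !mulgA divgK mulVg mul1g.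
  have z0 : kernel_fun phi (u' * u^-1) = 0%R.
    by apply: contrapT => n; apply: (UF _ (UM _ _ Uu' (UV _ Uu))).
  have : kernel_fun phi (k'^-1 * k) = 0%R by rewrite dE (charJ cchar) // z0 gact0.
  rewrite (charM cchar) ?(charV cchar) //; last exact: normalV.
  by rewrite addrC => /eqP; rewrite subr_eq0 => /eqP.
have /choice[kk kkP] : forall x, exists k, K k /\ exists2 u, U u & x = k * r x * u.
  move=> x; have [k [u [Kk Uu rx]]] := er x; exists k^-1; split; first exact: normalV.
  by exists u^-1; [exact: UV|rewrite rx !mulgA mulVg mul1g mulgK].
exists (fun x => kernel_fun phi (kk x)); split.
  move=> x W /nbhs_singleton Wx.
  have nxU : nbhs x [set y | U (x^-1 * y)].
    by apply: (@mulgl_continuous _ x^-1 x); rewrite /= mulVg.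
  apply: (@filterS _ (nbhs x) _ _ _ _ nxU) => y /= Uxy.
  have exy : e x y.
    by exists 1, (x^-1 * y); split => //; [exact: normal1|rewrite mul1g mulgA mulgV mul1g].
  have [Kx [u Uu xE]] := kkP x; have [Ky [v Uv yE]] := kkP y.
  rewrite (phi_uniq (kk y) (kk x) v (u * (x^-1 * y)) (r x)) //; first exact: UM.
  by rewrite mulgA -xE mulgA mulgV mul1g (re x y) // -yE.
move=> k x Kk.
have [Kx [u Uu xE]] := kkP x; have [Ky [v Uv yE]] := kkP (k * x).
have ekx : e x (k * x) by exists k, 1; split => //; rewrite mulg1.
rewrite -(charM cchar) //; apply: (phi_uniq _ _ v u (r x)) => //; first exact: normalM.
have vE : kk (k * x) * r x * v = k * x by rewrite (re _ _ ekx) -yE.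
by rewrite vE [in LHS]xE !mulgA.
Qed.
End Trivialisation.

Section ContinuousSection.
Variables (H G : profiniteGroupType) (tau : epi H G) (A : simple_gmodule G).
Local Notation K := (normal_set (ker tau)).
Local Notation V := (ghom (B_A tau A) A).
Local Notation p := (quotient_proj (N_A tau A)).

Lemma N_AP x : K x -> (forall phi : V, char phi x = 0%R) -> normal_set (N_A tau A) x.
Proof.
move=> Kx x0; split => // N /C_A_char[chi [cchi [-> _]]].
have [phi phiE] := char_surj cchi.
by split => //; rewrite -phiE.
Qed.

(** Let X be a basis of Hom_G(B_A, A), and c phi a trivialisation for each phi
    in X. The value s g is the only element over g at which all c phi vanish.
    It exists because the kernels of the characters in X are independent, it is
    unique because they meet in N_A, and the graph of s is closed. *)
Lemma tau_A_section : exists s : G -> H_A tau A, continuous s /\ cancel s (tau_A tau A).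
Proof.
have sT : @is_submodule _ V [set: V] by split.
have [X [_ fX spX]] := basis_extension (@gend_div _ A) sT (@sub0set _ _) (@free_set0 _ V).
pose T := set_type X; pose t (_ : unit) (x : T) : V := sval x.
have ft (r : unit) : free_family [set: T] (@t r).
  exact: free_family_val fX.
have tn0 x : X x -> x != 0%R by exact: (free_family_neq0 (@gend1 _ A) fX).
pose M := @mixed_family _ _ tau unit (fun=> A) (fun=> T) t void (fun=> ker tau).
have indM : independent tau M.
  by apply: mixed_family_independent => // -[] [].

have supM i : supplemented tau (M i) by apply: mixed_family_supplemented => -[].
have /choice[c cP] : forall phi : V, exists c : H_A tau A -> A, continuous c /\
    forall k x, normal_set (ker (tau_A tau A)) k -> c (k * x) = (kernel_fun phi k + c x)%R.
  by move=> phi; exact: trivialisation.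
have /choice[s sP] : forall g, exists x, tau_A tau A x = g /\ forall phi, X phi -> c phi x = 0%R.
  move=> g; have [h0 h0g] := epi_surj tau g.
  have /choice[y yP] : forall i : void + {r : unit & T}, exists y, tau y = g /\
      match i with inl _ => True | inr z => c (sval (tagged z)) (p y) = 0%R end.
    case=> [[]|[[] x]] /=; have Xx := set_valP x; set phi := sval x.
    have [k0 Kk0 k00] := char_neq0 (tn0 _ Xx).
    have [k Kk kE] := char_image (char_is_char phi) Kk0 k00 (fun x K => K) Kk0 (- c phi (p h0))%R.
    exists (k * h0); split; first by rewrite epiM Kk mul1g.
    change (c phi (p (k * h0)) = 0%R).
    rewrite epiM (cP phi).2; last exact/(quotient_ker (@N_A_sub _ _ tau A)).
    by rewrite -[kernel_fun _ _]/(char phi k) kE addNr.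
  have [h hg hM] := independent_cosets_meet supM indM (fun i => (yP i).1).
  exists (p h); split; first by rewrite -hg; exact: quotient_epi_proj.
  move=> phi Xphi; pose z : void + {r : unit & T} := inr (existT _ tt (exist _ phi (mem_set Xphi))).
  have [yg yc] := yP z; have := hM z.
  rewrite -[M z]/(char_ker (char_is_char phi)) => Nyh.
  have [Nh h0'] := normal_conj (y z) Nyh; rewrite mulgA mulgV mul1g in Nh h0'.
  rewrite -(divgK (y z) h) epiM (cP phi).2 ?yc ?addr0 //; exact/(quotient_ker (@N_A_sub _ _ tau A)).
exists s; split; last by move=> g; have [] := sP g.
have uniqs x y : tau_A tau A x = tau_A tau A y -> (forall phi, X phi -> c phi x = 0%R) ->
    (forall phi, X phi -> c phi y = 0%R) -> x = y.
  move=> xy cx cy; have [k kE] := epi_surj p (x * y^-1).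
  have Kk' : normal_set (ker (tau_A tau A)) (p k).
    by rewrite kE -[normal_set _ _]/(_ = 1) epiM epiV xy mulgV.
  have Kk : K k by exact/(quotient_ker (@N_A_sub _ _ tau A)).
  have kX phi : X phi -> char phi k = 0%R.
    move=> Xphi; have := cx _ Xphi; rewrite -(divgK y x) -kE (cP phi).2 // cy // addr0.
    by [].
  have : normal_set (N_A tau A) k.
    apply: N_AP => // phi; have /spanP[l [a [_ lX ->]]] : Defs.span X phi by rewrite spX.
    rewrite char_sum // big_seq big1 // => v /lX /kX ->; exact: hom0.
  by move=> /quotient_proj1; rewrite kE -{2}(divgK y x) => ->; rewrite mul1g.
apply: closed_graph_continuous; first exact: profinite_compact.
rewrite (_ : [set _ | _] = [set q : G * H_A tau A | q.1^-1 * tau_A tau A q.2 = 1] `&`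
   \bigcap_(phi in X) [set q | c phi q.2 = 0%R]).
  apply: closedI.
    apply: (@preimage_closed _ _ (fun q : G * H_A tau A => q.1^-1 * tau_A tau A q.2) [set 1]).
      move=> q _; apply: cvgMg.
        by apply: cvgVg; exact: cvg_fst.
      by apply: continuous_cvg; [exact: epi_continuous|exact: cvg_snd].
    by apply: accessible_closed_set1; apply: hausdorff_accessible; exact: profinite_hausdorff.
  apply: closed_bigI => phi _.
  apply: (@preimage_closed _ _ (fun q : G * H_A tau A => c phi q.2) [set 0%R]).
    move=> q _; apply: (@continuous_comp _ _ _ snd (c phi)); first exact: cvg_snd.
    by move: (cP phi) => [+ _]; apply.
  by apply: accessible_closed_set1; apply: hausdorff_accessible; exact: simple_hausdorff.
apply/seteqP; split=> [[g x] e|[g x] [gx cx]]; have [sg sc] := sP g.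
  have {e}<- : s g = x := e; split; last exact: sc.
  by change (g^-1 * tau_A tau A (s g) = 1); rewrite sg mulVg.
change (s g = x); apply: uniqs => //; rewrite sg.
have {}gx : g^-1 * tau_A tau A x = 1 := gx.
by have := congr1 (fun y => g * y) gx; rewrite mulgA mulgV mul1g mulg1.
Qed.
End ContinuousSection.

(** * Splitting maps and the homomorphism S_A *)

Section SplittingMap.
Variables (H G : profiniteGroupType) (tau : epi H G) (A : simple_gmodule G).
Local Notation K := (normal_set (ker tau)).
Local Notation V := (ghom (B_A tau A) A).
Local Notation p := (quotient_proj (N_A tau A)).

(** Epimorphisms of profinite groups are open, hence topological quotients. *)
Lemma epi_factor (T : topologicalType) (d : H -> T) : continuous d ->
  (forall k x, K k -> d (k * x) = d x) ->
  exists b : G -> T, continuous b /\ forall x, d x = b (tau x).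
Proof.
move=> cd dK; have /choice[l lP] : forall g, exists x, tau x = g by exact: epi_surj.
have dE x : d x = d (l (tau x)).
  rewrite -[in LHS](divgK (l (tau x)) x) dK //.
  by rewrite -[normal_set _ _]/(_ = 1) epiM epiV lP mulgV.
exists (d \o l); split => //.
apply/continuousP => U oU.
rewrite (_ : _ @^-1` U = tau @` (d @^-1` U)).
  by apply: epi_open; apply: open_comp => // x _; exact: cd.
apply/seteqP; split=> [g /= Ug|_ [x /= Ux <-] /=]; first by exists (l g).
by rewrite -dE.
Qed.

(** The coboundary of c is minus the inflation of z to H, and c extends the
    character phi; the constant c 1 is there because z need not be normalised.
    *)
Definition splitting_map (phi : V) (z : Z2 A) (c : H -> A) : Prop :=
  [/\ continuous c,
      forall x y, c (x * y) = (c x + gact (tau x) (c y) + val z (tau x, tau y))%R &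
      forall k, K k -> c k = (c 1%g + char phi k)%R].

Lemma splitting_mapMl phi z c k x : splitting_map phi z c -> K k ->
  c (k * x) = (char phi k + c x)%R.
Proof.
move=> [_ cM ck] Kk; have := cM 1 x.
rewrite (cM k x) (ck _ Kk) (_ : tau k = 1) // epi1 mul1g !gact1 => e.
have c0 : (c 1%g + val z (1%g, tau x) = 0)%R.
  by apply: (@addIr _ (c x)); rewrite add0r {2}e addrAC.
by rewrite (ACl ((1*4)*(2*3)))%AC /= c0 add0r.
Qed.

(** Adding a cochain b of G to a splitting map for f gives a splitting map for
    w if and only if f - w is the coboundary of b. *)
Lemma coboundary_shift (U : zmodType) (u v f w b1 b2 b3 : U) :
  (f - w = b2 - b3 + b1 <-> u + v + f + b3 = u + b1 + (v + b2) + w)%R.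
Proof.
have -> : (u + b1 + (v + b2) + w = (u + v) + (b2 + b1 + w))%R.
  by rewrite ?addrA (ACl (1*3*4*2*5))%AC.
rewrite -[(u + v + f + b3)%R]addrA; split=> [e|/addrI e].
  have -> : f = (b2 - b3 + b1 + w)%R by rewrite -e subrK.
  by congr (_ + _)%R; rewrite ?addrA (ACl (1*3*4*(2*5)))%AC /= addNr addr0.
have -> : f = (b2 + b1 + w - b3)%R by rewrite -e addrK.
by rewrite ?addrA (ACl (1*4*2*(3*5)))%AC /= subrr addr0.
Qed.

Section FactorSet.
Variables (s : G -> H_A tau A) (f : Z2 (B_A tau A)).
Hypotheses (cs : continuous s) (sK : cancel s (tau_A tau A)) (fs : is_factor_set s f).

Let shift (h : H) : H_A tau A := p h * (s (tau h))^-1.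

Let shift_ker h : normal_set (ker (tau_A tau A)) (shift h).
Proof.
rewrite -[normal_set _ _]/(tau_A tau A (shift h) = 1) epiM epiV sK.
by rewrite -[tau_A tau A _]/(quotient_epi _ _) quotient_epi_proj mulgV.
Qed.

(** The map sends k s(g), with k in the kernel, to phi k. *)
Lemma factor_set_splitting phi :
  splitting_map phi (Z2_map phi f) (fun h => kernel_fun phi (p h * (s (tau h))^-1)).
Proof.
have cchar := kernel_fun_char phi (@simple_hausdorff _ A).
split.
- apply: kernel_fun_continuous; last exact: shift_ker.
  move=> h; apply: cvgMg; first exact: epi_continuous.
  apply: cvgVg; apply: continuous_comp; [exact: epi_continuous|exact: cs].
- move=> x y; set a := s (tau x); set b := s (tau y).
  have KF : normal_set (ker (tau_A tau A)) (a * b * (s (tau x * tau y))^-1).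
    by rewrite -[normal_set _ _]/(_ = 1) !epiM epiV !sK mulgV.
  have -> : val (Z2_map phi f) (tau x, tau y) =
      kernel_fun phi (a * b * (s (tau x * tau y))^-1).
    rewrite (kernel_funE phi KF) /=; congr (phi _); apply: kernel_val_inj.
    exact: fs.
  rewrite epiM epiM -[X in gact X](sK (tau x)) -/a -(charJ cchar); last exact: shift_ker.
  have Kx := shift_ker x; have Ky := normal_conj a (shift_ker y).
  rewrite -!(charM cchar) //; last exact: normalM.
  congr (kernel_fun phi _); rewrite -/a -/b !mulgA.
  by rewrite !divgK.
- move=> k Kk; rewrite (_ : tau k = 1) // (epi1 tau) (epi1 p) mul1g addrC.
  rewrite (charM cchar) //; first exact/(quotient_ker (@N_A_sub _ _ tau A)).
  by rewrite -[normal_set _ _]/(_ = 1) epiV sK invg1.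
Qed.

End FactorSet.

(** Since continuous sections exist, f_A is the class of a factor set and not a
    default value. *)
Lemma f_A_factor_set : exists (s : G -> H_A tau A) (f : Z2 (B_A tau A)),
  [/\ continuous s, cancel s (tau_A tau A), is_factor_set s f & f_A tau A = H2_class f].
Proof.
suff ex : exists c, [set c | exists (s : G -> H_A tau A) (f : Z2 (B_A tau A)),
    [/\ continuous s, cancel s (tau_A tau A), is_factor_set s f & c = H2_class f]] c.
  by have := xgetPex 0%R ex.
have [s [cs sK]] := tau_A_section tau A.
have KF g h : normal_set (ker (tau_A tau A)) (s g * s h * (s (g * h))^-1).
  by rewrite -[normal_set _ _]/(_ = 1) !epiM epiV !sK mulgV.
pose f (q : G * G) : B_A tau A := kernel_in (@tau_A_abelian _ _ tau A) (KF q.1 q.2).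
have fP : is_cocycle2 f.
  split.
    apply: kernel_continuous => q.
    apply: cvgMg; first apply: cvgMg.
    - by apply: continuous_comp; [exact: cvg_fst|exact: cs].
    - by apply: continuous_comp; [exact: cvg_snd|exact: cs].
    - apply: cvgVg; apply: continuous_comp; last exact: cs.
      exact: mulg_continuous.
  move=> g h k; apply: kernel_val_inj.
  rewrite -[LHS]/(s g * s h * (s (g * h))^-1 * (s (g * h) * s k * (s (g * h * k))^-1)).
  rewrite -[RHS]/(kernel_val (kernel_act g (f (h, k))) *
    (s g * s (h * k) * (s (g * (h * k)))^-1)).
  rewrite -[X in kernel_act X _](sK g) kernel_actE.
  rewrite -[kernel_val _]/(s h * s k * (s (h * k))^-1) !mulgA.
  by rewrite !divgK.
by exists (H2_class (exist _ f (mem_set fP))), s, (exist _ f (mem_set fP)).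
Qed.

(** Sections of H_A disappear from the description of S_A: to compare the
    values of S_A on characters of two different groups over G, it suffices to
    find splitting maps for one cocycle. *)
Lemma S_A_splitting phi z : S_A tau A phi = H2_class z <-> exists c, splitting_map phi z c.
Proof.
have [s [f [cs sK fs fE]]] := f_A_factor_set.
set w := Z2_map phi f.
have [c0 c0P] : exists c0, splitting_map phi w c0.
  by eexists; exact: factor_set_splitting cs sK fs phi.
have [c0c c0M c0K] := c0P.
rewrite /S_A fE H2_mapE -/w H2_class_eq; split.
  move=> /asboolP[b bc wz]; exists (fun h => c0 h + b (tau h))%R; split.
  - move=> h; apply: (@continuous2_cvg _ _ _ _ _ _ c0 (b \o tau) (fun u v => u + v)%R).
    + exact: (@add_continuous A (c0 h, b (tau h))).
    + exact: c0c.
    + by apply: continuous_comp; [exact: epi_continuous|exact: bc].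
  - move=> x y; rewrite epiM c0M gactD; apply/coboundary_shift.
    by have := congr1 (fun F => F (tau x, tau y)) wz; rewrite raddfB.
  - by move=> k Kk; rewrite (c0K _ Kk) (_ : tau k = 1) // epi1 addrAC.
move=> [c cP]; have [cc cM cK] := cP.
have [|k x Kk|b [bc dE]] := @epi_factor _ (fun h => c h - c0 h)%R.
- move=> h; apply: (@continuous2_cvg _ _ _ _ _ _ c c0 (fun u v => u - v)%R).
  + exact: (@sub_continuous A (c h, c0 h)).
  + exact: cc.
  + exact: c0c.
- rewrite (splitting_mapMl _ cP Kk) (splitting_mapMl _ c0P Kk).
  by rewrite opprD addrACA subrr add0r.
have cE h : c h = (c0 h + b (tau h))%R by rewrite -dE addrC subrK.
apply/asboolP; exists b => //; apply/funext => -[g h].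
have [x <-] := epi_surj tau g; have [y <-] := epi_surj tau h.
rewrite raddfB; apply/(coboundary_shift (c0 x) (gact (tau x) (c0 y))).
by have := cM x y; rewrite !cE gactD epiM c0M.
Qed.

End SplittingMap.

(** * Isomorphisms over G *)

Section Isomorphisms.

Lemma epi_inj (E G : profiniteGroupType) (f : epi E G) :
  (forall x, f x = 1 -> x = 1) -> injective f.
Proof.
move=> f1 x y fxy; apply: (@mulIg _ y^-1); rewrite mulgV; apply: f1.
by rewrite epiM epiV fxy mulgV.
Qed.

Lemma injective_epi_is_iso (E G : profiniteGroupType) (f : epi E G) :
  injective f -> is_iso f.
Proof.
move=> fI; split; [exact: epiM|exact: epi_continuous|].
have /choice[f' f'K] : forall g, exists x, f x = g by exact: epi_surj.
exists f'; split=> //; first by move=> x; apply: fI.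
apply/continuousP => U oU; rewrite (_ : _ @^-1` U = f @` U); first exact: epi_open.
apply/seteqP; split=> [g Ug|_ [x Ux <-]]; first by exists (f' g).
by rewrite /= (_ : f' (f x) = x) //; apply: fI.
Qed.

Lemma is_iso_inj (E G : profiniteGroupType) (f : E -> G) : is_iso f -> injective f.
Proof. by move=> [_ _ [f' [fK _ _]]]; exact: can_inj fK. Qed.

Lemma is_iso_epi (E G : profiniteGroupType) (f : E -> G) : is_iso f ->
  exists f1 : epi E G, f1 =1 f.
Proof.
move=> [fM fc [f' [fK f'K _]]].
have fs g : exists x, f x = g by exists (f' g).
by exists (Epi fM fc fs).
Qed.

Lemma is_iso_inv (E G : profiniteGroupType) (f : E -> G) : is_iso f ->
  exists f' : epi G E, [/\ injective f', cancel f f' & cancel f' f].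
Proof.
move=> [fM fc [f' [fK f'K f'c]]].
have f'M : {morph f' : x y / x * y}.
  by move=> x y; apply: (can_inj fK); rewrite fM !f'K.
have f's g : exists x, f' x = g by exists (f g).
by exists (Epi f'M f'c f's); split => //; exact: can_inj f'K.
Qed.

Lemma epi_comp_subproof (E F G : profiniteGroupType) (f : epi F G) (g : epi E F) :
  [/\ {morph f \o g : x y / x * y}, continuous (f \o g) &
      forall z, exists x, (f \o g) x = z].
Proof.
split=> [x y|x|z] /=; first by rewrite !epiM.
  by apply: continuous_comp; exact: epi_continuous.
by have [y <-] := epi_surj f z; have [x <-] := epi_surj g y; exists x.
Qed.

Definition epi_comp (E F G : profiniteGroupType) (f : epi F G) (g : epi E F) : epi E G :=
  let: And3 fM fc fs := epi_comp_subproof f g in Epi fM fc fs.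

Lemma epi_compE (E F G : profiniteGroupType) (f : epi F G) (g : epi E F) x :
  epi_comp f g x = f (g x).
Proof. by rewrite /epi_comp; case: epi_comp_subproof. Qed.

Variable G : profiniteGroupType.

Lemma iso_over_refl (E : profiniteGroupType) (eta : epi E G) : iso_over eta eta.
Proof.
have cid x : {for x, continuous (@id E)} by exact: cvg_id.
by exists id => //; split => //; exists id; split.
Qed.

Lemma iso_over_sym (E F : profiniteGroupType) (eta : epi E G) (rho : epi F G) :
  iso_over eta rho -> iso_over rho eta.
Proof.
move=> [psi /is_iso_inv[psi' [psi'I psiK psi'K]] e].
exists psi'; first exact: injective_epi_is_iso.
by move=> x; rewrite /= e /= psi'K.
Qed.

Lemma iso_over_trans (E F D : profiniteGroupType) (eta : epi E G) (rho : epi F G)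
  (sigma : epi D G) : iso_over eta rho -> iso_over rho sigma -> iso_over eta sigma.
Proof.
move=> [f fiso fe] [g giso ge].
have [f1 f1E] := is_iso_epi fiso; have [g1 g1E] := is_iso_epi giso.
exists (epi_comp g1 f1); last by move=> x; rewrite /= epi_compE fe /= ge /= g1E f1E.
apply: injective_epi_is_iso => x y; rewrite !epi_compE g1E g1E => /(is_iso_inj giso).
by rewrite !f1E => /(is_iso_inj fiso).
Qed.

Lemma iso_over_abelian (E F : profiniteGroupType) (eta : epi E G) (rho : epi F G) :
  iso_over eta rho -> abelian_kernel rho -> abelian_kernel eta.
Proof.
move=> [f fiso fe] ab; have [f1 f1E] := is_iso_epi fiso.
move=> x y Kx Ky; apply: (is_iso_inj fiso); rewrite -!f1E !epiM.
have Kf z : eta z = 1 -> rho (f1 z) = 1 by rewrite f1E fe.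
by apply: ab; exact: Kf.
Qed.

Lemma iso_over_indecomposable (E F : profiniteGroupType) (eta : epi E G) (rho : epi F G) :
  iso_over eta rho -> indecomposable rho -> indecomposable eta.
Proof.
move=> [f fiso fe] [nrho drho].
have [f1 f1E] := is_iso_epi fiso; have [f' [f'I fK f'K]] := is_iso_inv fiso.
split=> [/is_iso_inj etaI|D alpha beta e].
  apply: nrho; apply: injective_epi_is_iso => x y xy.
  by apply: f'I; apply: etaI; rewrite !fe /= !f'K.
have [|alphaiso|] := drho D (epi_comp alpha f') beta.
- by move=> x; rewrite /= epi_compE -[RHS]/((beta \o alpha) (f' x)) -e fe /= f'K.
- left; apply: injective_epi_is_iso => x y xy.
  apply: (is_iso_inj fiso); apply: (is_iso_inj alphaiso).
  by rewrite !epi_compE !fK.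
- by right.
Qed.

Lemma ker_comp_sub (E D : profiniteGroupType) (f : epi E D) (beta : epi D G) (tau : epi E G) :
  tau =1 beta \o f -> normal_set (ker f) `<=` normal_set (ker tau).
Proof. by move=> e x /= fx; rewrite e /= fx epi1. Qed.

(** The first isomorphism theorem, over G. *)
Lemma quotient_ker_iso (E D : profiniteGroupType) (f : epi E D) (beta : epi D G)
    (tau : epi E G) (e : tau =1 beta \o f) :
  iso_over (quotient_epi (ker_comp_sub e)) beta.
Proof.
exists (quotient_epi (@subset_refl _ (normal_set (ker f)))).
  apply: injective_epi_is_iso; apply: epi_inj => x.
  have [y <-] := epi_surj (quotient_proj (ker f)) x.
  by rewrite quotient_epi_proj => fy; exact/quotient_proj1.
move=> x; have [y <-] := epi_surj (quotient_proj (ker f)) x.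
rewrite [LHS]quotient_epi_proj e.
change (beta (f y) =
  beta (quotient_epi (@subset_refl _ (normal_set (ker f))) (quotient_proj (ker f) y))).
by rewrite quotient_epi_proj.
Qed.

End Isomorphisms.

(** * Maximal normal subgroups of the kernel *)

Section MaximalNormal.
Variables (H G : profiniteGroupType) (tau : epi H G).
Local Notation K := (normal_set (ker tau)).

Lemma max_normal_sub N : max_normal (ker tau) N -> normal_set N `<=` K.
Proof. by case=> -[]. Qed.

(** The product of L and N is a closed normal subgroup, so it is N or ker tau.
    *)
Lemma max_normal_supplemented N : max_normal (ker tau) N -> supplemented tau N.
Proof.
move=> [[NK KN] maxN] L LK nL k Kk.
have PK : normal_set (normal_prod L N) `<=` K.
  move=> x [l Ll Nlx]; rewrite -[x]mul1g -(mulgV l) -mulgA.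
  by apply: normalM; [exact: LK|exact: NK].
have [KP|nKP] := pselect (K `<=` normal_set (normal_prod L N)); first exact: KP.
case: nL; rewrite -(maxN (normal_prod L N)) //; first exact: normal_prodl.
exact: normal_prodr.
Qed.

Lemma supplemented_max_normal N : normal_set N `<=` K -> ~ K `<=` normal_set N ->
  supplemented tau N -> max_normal (ker tau) N.
Proof.
move=> NK nKN supN; split=> [//|P [PK nKP] NP].
apply/seteqP; split => //; apply: contrapT => nPN; apply: nKP => k Kk.
have [l Pl Nlk] := supN P PK nPN k Kk.
by rewrite -[k]mul1g -(mulgV l) -mulgA; apply: normalM => //; exact: NP.
Qed.

(** With P the product of L and N, the epimorphism H/N ->> G decomposes through
    H/P, so P is N or ker tau. *)
Lemma indecomposable_supplemented N (sNK : normal_set N `<=` K) :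
  indecomposable (quotient_epi sNK) -> supplemented tau N.
Proof.
move=> [_ dec] L LK nL k Kk.
pose P := normal_prod L N.
have PK : normal_set P `<=` K.
  move=> x [l Ll Nlx]; rewrite -[x]mul1g -(mulgV l) -mulgA.
  by apply: normalM; [exact: LK|exact: (sNK _ Nlx)].
have NP : normal_set N `<=` normal_set (ker (quotient_proj P)).
  by move=> x Nx; apply/quotient_proj1; exact: normal_prodr.
have [|/is_iso_inj aI|/is_iso_inj bI] := dec _ (quotient_epi NP) (quotient_epi PK).
- move=> x; have [y <-] := epi_surj (quotient_proj N) x.
  change (quotient_epi sNK (quotient_proj N y) =
    quotient_epi PK (quotient_epi NP (quotient_proj N y))).
  by rewrite !quotient_epi_proj.
- case: nL => x Lx; apply/quotient_proj1; apply: aI; rewrite epi1 quotient_epi_proj.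
  by apply/quotient_proj1; exact: normal_prodl.
- have : normal_set P k; last by [].
  by apply/quotient_proj1; apply: bI; rewrite epi1 quotient_epi_proj.
Qed.

(** A decomposition through D gives the normal subgroup P = ker (H ->> D)
    between N and ker tau. *)
Lemma max_normal_indecomposable N (sNK : normal_set N `<=` K) :
  max_normal (ker tau) N -> indecomposable (quotient_epi sNK).
Proof.
move=> [[_ nKN] maxN]; split.
  move=> /is_iso_inj qI; apply: nKN => x Kx; apply/quotient_proj1; apply: qI.
  by rewrite epi1 quotient_epi_proj.
move=> D alpha beta e.
pose P := ker (epi_comp alpha (quotient_proj N)).
have PE x : normal_set P x <-> alpha (quotient_proj N x) = 1.
  by rewrite -[normal_set P x]/(_ = 1) epi_compE.
have eK x : beta (alpha (quotient_proj N x)) = tau x.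
  by rewrite -[LHS]/((beta \o alpha) _) -e quotient_epi_proj.
have PK : normal_set P `<=` K.
  by move=> x /PE px; rewrite -[K x]/(_ = 1) -eK px epi1.
have NP : normal_set N `<=` normal_set P.
  by move=> x /quotient_proj1 Nx; apply/PE; rewrite Nx epi1.
have [KP|nKP] := pselect (K `<=` normal_set P); last first.
  left; apply: injective_epi_is_iso; apply: epi_inj => x.
  have [y <-] := epi_surj (quotient_proj N) x => /PE Py.
  by apply/quotient_proj1; rewrite -(maxN P).
right; apply: injective_epi_is_iso; apply: epi_inj => x.
have [z <-] := epi_surj alpha x; have [y <-] := epi_surj (quotient_proj N) z.
by rewrite eK => /KP/PE.
Qed.

End MaximalNormal.

Section OpenNormal.
Variable H : profiniteGroupType.

(** By compactness of H, the intersection of all conjugates of an open subgroup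
    is still open. *)
Lemma open_normal_subgroup (W : set H) : nbhs 1 W ->
  exists U : normalSubgroup H, open (normal_set U) /\ normal_set U `<=` W.
Proof.
move=> /profinite_open_subgroup[U [nU UW [U1 UM UV]]].
pose C := [set u | forall h, U (u ^ h)].
have nC : nbhs 1 C.
  have /compact_near_coveringP/(_ H (nbhs 1) (fun u h => U (u ^ h)) _) := @profinite_compact H.
  move=> near; have : \forall u \near 1, forall h, [set: H] h -> U (u ^ h).
    apply: near => h _.
    have : nbhs ((1 : H) ^ h) U by rewrite conj1g.
    have ct : continuous (fun q : H * H => q.2 ^ q.1).
      move=> q; rewrite /conjg; apply: cvgMg; last first.
        by apply: cvgMg; [exact: cvg_snd|exact: cvg_fst].
      by apply: cvgVg; exact: cvg_fst.
    by move=> /(ct (h, 1)).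
  by apply: filterS => u Cu h; exact: Cu.
have C1 : C 1 by move=> h; rewrite conj1g.
have CM x y : C x -> C y -> C (x * y) by move=> Cx Cy h; rewrite conjMg; apply: UM.
have CV x : C x -> C x^-1 by move=> Cx h; rewrite conjVg; apply: UV.
have CJ x y : C x -> C (x ^ y) by move=> Cx h; rewrite -conjgM.
have nbC x : nbhs x [set y | C (x^-1 * y)].
  by apply: (@mulgl_continuous _ x^-1 x); rewrite /= mulVg.
have oC : open C.
  rewrite openE => x Cx; apply: (@filterS _ (nbhs x) _ _ _ _ (nbC x)) => y /= Cxy.
  by have := CM _ _ Cx Cxy; rewrite mulgA mulgV mul1g.
have cC : closed C.
  rewrite -[C]setCK; apply: open_closedC; rewrite openE => x nCx.
  apply: (@filterS _ (nbhs x) _ _ _ _ (nbC x)) => y /= Cxy Cy; apply: nCx.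
  by have := CM _ _ Cy (CV _ Cxy); rewrite invgM invgK mulgA mulgV mul1g.
exists (NormalSubgroup C1 CM CV CJ cC); split => // x /(_ 1); rewrite conjg1; exact: UW.
Qed.

End OpenNormal.

Section MaximalAbelian.
Variables (H G : profiniteGroupType) (tau : epi H G).
Local Notation K := (normal_set (ker tau)).
Variable N : normalSubgroup H.
Hypothesis supN : supplemented tau N.
Hypotheses (sNK : normal_set N `<=` K) (KN : ~ K `<=` normal_set N).
Variable ab : abelian_kernel (quotient_epi sNK).
Local Notation B := (kernel_module ab).
Local Notation p := (quotient_proj N).

(** This is where finiteness of K/N comes from. Given x0 in ker tau outside N,
    choose U so small that x0 is not in U N; then the elements of U in ker tau
    do not cover ker tau modulo N, and must lie in N. *)
Lemma supplemented_open : exists U : normalSubgroup H, open (normal_set U) /\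
  (normal_set U `&` K) `<=` normal_set N.
Proof.
have [x0 [Kx0 nx0]] : exists x, K x /\ ~ normal_set N x.
  by apply: contrapT => /forallNP n; apply: KN => x Kx; apply: contrapT => nx; apply: (n x).
have nW : nbhs 1 [set u | ~ normal_set N (u^-1 * x0)].
  have ct : continuous (fun u : H => u^-1 * x0).
    by move=> u; apply: cvgMg; [exact: invg_continuous|exact: cvg_cst].
  apply: (ct 1 (~` normal_set N)); rewrite /= invg1 mul1g; apply: open_nbhs_nbhs; split => //.
  by apply: closed_openC; exact: normal_closed.
have [U [oU UW]] := open_normal_subgroup nW.
exists U; split => //; apply: contrapT => nUN.
pose L := normal_meet (ker tau) [set: unit] (fun=> U).
have LK : normal_set L `<=` K by move=> x [].
have nLN : ~ normal_set L `<=` normal_set N.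
  by move=> LN; apply: nUN => x [Ux Kx]; apply: LN; split.
by have [l [_ /(_ tt I)/UW]] := supN LK nLN Kx0.
Qed.

Lemma kernel_repr (u : B) : exists2 x, K x & p x = kernel_val u.
Proof.
have [x xu] := epi_surj p (kernel_val u); exists x => //.
by apply/(quotient_ker sNK); rewrite xu; exact: kernel_valP.
Qed.

Let mod_discrete (V : set B) : open V.
Proof.
have [U [oU UKN]] := supplemented_open.
rewrite openE => u Vu.
have [k Kk ku] := kernel_repr u.
have oW : open (p @` [set x | normal_set U (k^-1 * x)]).
  apply: epi_open; apply: (@open_comp _ _ (fun x => k^-1 * x)) => // x _.
  exact: mulgl_continuous.
have nW : nbhs u ((@kernel_val _ _ _ ab) @^-1` (p @` [set x | normal_set U (k^-1 * x)])).
  apply: open_nbhs_nbhs; split.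
    by apply: open_comp => // x _; exact: kernel_val_continuous.
  by exists k => //=; rewrite mulVg; exact: normal1.
apply: (@filterS _ (nbhs u) _ _ _ _ nW) => v [x Ukx xv].
suff -> : v = u by [].
have Kx : K x by apply/(quotient_ker sNK); rewrite xv; exact: kernel_valP.
apply: kernel_val_inj; rewrite -xv -ku; apply/esym/quotient_projE/UKN.
by split => //; apply: normalM => //; exact: normalV.
Qed.

Let mod_finite : finite_set [set: B].
Proof.
have [U [oU UKN]] := supplemented_open.
have [s sP] : exists s : seq H, forall x, K x -> exists2 k, k \in s &
    K k /\ normal_set U (k^-1 * x).
  apply: contrapT => /forallNP ns.
  pose D k := [set x | K k -> ~ normal_set U (k^-1 * x)].
  have [||x xP] := @compact_bigcap_nonempty H H (fun k => K `&` D k) (@profinite_compact H).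
  - move=> k; apply: closedI; first exact: normal_closed.
    have [Kk|nKk] := pselect (K k); last first.
      rewrite (_ : D k = setT); first exact: closedT.
      by apply/seteqP; split=> // x _ Kk.
    rewrite (_ : D k = ~` ((fun x => k^-1 * x) @^-1` normal_set U)).
      by apply: open_closedC; apply: open_comp => // x _; exact: mulgl_continuous.
    by apply/seteqP; split=> x /= Dx; [exact: Dx|move=> _].
  - move=> s; have := ns s => /existsNP[x /not_implyP[Kx nx]].
    exists x => k ks; split => // Kk Ukx; apply: nx; by exists k.
  - have [Kx _] := xP 1; have [_] := xP x; apply => //.
    by rewrite mulVg; exact: normal1.
pose f k : B := if pselect (K k) is left Kk
  then kernel_in ab ((quotient_ker sNK k).2 Kk) else 0%R.
apply: (@sub_finite_set _ _ (f @` [set` s])); last first.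
  by apply: finite_image; exact: finite_seq.
move=> u _; have [x Kx xu] := kernel_repr u; have [k ks [Kk Ukx]] := sP x Kx.
exists k => //; rewrite /f; case: pselect => // Kk'; apply: kernel_val_inj.
rewrite -xu; apply/quotient_projE/UKN; split => //.
by apply: normalM => //; exact: normalV.
Qed.

Let mod_neq0 : exists a : B, a != 0%R.
Proof.
apply: contrapT => /forallNP n; apply: KN => x Kx; apply/quotient_proj1.
have Kx' := (quotient_ker sNK x).2 Kx.
have /negP/negPn/eqP/(congr1 (@kernel_val _ _ _ _)) := n (kernel_in ab Kx').
by [].
Qed.

Let mod_simple (S : set B) : S 0%R -> (forall a b, S a -> S b -> S (a - b)%R) ->
  (forall g a, S a -> S (gact g a)) -> S = [set 0%R] \/ S = [set: B].
Proof.
move=> S0 SB SG.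
have SN a : S a -> S (- a)%R by move=> Sa; have := SB _ _ S0 Sa; rewrite sub0r.
have SD a b : S a -> S b -> S (a + b)%R.
  by move=> Sa Sb; rewrite -(opprK b); apply: SB => //; exact: SN.
pose P := p @^-1` ((@kernel_val _ _ _ ab) @` S).
have P1 : P 1 by exists 0%R => //; rewrite (epi1 p).
have PM x y : P x -> P y -> P (x * y).
  move=> [a Sa ax] [b Sb by_]; exists (a + b)%R; first exact: SD.
  by rewrite epiM -ax -by_.
have PV x : P x -> P x^-1.
  move=> [a Sa ax]; exists (- a)%R; first exact: SN.
  by rewrite epiV -ax.
have PJ x y : P x -> P (x ^ y).
  move=> [a Sa ax]; exists (gact (tau y^-1) a); first exact: SG.
  rewrite -(quotient_epi_proj sNK) [LHS]kernel_actE ax.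
  by rewrite conjgE !epiM !epiV invgK mulgA.
have Pc : closed P.
  apply: preimage_closed; first by move=> x _; exact: epi_continuous.
  apply: compact_closed; first exact: profinite_hausdorff.
  by apply: finite_compact; apply: finite_image; apply: sub_finite_set mod_finite.
pose L := NormalSubgroup P1 PM PV PJ Pc.
have LK : normal_set L `<=` K.
  by move=> x [a Sa ax]; apply/(quotient_ker sNK); rewrite -ax; exact: kernel_valP.
have [LN|nLN] := pselect (normal_set L `<=` normal_set N); [left|right].
  apply/seteqP; split=> [u Su|_ -> //].
  have [x Kx xu] := kernel_repr u; apply: kernel_val_inj; rewrite -xu.
  by apply/quotient_proj1/LN; exists u.
apply/seteqP; split => // u _; have [x Kx xu] := kernel_repr u.
have [l [a Sa al] Nlx] := supN LK nLN Kx.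
suff -> : u = a by [].
by apply: kernel_val_inj; rewrite -xu al; apply/esym/quotient_projE.
Qed.

Definition max_module : simple_gmodule G :=
  SimpleGmodule mod_finite mod_discrete mod_neq0 mod_simple.

Lemma max_module_C_A : C_A tau max_module N.
Proof. by exists sNK, ab; exact: gmodule_iso_refl. Qed.

End MaximalAbelian.

(** * Gluing local isomorphisms *)

Section Gluing.
Variables (H H' G : profiniteGroupType) (tau : epi H G) (tau' : epi H' G).

(** The graph of an isomorphism of H/N with H'/N' over G, lifted to a relation
    between H and H'. Relations are symmetric in the two groups, and many of
    them can be intersected. *)
Record local_iso (Gam : H -> H' -> Prop)
    (N : normalSubgroup H) (N' : normalSubgroup H') : Prop := LocalIso {
  local_closed : closed [set q : H * H' | Gam q.1 q.2];
  local_over : forall x x', Gam x x' -> tau x = tau' x';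
  localM : forall x x' y y', Gam x x' -> Gam y y' -> Gam (x * y) (x' * y');
  localV : forall x x', Gam x x' -> Gam x^-1 x'^-1;
  local_ex : forall x, exists x', Gam x x';
  local_ex' : forall x', exists x, Gam x x';
  local_ker : forall x, Gam x 1 <-> normal_set N x;
  local_ker' : forall x', Gam 1 x' <-> normal_set N' x'
}.
End Gluing.

Lemma local_iso_sym (H H' G : profiniteGroupType) (tau : epi H G) (tau' : epi H' G) Gam N N' :
  local_iso tau tau' Gam N N' -> local_iso tau' tau (fun x' x => Gam x x') N' N.
Proof.
case=> c o M V e e' k k'; split => //.
- rewrite (_ : [set _ | _] =
    (fun q : H' * H => (q.2, q.1)) @^-1` [set q : H * H' | Gam q.1 q.2]) //.
  apply: preimage_closed => // q _; apply: cvg_pair; [exact: cvg_snd|exact: cvg_fst].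
- by move=> x x' /o.
- by move=> x x' y y' xx' yy'; exact: M.
- by move=> x x' /V.
Qed.

Lemma glued_ex (H H' G : profiniteGroupType) (tau : epi H G) (tau' : epi H' G)
    (I : eqType) (Gam : I -> H -> H' -> Prop)
    (N : I -> normalSubgroup H) (N' : I -> normalSubgroup H') :
  (forall i, local_iso tau tau' (Gam i) (N i) (N' i)) ->
  (forall i, supplemented tau' (N' i)) -> independent tau' N' ->
  forall x, exists x', tau' x' = tau x /\ forall i, Gam i x x'.
Proof.
move=> loc sup ind x.
have /choice[y yP] : forall i, exists x', Gam i x x' by move=> i; exact: (local_ex (loc i)).
have yg i : tau' (y i) = tau x by exact/esym/(local_over (loc i)).
have [h hg hN] := independent_cosets_meet sup ind yg.
exists h; split => // i.
have := localM (loc i) (yP i) ((local_ker' (loc i) _).2 (hN i)).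
by rewrite mulg1 mulgA mulgV mul1g.
Qed.

Section Glue.
Variables (H H' G : profiniteGroupType) (tau : epi H G) (tau' : epi H' G).
Variables (I : eqType) (Gam : I -> H -> H' -> Prop).
Variables (N : I -> normalSubgroup H) (N' : I -> normalSubgroup H').
Hypothesis loc : forall i, local_iso tau tau' (Gam i) (N i) (N' i).
Hypotheses (sup : forall i, supplemented tau (N i)) (sup' : forall i, supplemented tau' (N' i)).
Hypotheses (ind : independent tau N) (ind' : independent tau' N').
Hypothesis trivial' : forall x', normal_set (ker tau') x' ->
  (forall i, normal_set (N' i) x') -> x' = 1.

(** The pairs over one element of G that satisfy all Gam i form the graph of
    psi. It is everywhere defined by the independence of the N', single-valued
    since the N' meet trivially, and closed, so psi is continuous. Surjectivity
    is the same statement with H and H' exchanged. *)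
Lemma glue_local_isos : exists psi : epi H H', tau =1 tau' \o psi /\
  ((forall x, normal_set (ker tau) x -> (forall i, normal_set (N i) x) -> x = 1) ->
   injective psi).
Proof.
pose glued x x' := tau' x' = tau x /\ forall i, Gam i x x'.
have gM x x' y y' : glued x x' -> glued y y' -> glued (x * y) (x' * y').
  move=> [xx' xi] [yy' yi]; split; first by rewrite !epiM xx' yy'.
  by move=> i; apply: localM; [exact: loc|exact: xi|exact: yi].
have gV x x' : glued x x' -> glued x^-1 x'^-1.
  move=> [xx' xi]; split; first by rewrite !epiV xx'.
  by move=> i; apply: localV; [exact: loc|exact: xi].
have guniq x x' y' : glued x x' -> glued x y' -> x' = y'.
  move=> /gV xx' xy'; apply: (@mulgI _ x'^-1); rewrite mulVg; apply/esym.
  have [e ei] := gM _ _ _ _ xx' xy'; rewrite mulVg in e ei.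
  apply: trivial'; first by rewrite -[normal_set _ _]/(_ = 1) e epi1.
  by move=> i; apply/(local_ker' (loc i)).
have /choice[psi psiP] := glued_ex loc sup' ind'.
have psiM : {morph psi : x y / x * y} by move=> x y; apply: guniq (gM _ _ _ _ (psiP x) (psiP y)).
have psic : continuous psi.
  apply: closed_graph_continuous; first exact: profinite_compact.
  rewrite (_ : [set _ | _] = [set q : H * H' | (tau q.1)^-1 * tau' q.2 = 1] `&`
      \bigcap_(i in [set: I]) [set q | Gam i q.1 q.2]).
    apply: closedI; last by apply: closed_bigI => i _; exact: local_closed (loc i).
    apply: (@preimage_closed _ _ (fun q : H * H' => (tau q.1)^-1 * tau' q.2) [set 1]).
      move=> q _; apply: cvgMg.
        by apply: cvgVg; apply: continuous_comp; [exact: cvg_fst|exact: epi_continuous].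
      by apply: continuous_comp; [exact: cvg_snd|exact: epi_continuous].
    by apply: accessible_closed_set1; apply: hausdorff_accessible; exact: profinite_hausdorff.
  apply/seteqP; split=> [[x x'] /= <-|[x x'] /= [e ei]].
    by have [e ei] := psiP x; split=> [|i _]; [rewrite e mulVg|exact: ei].
  apply: (guniq x) => //; split=> [|i]; last exact: ei.
  by have := congr1 (fun y => tau x * y) e; rewrite mulgA mulgV mul1g mulg1.
have psis y : exists x, psi x = y.
  have [x [xy xi]] := glued_ex (fun i => local_iso_sym (loc i)) sup ind y.
  by exists x; apply: (guniq x) => //; split.
exists (Epi psiM psic psis); split=> [x|triv]; first by have [e _] := psiP x.
apply: epi_inj => x /= psix; have [e ei] := psiP x; rewrite psix in e ei.
apply: triv; first by rewrite -[normal_set _ _]/(_ = 1) -e epi1.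
by move=> i; apply/(local_ker (loc i)).
Qed.
End Glue.

(** * Local isomorphisms from equal invariants *)

Section LocalIsomorphisms.
Variables (H H' G : profiniteGroupType) (tau : epi H G) (tau' : epi H' G).

Lemma closed_agree (T : topologicalType) (E F : topologicalType) (f : E -> T) (g : F -> T) :
  hausdorff_space T -> continuous f -> continuous g ->
  closed [set q : E * F | f q.1 = g q.2].
Proof.
rewrite open_hausdorff => hT cf cg; rewrite -[X in closed X]setCK; apply: open_closedC.
rewrite openE => -[x y] /= /eqP /hT[[U V] /= [/set_mem Ux /set_mem Vy] [oU oV /eqP UV]].
exists (f @^-1` U, g @^-1` V).
  by split; [apply: cf|apply: cg]; exact: open_nbhs_nbhs.
move=> [x' y'] /= [Ux' Vy'] e; have : (U `&` V) (f x') by split => //; rewrite e.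
by rewrite UV.
Qed.

Lemma quotient_local_iso (N : normalSubgroup H) (N' : normalSubgroup H')
    (sNK : normal_set N `<=` normal_set (ker tau))
    (sN'K : normal_set N' `<=` normal_set (ker tau')) :
  iso_over (quotient_epi sN'K) (quotient_epi sNK) ->
  exists Gam, local_iso tau tau' Gam N N'.
Proof.
move=> [f fiso fe]; have [f1 f1E] := is_iso_epi fiso.
pose g := epi_comp f1 (quotient_proj N').
have gE x : g x = f1 (quotient_proj N' x) by exact: epi_compE.
have gtau x' : quotient_epi sNK (g x') = tau' x'.
  by rewrite gE f1E -[LHS]/((quotient_epi sNK \o f) _) -fe quotient_epi_proj.
exists (fun x x' => quotient_proj N x = g x'); split.
- apply: closed_agree; [exact: profinite_hausdorff|exact: epi_continuous|exact: epi_continuous].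
- by move=> x x' e; rewrite -gtau -e quotient_epi_proj.
- by move=> x x' y y' ex ey; rewrite !epiM ex ey.
- by move=> x x' ex; rewrite !epiV ex.
- by move=> x; have [x' xx'] := epi_surj g (quotient_proj N x); exists x'.
- by move=> x'; have [x xx'] := epi_surj (quotient_proj N) (g x'); exists x.
- by move=> x; rewrite epi1; exact: quotient_proj1.
- move=> x'; rewrite epi1 gE -quotient_proj1; split=> [e|->]; last by rewrite epi1.
  by apply: (is_iso_inj fiso); rewrite -!f1E -e epi1.
Qed.

Lemma splitting_map1 (H0 : profiniteGroupType) (tau0 : epi H0 G) (A : simple_gmodule G)
    (phi : ghom (B_A tau0 A) A) z c : splitting_map phi z c ->
  c 1%g = (- val z (1%g, 1%g))%R.
Proof.
move=> [_ cM _]; have := cM 1 1; rewrite mul1g epi1 gact1 => e.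
apply/eqP; rewrite -addr_eq0; apply/eqP.
by apply: (@addIr _ (c 1%g)); rewrite add0r {3}e addrAC.
Qed.

Lemma splitting_mapV (H0 : profiniteGroupType) (tau0 : epi H0 G) (A : simple_gmodule G)
    (phi : ghom (B_A tau0 A) A) z c x : splitting_map phi z c ->
  c x^-1 = (- val z (1%g, 1%g) - gact (tau0 x)^-1%g (c x) - val z ((tau0 x)^-1%g, tau0 x))%R.
Proof.
move=> cP; rewrite -(splitting_map1 cP); have [_ cM _] := cP.
have := cM x^-1 x; rewrite mulVg epiV => ->.
by rewrite addrAC !addrK.
Qed.

Variable A : simple_gmodule G.

(** Multiplication by k in the kernel adds char phi k to c, and char phi is
    onto A. *)
Lemma splitting_map_onto (H1 H2 : profiniteGroupType) (tau1 : epi H1 G) (tau2 : epi H2 G)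
    (phi : ghom (B_A tau1 A) A) z c (x : H2) a :
  phi != 0%R -> splitting_map phi z c -> exists y : H1, tau1 y = tau2 x /\ c y = a.
Proof.
move=> /char_neq0[k0 Kk0 k00] cP; have [y0 y0x] := epi_surj tau1 (tau2 x).
have [k Kk kE] := char_image (char_is_char phi) Kk0 k00 (fun x K => K) Kk0 (a - c y0)%R.
exists (k * y0); split; first by rewrite epiM Kk mul1g.
by rewrite (splitting_mapMl _ cP Kk) kE subrK.
Qed.

(** Splitting maps c and c' for one cocycle obey the same formulas for products
    and inverses, so c x = c' x' is a subgroup condition on the pairs (x, x')
    over one element of G. *)
Lemma char_local_iso (phi : ghom (B_A tau A) A) (phi' : ghom (B_A tau' A) A) :
  phi != 0%R -> phi' != 0%R -> S_A tau' A phi' = S_A tau A phi ->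
  exists Gam, local_iso tau tau' Gam (char_ker (char_is_char phi)) (char_ker (char_is_char phi')).
Proof.
move=> phi0 phi'0 SS.
have Sz : S_A tau A phi = H2_class (H2_repr (S_A tau A phi)) by exact/esym/reprK.
set z := H2_repr _ in Sz; have [c cP] := (S_A_splitting phi z).1 Sz.
have [c' c'P] := (S_A_splitting phi' z).1 (etrans SS Sz).
have [cc cM cK] := cP; have [c'c c'M c'K] := c'P.
have c1 : c 1 = c' 1 by rewrite (splitting_map1 cP) (splitting_map1 c'P).
exists (fun x x' => tau x = tau' x' /\ c x = c' x'); split.
- apply: closedI.
    apply: closed_agree; [exact: profinite_hausdorff|exact: epi_continuous|exact: epi_continuous].
  by apply: closed_agree => //; exact: simple_hausdorff.
- by move=> x x' [].
- move=> x x' y y' [ex cx] [ey cy]; rewrite !epiM ex ey; split => //.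
  by rewrite cM c'M ex ey cx cy.
- move=> x x' [ex cx]; rewrite !epiV ex; split => //.
  by rewrite (splitting_mapV _ cP) (splitting_mapV _ c'P) ex cx.
- move=> x; have [y [yx cy]] := splitting_map_onto tau x (c x) phi'0 c'P.
  by exists y.
- move=> x'; have [y [yx cy]] := splitting_map_onto tau' x' (c' x') phi0 cP.
  by exists y.
- move=> x; rewrite epi1 -c1; split=> [[Kx cx]|[Kx x0]]; split => //.
    by move: cx; rewrite (cK _ Kx) -{2}[c 1]addr0 => /addrI.
  by rewrite (cK _ Kx) x0 addr0.
- move=> x; rewrite epi1 c1; split=> [[/esym Kx cx]|[Kx x0]]; split => //.
    by move: cx; rewrite (c'K _ Kx) -{1}[c' 1]addr0 => /addrI.
  by rewrite (c'K _ Kx) x0 addr0.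
Qed.

End LocalIsomorphisms.

(** * Linearity of S_A *)

Section Linearity.
Variables (H G : profiniteGroupType) (tau : epi H G) (A : simple_gmodule G).
Local Notation V := (ghom (B_A tau A) A).
Local Open Scope ring_scope.

Lemma S_A0 : S_A tau A 0 = H2_class 0.
Proof.
apply/S_A_splitting; exists (fun=> 0); split.
- exact: cst_continuous.
- by move=> x y; rewrite gact0 !addr0.
- by move=> k Kk; rewrite char0 // addr0.
Qed.

Lemma S_AD (v w : V) z t : S_A tau A v = H2_class z -> S_A tau A w = H2_class t ->
  S_A tau A (v + w) = H2_class (z + t).
Proof.
move=> /S_A_splitting[c [cc cM cK]] /S_A_splitting[d [dc dM dK]].
apply/S_A_splitting; exists (fun x => c x + d x); split.
- move=> h; apply: (@continuous2_cvg _ _ _ _ _ _ c d (fun u v => u + v)).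
  + exact: (@add_continuous A (c h, d h)).
  + exact: cc.
  + exact: dc.
- move=> x y; rewrite cM dM gactD raddfD /=.
  by rewrite addrACA (addrACA (c x)).
- by move=> k Kk; rewrite cK // dK // charD // addrACA.
Qed.

Lemma S_AZ (a : gend A) (v : V) z : S_A tau A v = H2_class z ->
  S_A tau A (a *: v) = H2_class (Z2_map a z).
Proof.
move=> /S_A_splitting[c [cc cM cK]].
apply/S_A_splitting; exists (fun x => hom_fun a (c x)); split.
- move=> h; apply: continuous_comp; [exact: cc|exact: discrete_continuous].
- by move=> x y; rewrite cM !homD homact.
- by move=> k Kk; rewrite cK // homD charZ.
Qed.

Lemma H2_class0 : H2_class (0 : Z2 A) = 0.
Proof. exact: (raddf0 (\pi_(Quotient.quot (GRing.ZmodClosed.clone (Z2 A) (@B2 _ A) _)))). Qed.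

End Linearity.

Section Compatibility.
Variables (H H' G : profiniteGroupType) (tau : epi H G) (tau' : epi H' G).
Variable A : simple_gmodule G.
Local Open Scope ring_scope.
Let rho (v' : ghom (B_A tau' A) A) (v : ghom (B_A tau A) A) := S_A tau' A v' = S_A tau A v.

Lemma S_A_rel0 : rho 0 0. Proof. by rewrite /rho !S_A0. Qed.

Lemma S_A_relD v' v w' w : rho v' v -> rho w' w -> rho (v' + w') (v + w).
Proof.
move=> e e'.
have ez : S_A tau A v = H2_class (H2_repr (S_A tau A v)) by exact/esym/reprK.
have ez' : S_A tau A w = H2_class (H2_repr (S_A tau A w)) by exact/esym/reprK.
by rewrite /rho (S_AD ez ez'); apply: S_AD; rewrite ?e ?e'.
Qed.

Lemma S_A_relZ (a : gend A) v' v : rho v' v -> rho (a *: v') (a *: v).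
Proof.
move=> e.
have ez : S_A tau A v = H2_class (H2_repr (S_A tau A v)) by exact/esym/reprK.
by rewrite /rho (S_AZ a ez); apply: S_AZ; rewrite e.
Qed.
End Compatibility.

Lemma S_A_ker (H G : profiniteGroupType) (tau : epi H G) (A : simple_gmodule G) :
  is_submodule (S_A tau A @^-1` [set 0%R]).
Proof.
have S0 : S_A tau A 0%R = 0%R by rewrite S_A0 H2_class0.
split=> [|v w /= v0 w0|a v /= v0]; first exact: S0.
  rewrite -S0 -[X in _ = S_A tau A X](addr0 0%R).
  by apply: S_A_relD; rewrite S0.
by rewrite -S0 -[X in _ = S_A tau A X](scaler0 _ a); apply: S_A_relZ; rewrite S0.
Qed.

(** * Invariants under domination *)

Section Dominance.
Variables (H H' G : profiniteGroupType) (tau : epi H G) (tau' : epi H' G).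
Variable psi : epi H H'.
Hypothesis psiE : tau =1 tau' \o psi.

(** N' is sent to its preimage, the kernel of H ->> H'/N'. *)
Lemma dominates_mult_na (zeta : nonabelian_epi G) :
  cardinal_le (mult_na tau' zeta) (mult_na tau zeta).
Proof.
pose f (N' : normalSubgroup H') := ker (epi_comp (quotient_proj N') psi).
have fE N' x : normal_set (f N') x <-> normal_set N' (psi x).
  by rewrite -[normal_set (f N') x]/(_ = 1) epi_compE; exact: quotient_proj1.
apply: (@inj_card_le_fun _ _ _ _ f).
  move=> M N _ _ MN; apply: normal_inj; apply/seteqP; split=> y; have [x <-] := epi_surj psi y.
    by move=> /fE; rewrite MN => /fE.
  by move=> /fE; rewrite -MN => /fE.
move=> N' [sN'K iso].
have e : tau =1 quotient_epi sN'K \o epi_comp (quotient_proj N') psi.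
  move=> x; rewrite psiE -[RHS]/(quotient_epi sN'K (epi_comp (quotient_proj N') psi x)).
  by rewrite epi_compE quotient_epi_proj.
by exists (ker_comp_sub e); exact: iso_over_trans (quotient_ker_iso e) iso.
Qed.

Variable A : simple_gmodule G.

(** A splitting map on H' composed with psi is a splitting map on H for the
    same cocycle. *)
Lemma dominates_char (phi' : ghom (B_A tau' A) A) : exists phi : ghom (B_A tau A) A,
  (forall x, normal_set (ker tau) x -> char phi x = char phi' (psi x)) /\
  S_A tau A phi = S_A tau' A phi'.
Proof.
have [phi phiE] := char_surj (char_comp psiE (char_is_char phi')).
exists phi; split => //.
have Sz : S_A tau' A phi' = H2_class (H2_repr (S_A tau' A phi')) by exact/esym/reprK.
rewrite Sz; apply/S_A_splitting.
have /S_A_splitting[c [cc cM cK]] := Sz.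
exists (c \o psi); split.
- by move=> x; apply: continuous_comp; [exact: epi_continuous|exact: cc].
- by move=> x y; rewrite /= epiM cM !psiE.
- move=> k Kk; have Kk' : normal_set (ker tau') (psi k).
    by rewrite -[normal_set _ _]/((tau' \o psi) k = 1) -psiE.
  by rewrite /= (cK _ Kk') phiE // epi1.
Qed.

Lemma dominates_supp : supp tau' A `<=` supp tau A.
Proof. by move=> _ [phi' _ <-]; have [phi [_ <-]] := dominates_char phi'; exists phi. Qed.

Lemma dominates_mult_ab : cardinal_le (mult_ab tau' A) (mult_ab tau A).
Proof.
have /choice[f fP] := dominates_char.
have Kpsi x : normal_set (ker tau) x -> normal_set (ker tau') (psi x).
  by move=> Kx; rewrite -[normal_set _ _]/((tau' \o psi) x = 1) -psiE.
apply: (@dimension_le _ (@gend_div _ A) (@gend1 _ A) _ _ _ _ f); try exact: S_A_ker.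
- move=> v w; apply: char_inj => x Kx.
  by rewrite (fP _).1 // !charD ?(fP _).1 //; exact: Kpsi.
- move=> a v; apply: char_inj => x Kx.
  by rewrite (fP _).1 // !charZ ?(fP _).1 //; exact: Kpsi.
- move=> v w vw; apply: char_inj => y Ky; have [x xy] := epi_surj psi y.
  have Kx : normal_set (ker tau) x by rewrite -[normal_set _ _]/(_ = 1) psiE /= xy.
  by rewrite -xy -!(fP _).1 // vw.
- by move=> v /= v0; rewrite (fP v).2.
Qed.

End Dominance.

(** * Matching the invariants *)

Section Maximal.
Variables (H G : profiniteGroupType) (tau : epi H G).
Local Notation K := (normal_set (ker tau)).

(** The simple G-modules form a type too large to index a family of elements;
    the subgroups N, standing for the modules ker tau / N, index them instead.
    *)
Definition max_ab : Type :=
  {N : normalSubgroup H | max_normal (ker tau) N /\ abelian_mod tau N}.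

Definition max_ab_sub (r : max_ab) : normal_set (sval r) `<=` K :=
  max_normal_sub (svalP r).1.

Arguments max_ab_sub : clear implicits.

Definition max_ab_module (r : max_ab) : simple_gmodule G :=
  max_module (max_normal_supplemented (svalP r).1) (svalP r).1.1.2
    ((abelian_modP (max_ab_sub r)).2 (svalP r).2).

Lemma max_ab_C_A (r : max_ab) : C_A tau (max_ab_module r) (sval r).
Proof. exact: max_module_C_A. Qed.

Definition max_na : Type :=
  {N : normalSubgroup H | max_normal (ker tau) N /\ ~ abelian_mod tau N}.

Definition max_na_sub (i : max_na) : normal_set (sval i) `<=` K :=
  max_normal_sub (svalP i).1.

Arguments max_na_sub : clear implicits.

Lemma max_na_kernel (i : max_na) : ~ abelian_kernel (quotient_epi (max_na_sub i)).
Proof. by move=> /abelian_modP; exact: (svalP i).2. Qed.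

Definition max_na_epi (i : max_na) : nonabelian_epi G :=
  NonabelianEpi (max_normal_indecomposable (max_na_sub i) (svalP i).1) (@max_na_kernel i).

Lemma mult_naP (zeta : nonabelian_epi G) N : cardinal_set (mult_na tau zeta) N ->
  [/\ normal_set N `<=` K, supplemented tau N & ~ abelian_mod tau N].
Proof.
move=> [sNK iso]; split => //.
  apply: (@indecomposable_supplemented _ _ _ _ sNK).
  by apply: iso_over_indecomposable iso _; exact: nonabelian_indecomposable.
move=> /(abelian_modP sNK) ab; apply: (@nonabelian_kernel _ zeta).
exact: iso_over_abelian (iso_over_sym iso) ab.
Qed.

Lemma max_na_inj (i k : max_na) : sval i = sval k -> i = k.
Proof. by move=> ik; apply: eq_sig_hprop => // ?; exact: Prop_irrelevance. Qed.

Lemma max_na_supplemented (i : max_na) : supplemented tau (sval i).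
Proof. exact: max_normal_supplemented (svalP i).1. Qed.

Lemma mult_na_max (zeta : nonabelian_epi G) N : cardinal_set (mult_na tau zeta) N ->
  exists i : max_na, sval i = N /\ iso_over (max_na_epi i) zeta.
Proof.
move=> NP; have [NK supN nabN] := mult_naP NP; have [sNK iso] := NP.
have maxN : max_normal (ker tau) N.
  apply: supplemented_max_normal => // KN; apply: nabN => x y Kx Ky; apply: KN.
  by apply: normalM; [apply: normalV|]; exact: normalM.
by exists (exist _ N (conj maxN nabN)).
Qed.

Lemma fundamental_trivial x : fundamental tau -> K x ->
  (forall r : max_ab, normal_set (sval r) x) ->
  (forall i : max_na, normal_set (sval i) x) -> x = 1.
Proof.
move=> fund Kx abx nax; have : fundament_kernel tau x; last by rewrite fund.
split => // N maxN; have [ab|nab] := pselect (abelian_mod tau N).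
  exact: (abx (exist _ N (conj maxN ab))).
exact: (nax (exist _ N (conj maxN nab))).
Qed.

(** N is the kernel of a character with values in B, a combination of the
    elements of Y. *)
Lemma C_A_mem (A B : simple_gmodule G) N (Y : set (ghom (B_A tau B) B)) x :
  C_A tau A N -> gmodule_iso A B -> Defs.span Y = [set: _] ->
  K x -> (forall phi, Y phi -> char phi x = 0%R) -> normal_set N x.
Proof.
move=> [sNK [ab isoA]] AB spY Kx Yx.
have /C_A_char[chi [cchi [-> _]]] : C_A tau B N.
  by exists sNK, ab; exact: gmodule_iso_trans isoA AB.
have [phi phiE] := char_surj cchi; split => //; rewrite -phiE //.
have /spanP[l [a [_ lY ->]]] : Defs.span Y phi by rewrite spY.
by rewrite char_sum // big_seq big1 // => v /lY /Yx ->; exact: hom0.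
Qed.

End Maximal.

Arguments max_ab_sub {H G tau} r.
Arguments max_na_sub {H G tau} i.

Section Construction.
Variables (G H H' : profiniteGroupType) (tau : epi H G) (tau' : epi H' G).

(** The instance of matched_bases for S_A: multiplicities compare the bases of
    the kernels, and the inclusion of supports makes the relation total. *)
Lemma matched_characters (A : simple_gmodule G) :
  cardinal_le (mult_ab tau' A) (mult_ab tau A) -> supp tau' A `<=` supp tau A ->
  exists Xt : set (ghom (B_A tau' A) A) * (ghom (B_A tau' A) A -> ghom (B_A tau A) A),
    [/\ free_family Xt.1 id, Defs.span Xt.1 = [set: _], free_family Xt.1 Xt.2,
      forall x, Xt.1 x -> S_A tau' A x = S_A tau A (Xt.2 x) &
      cardinal_eq (mult_ab tau' A) (mult_ab tau A) -> supp tau' A = supp tau A ->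
        Defs.span (Xt.2 @` Xt.1) = [set: _]].
Proof.
move=> multle supple.
have [f [fI fX feq]] := card_le_eq_fun 0%R multle.
pose rho v' v := S_A tau' A v' = S_A tau A v.
have B' := dimension_basis (@gend_div _ A) (S_A_ker tau' A).
have B := dimension_basis (@gend_div _ A) (S_A_ker tau A).
have [|||X [t [fX' spX ft rhot speq]]] := @matched_bases _ (@gend_div _ A) (@gend1 _ A)
   _ _ rho _ _ f (S_A_rel0 tau tau' A) (@S_A_relD _ _ _ tau tau' A)
   (@S_A_relZ _ _ _ tau tau' A) _ _ _ fI fX.
- by move=> v'; have [|v _ vv'] := supple (S_A tau' A v'); [by exists v'|by exists v].
- by move: B'; congr (is_basis _ _); apply/funext => v; rewrite /rho S_A0 H2_class0.
- move: B; congr (is_basis _ _); apply/funext => v; rewrite /rho S_A0 H2_class0.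
  by apply/propext; split.
exists (X, t); split => //= /feq fX0 supeq; apply: speq => // v.
have [v' _ vv'] : supp tau' A (S_A tau A v) by rewrite supeq; exists v.
by exists v'.
Qed.

(** Each isomorphism class comes with its own injection f, which is applied to
    the members of that class. No collision arises between classes because N i
    stays in the class of i. *)
Lemma matched_nonabelian :
  (forall zeta, cardinal_le (mult_na tau' zeta) (mult_na tau zeta)) ->
  exists N : max_na tau' -> max_na tau, [/\ injective N,
    forall i, iso_over (max_na_epi i) (max_na_epi (N i)) &
    (forall zeta, cardinal_eq (mult_na tau' zeta) (mult_na tau zeta)) ->
      forall k, exists i, N i = k].
Proof.
move=> multle.
have [||| rep [repE rep_eq]] := @class_repr (max_na tau')
    (fun i i' => iso_over (max_na_epi i) (max_na_epi i')).
- by move=> i; exact: iso_over_refl.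
- by move=> i i'; exact: iso_over_sym.
- by move=> i i' i''; exact: iso_over_trans.
have repK i : rep (rep i) = rep i by exact/esym/rep_eq/repE.
pose S' (i : max_na tau') : set (normalSubgroup H') := cardinal_set (mult_na tau' (max_na_epi i)).
pose S (i : max_na tau') : set (normalSubgroup H) := cardinal_set (mult_na tau (max_na_epi i)).
have /choice[f fP] : forall i : max_na tau', exists f : normalSubgroup H' -> normalSubgroup H,
    [/\ {in S' i &, injective f}, forall x, S' i x -> S i (f x) &
      S' i #= S i -> f @` S' i = S i].
  by move=> i; apply: (card_le_eq_fun (ker tau)); exact: multle.
have S'P i : S' (rep i) (sval i) by exists (max_na_sub i); exact: repE.
have /choice[N NP] : forall i, exists k : max_na tau,
    sval k = f (rep i) (sval i) /\ iso_over (max_na_epi k) (max_na_epi (rep i)).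
  by move=> i; apply: mult_na_max; have [_ fS _] := fP (rep i); exact/fS/S'P.
have repN i k : N i = N k -> rep i = rep k.
  move=> ik; rewrite -(repK i) -(repK k); apply: rep_eq.
  apply: iso_over_trans (NP k).2; apply: iso_over_sym; rewrite -ik; exact: (NP i).2.
exists N; split=> [i k ik|i|multeq k].
- have [fI _ _] := fP (rep i); apply: max_na_inj.
  apply: fI; [exact/mem_set/S'P|by rewrite (repN _ _ ik); exact/mem_set/S'P|].
  by rewrite -(NP i).1 ik (NP k).1 (repN _ _ ik).
- exact: iso_over_trans (repE i) (iso_over_sym (NP i).2).
(* The class of k occurs on the side of tau' since its two multiplicities agree. *)
have [i ik] : exists i : max_na tau', iso_over (max_na_epi i) (max_na_epi k).
  have Sk : cardinal_set (mult_na tau (max_na_epi k)) (sval k).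
    by exists (max_na_sub k); exact: iso_over_refl.
  have [g [_ gS]] := card_eq_fun (ker tau') (card_esym (multeq (max_na_epi k))).
  have [|i [_ ik]] := @mult_na_max _ _ tau' (max_na_epi k) (g (sval k)).
    by rewrite -gS; exists (sval k).
  by exists i.
have : S (rep i) (sval k).
  by exists (max_na_sub k); apply: iso_over_trans (repE i); exact: iso_over_sym.
have [_ _ <-] := fP (rep i); last exact: multeq.
move=> [M /mult_na_max[m [<- mi]] fm]; exists m; apply: max_na_inj.
by rewrite (NP m).1 (rep_eq _ _ mi) repK.
Qed.

Hypotheses (fund : fundamental tau) (fund' : fundamental tau').
Hypothesis mult_le :
  forall lambda : Lambda G, cardinal_le (mult tau' lambda) (mult tau lambda).
Hypothesis supp_le : forall A : simple_gmodule G, supp tau' A `<=` supp tau A.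

(** The case of equality is included because injectivity concerns the very psi
    obtained from the matching. *)
Lemma dominates_of_mult : exists psi : epi H H', tau =1 tau' \o psi /\
  ((forall lambda : Lambda G, cardinal_eq (mult tau' lambda) (mult tau lambda)) ->
   (forall A : simple_gmodule G, supp tau' A = supp tau A) -> injective psi).
Proof.
(* R indexes the isomorphism classes of the abelian factors ker / N of both sides. *)
pose R0 : Type := (max_ab tau + max_ab tau')%type.
pose A0 (r : R0) : simple_gmodule G :=
  match r with inl r => max_ab_module r | inr r => max_ab_module r end.
have [||| rep [repE rep_eq]] := @class_repr R0 (fun r r' => gmodule_iso (A0 r) (A0 r')).
- by move=> r; exact: gmodule_iso_refl.
- by move=> r r'; exact: gmodule_iso_sym.
- by move=> r r' r''; exact: gmodule_iso_trans.
pose R : choiceType := {classic {r : R0 | rep r = r}}.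
pose A (r : R) : simple_gmodule G := A0 (sval r).
have isoA (r r' : R) : gmodule_iso (A r) (A r') -> r = r'.
  move=> /rep_eq; rewrite (svalP r) (svalP r') => rr'.
  by apply: eq_sig_hprop => // ?; exact: Prop_irrelevance.
have repR (r0 : R0) : exists r : R, gmodule_iso (A0 r0) (A r).
  have rr : rep (rep r0) = rep r0 by exact/esym/rep_eq/repE.
  by exists (exist (fun r => rep r = r) (rep r0) rr); exact: repE.
pose Xt (r : R) := cid (matched_characters (mult_le (Lambda_ab (A r))) (@supp_le (A r))).
have XtP r := svalP (Xt r).
pose X r := (sval (Xt r)).1; pose T r : choiceType := set_type (X r).
pose t' r (x : T r) := sval x; pose t r (x : T r) := (sval (Xt r)).2 (sval x).
have ft' r : free_family [set: T r] (@t' r).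
  by apply: (@free_family_val _ _ _ _ id); have [] := XtP r.
have ft r : free_family [set: T r] (@t r).
  by apply: free_family_val; have [] := XtP r.
have [N [injN isoN surjN]] := matched_nonabelian (fun zeta => mult_le (Lambda_na zeta)).
pose J : choiceType := {classic (max_na tau')}.
(* The matched families: M on the side of H, M' on the side of H'. *)
pose M := mixed_family t (fun i : J => sval (N i)).
pose M' := mixed_family t' (fun i : J => sval i).
have /choice[Gam GamP] : forall k, exists Gam, local_iso tau tau' Gam (M k) (M' k).
  case=> [i|[r x]]; first exact: quotient_local_iso (isoN i).
  have [_ _ _ SS _] := XtP r.
  apply: char_local_iso; last exact/SS/set_valP.
    exact: (free_family_neq0 (@gend1 _ (A r)) (@ft r) I).
  exact: (free_family_neq0 (@gend1 _ (A r)) (@ft' r) I).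
have [||||| psi [psiE psiI]] := glue_local_isos GamP.
- by apply: mixed_family_supplemented => i; exact: max_na_supplemented.
- by apply: mixed_family_supplemented => i; exact: max_na_supplemented.
- apply: mixed_family_independent => // [i|i|i|i k /max_na_inj/injN //].
  + exact: max_na_sub.
  + exact: max_na_supplemented.
  + exact: (svalP (N i)).2.
- apply: mixed_family_independent => // [i|i|i|i k /max_na_inj //].
  + exact: max_na_sub.
  + exact: max_na_supplemented.
  + exact: (svalP i).2.
- move=> x Kx Mx; apply: (fundamental_trivial fund' Kx) => [r0|i]; last exact: (Mx (inl i)).
  have [r iso] := repR (inr r0); have [_ spX _ _ _] := XtP r.
  apply: (C_A_mem (max_ab_C_A r0) iso spX Kx) => phi Xphi.
  by have [_] := Mx (inr (existT _ r (exist _ phi (mem_set Xphi)))).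
exists psi; split => // multeq suppeq; apply: psiI => x Kx Mx.
apply: (fundamental_trivial fund Kx) => [r0|k].
  have [r iso] := repR (inl r0); have [_ _ _ _ sptX] := XtP r.
  have spX := sptX (multeq (Lambda_ab (A r))) (suppeq (A r)).
  apply: (C_A_mem (max_ab_C_A r0) iso spX Kx) => _ [phi Xphi <-].
  by have [_] := Mx (inr (existT _ r (exist _ phi (mem_set Xphi)))).
have [i <-] := surjN (fun zeta => multeq (Lambda_na zeta)) k.
exact: (Mx (inl i)).
Qed.
End Construction.

Section Equivalence.
Variables (G H H' : profiniteGroupType) (tau : epi H G) (tau' : epi H' G).

Lemma dominates_mult_supp : dominates tau tau' ->
  (forall lambda : Lambda G, cardinal_le (mult tau' lambda) (mult tau lambda)) /\
  (forall A : simple_gmodule G, supp tau' A `<=` supp tau A).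
Proof.
move=> [psi psiE]; split; last by move=> A; exact: dominates_supp psiE A.
by case=> [A|zeta]; [exact: dominates_mult_ab psiE A|exact: dominates_mult_na psiE zeta].
Qed.

Lemma iso_over_dominates : iso_over tau' tau -> dominates tau' tau.
Proof.
move=> [f fiso fe]; have [f1 f1E] := is_iso_epi fiso.
by exists f1 => x; rewrite /= f1E; exact: fe.
Qed.
End Equivalence.

Theorem corollary8p10 (G H H' : profiniteGroupType)
    (tau : epi H G) (tau' : epi H' G)
    (tau_fund : fundamental tau) (tau'_fund : fundamental tau') :
  (dominates tau tau' <->
     (forall lambda : Lambda G,
        cardinal_le (mult tau' lambda) (mult tau lambda)) /\
     (forall A : simple_gmodule G, supp tau' A `<=` supp tau A)) /\
  (iso_over tau' tau <->
     (forall lambda : Lambda G,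
        cardinal_eq (mult tau' lambda) (mult tau lambda)) /\
     (forall A : simple_gmodule G, supp tau' A = supp tau A)).
Proof.
split; split.
- exact: dominates_mult_supp.
- move=> [multle supple].
  have [psi [psiE _]] := dominates_of_mult tau_fund tau'_fund multle supple.
  by exists psi.
- move=> iso.
  have [le' sub'] := dominates_mult_supp (iso_over_dominates iso).
  have [le sub] := dominates_mult_supp (iso_over_dominates (iso_over_sym iso)).
  split=> [lambda|A]; last by apply/seteqP; split; [exact: sub|exact: sub'].
  by apply/card_eqPle; split; [exact: le|exact: le'].
- move=> [multeq suppeq].
  have multle lambda : cardinal_le (mult tau' lambda) (mult tau lambda).
    by have /card_eqPle[] := multeq lambda.
  have supple A : supp tau' A `<=` supp tau A by rewrite suppeq.
  have [psi [psiE psiI]] := dominates_of_mult tau_fund tau'_fund multle supple.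
  apply: iso_over_sym; exists psi => //.
  by apply: injective_epi_is_iso; exact: psiI.
Qed.
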